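(* Assume $\dim E=1$. Let $N$ be an invariant subspace of $S_E\oplus S_F^*$. Then $N=\ker(W_\Psi)$ for some $\Psi\in\Lambda^\infty_{E\oplus F}$. If, furthermore, $\dim F<\infty$ and $N$ is a type I invariant subspace, then there is a partial isometry $W_\Psi$ (with $\Psi\in\Lambda^\infty_{E\oplus F}$) such that $N=\ker(W_\Psi)$.
   Context: $E$ and $F$ are complex separable Hilbert spaces; subspaces are closed. $L_E^2$ is the space of square integrable $E$-valued functions on the unit circle $\mathbb T$ and $H_E^2\subset L_E^2$ the $E$-valued Hardy space. $L^\infty_{B(E,F)}$ is the space of bounded measurable functions on $\mathbb T$ with values in $B(E,F)$ (bounded operators from $E$ to $F$), and $H^\infty_{B(E,F)}$ the bounded analytic ones; $B(E)=B(E,E)$. $P$ is the orthogonal projection of a vector-valued $L^2$ space onto the corresponding $H^2$. $S_E=T_z$ is the shift (multiplication by $z$) on $H_E^2$, and $M_z$ is multiplication by $z$ on $L^2_E$ or $L^2_F$. For $\Phi\in L^\infty_{B(E,F)}$ the Toeplitz operator $T_\Phi:H_E^2\to H_F^2$ is $T_\Phi h=P[\Phi h]$, and the Hankel operator $H_\Phi:H_E^2\to H_F^2$ is $H_\Phi h=PJ[\Phi h]$, where $Jf(z)=\overline z f(\overline z)$ for $f\in L_F^2$. (Likewise for other pairs of spaces.) $\Lambda^\infty_{E\oplus F}$ is the set of all symbols $$\Psi(z)=\begin{bmatrix} C(z)&D(z)\\ A(z)&B(z)\end{bmatrix}:E\oplus F\to E\oplus F$$ with $A\in H^\infty_{B(E,F)}$,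 $B\in H^\infty_{B(F)}$, $C\in L^\infty_{B(E)}$, $D\in L^\infty_{B(F,E)}$. For such $\Psi$, $$W_\Psi=\begin{bmatrix} H_C^*&T_A^*\\ H_D^*&T_B^*\end{bmatrix}:H_E^2\oplus H_F^2\to H_E^2\oplus H_F^2 .$$ Type I: let $J_2$ be the unitary on $L_E^2\oplus H_F^2$ given by $J_2(f\oplus g)=f(\overline z)\oplus g(z)$. Each invariant subspace $N$ of $S_E\oplus S_F^*$ corresponds to a unique invariant subspace $N_3$ of $M_z\oplus M_z$ on $L_E^2\oplus L_F^2$ with $zH_E^2\subset N_3\subset L_E^2\oplus H_F^2$, via $N=(L_E^2\oplus H_F^2)\ominus J_2N_3$. $N$ is type I if the corresponding $N_3$ is of the form $N_3=UH_{E_0}^2$ with $\{0\}\ne E_0\subset E\oplus F$ and $U\in L^\infty_{B(E_0,E\oplus F)}$ isometry-valued ($U(z)^*U(z)=I_{E_0}$ a.e. $z\in\mathbb T$). *)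

(* Defs.v *)
From HB Require Import structures.
From mathcomp Require Import all_boot all_order all_algebra.
From mathcomp Require Import all_classical all_reals all_analysis.
From mathcomp Require Import complex ring.

Set Implicit Arguments.
Unset Strict Implicit.
Unset Printing Implicit Defensive.

Import Order.TTheory GRing.Theory Num.Theory.
Import numFieldNormedType.Exports.

Local Open Scope classical_set_scope.
Local Open Scope ring_scope.

HB.mixin Record NormedModule_hasInner (R : realType) E
    & NormedModule R[i] E := {
  inner : E -> E -> R[i] ;
  innerDl : forall (a : R[i]) (x y z : E),
    inner (a *: x + y) z = a * inner x z + inner y z ;
  innerC : forall x y : E, inner y x = (inner x y)^* ;
  inner_norm : forall x : E, inner x x = `|x| ^+ 2
}.

#[short(type="hilbertType")]
HB.structure Definition Hilbert (R : realType) :=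
  {E of NormedModule_hasInner R E & CompleteNormedModule R[i] E}.

(* The product of normed modules carries the max norm; this copy carries the
   Hilbert space direct sum structure. *)
Definition dsum (E F : Type) : Type := (E * F)%type.

Section DirectSum.
Context (R : realType) (E F : hilbertType R).
Local Notation C := R[i].
Implicit Types x y z : dsum E F.

HB.instance Definition _ := GRing.Lmodule.copy (dsum E F) (E * F)%type.

Definition dnorm x : C := sqrtC (`|x.1| ^+ 2 + `|x.2| ^+ 2).

Let dnorm2 x : dnorm x ^+ 2 = `|x.1| ^+ 2 + `|x.2| ^+ 2.
Proof. exact: sqrtCK. Qed.

Let dnorm_ge0 x : 0 <= dnorm x.
Proof. by rewrite sqrtC_ge0 addr_ge0 ?exprn_ge0. Qed.

Let minkowski (a b c d : C) : 0 <= a -> 0 <= b -> 0 <= c -> 0 <= d ->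
  sqrtC ((a + b) ^+ 2 + (c + d) ^+ 2) <=
  sqrtC (a ^+ 2 + c ^+ 2) + sqrtC (b ^+ 2 + d ^+ 2).
Proof.
move=> a0 b0 c0 d0.
set p := a ^+ 2 + c ^+ 2; set q := b ^+ 2 + d ^+ 2.
have p0 : 0 <= p by rewrite addr_ge0 ?exprn_ge0.
have q0 : 0 <= q by rewrite addr_ge0 ?exprn_ge0.
have sp : 0 <= sqrtC p by rewrite sqrtC_ge0.
have sq : 0 <= sqrtC q by rewrite sqrtC_ge0.
rewrite -(@ler_pXn2r _ 2)// ?nnegrE ?sqrtC_ge0 ?addr_ge0 ?exprn_ge0 ?addr_ge0//.
rewrite sqrtCK !sqrrD !sqrtCK -sqrtCM ?nnegrE//.
have -> : a ^+ 2 + a * b *+ 2 + b ^+ 2 + (c ^+ 2 + c * d *+ 2 + d ^+ 2) =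
  p + (a * b + c * d) *+ 2 + q by rewrite /p /q; ring.
rewrite lerD2r lerD2l lerMn2r/=.
rewrite -(@ler_pXn2r _ 2)// ?nnegrE ?sqrtC_ge0 ?mulr_ge0//; last first.
  by rewrite addr_ge0 ?mulr_ge0.
rewrite sqrtCK -subr_ge0.
have -> : p * q - (a * b + c * d) ^+ 2 = (a * d - b * c) ^+ 2.
  by rewrite /p /q; ring.
by rewrite real_exprn_even_ge0// rpredB// rpredM// ger0_real.
Qed.

Let ler_dnormD x y : dnorm (x + y) <= dnorm x + dnorm y.
Proof.
apply: le_trans (minkowski _ _ _ _) => //.
by rewrite ler_sqrtC ?nnegrE ?addr_ge0 ?exprn_ge0 ?addr_ge0// lerD//
  ler_pXn2r ?nnegrE ?addr_ge0//; exact: ler_normD.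
Qed.

Let dnormZ (a : C) x : dnorm (a *: x) = `|a| * dnorm x.
Proof.
rewrite /dnorm /= !normrZ !exprMn -mulrDr sqrtCM ?nnegrE ?addr_ge0 ?exprn_ge0//.
by rewrite sqrCK.
Qed.

Let dnorm0_eq0 x : dnorm x = 0 -> x = 0.
Proof.
case: x => x y /eqP; rewrite sqrtC_eq0 paddr_eq0 ?exprn_ge0//= !sqrf_eq0 !normr_eq0.
by move=> /andP[/eqP -> /eqP ->].
Qed.

HB.instance Definition _ :=
  Lmodule_isNormed.Build C (dsum E F) ler_dnormD dnormZ dnorm0_eq0.

Let normE x : `|x| = dnorm x. Proof. by []. Qed.

Let norm_fst x : `|x.1| <= `|x|.
Proof.
rewrite normE -(@ler_pXn2r _ 2)// ?nnegrE// dnorm2.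
by rewrite lerDl exprn_ge0.
Qed.

Let norm_snd x : `|x.2| <= `|x|.
Proof.
rewrite normE -(@ler_pXn2r _ 2)// ?nnegrE// dnorm2.
by rewrite lerDr exprn_ge0.
Qed.

Let norm_le x : `|x| <= `|x.1| + `|x.2|.
Proof.
rewrite normE -(@ler_pXn2r _ 2)// ?nnegrE ?addr_ge0// dnorm2 sqrrD.
by rewrite lerD2r lerDl mulrn_wge0 ?mulr_ge0.
Qed.

Let complete (G : set_system (dsum E F)) : ProperFilter G -> cauchy G -> cvg G.
Proof.
move=> FG /cauchy_ballP Gc.
have G1 : cauchy (fst @ G).
  apply/cauchy_ballP => e e0; have [[P Q] /= [GP GQ] PQ] := Gc e e0.
  exists (fst @` P, fst @` Q).
    split; [apply: filterS GP|apply: filterS GQ] => z ?; by exists z.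
  move=> [_ _] [/= [z Pz <-] [t Qt <-]].
  have := PQ (z, t) (conj Pz Qt).
  by rewrite /= -!ball_normE /= => /(le_lt_trans _); apply; exact: (norm_fst (z - t)).
have G2 : cauchy (snd @ G).
  apply/cauchy_ballP => e e0; have [[P Q] /= [GP GQ] PQ] := Gc e e0.
  exists (snd @` P, snd @` Q).
    split; [apply: filterS GP|apply: filterS GQ] => z ?; by exists z.
  move=> [_ _] [/= [z Pz <-] [t Qt <-]].
  have := PQ (z, t) (conj Pz Qt).
  by rewrite /= -!ball_normE /= => /(le_lt_trans _); apply; exact: (norm_snd (z - t)).
have C1 : cvg (fst @ G) by apply: cauchy_cvg.
have [l1 /cvgrPdist_lt l1P] := (cvg_ex _).1 C1.
have C2 : cvg (snd @ G) by apply: cauchy_cvg.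
have [l2 /cvgrPdist_lt l2P] := (cvg_ex _).1 C2.
apply/cvg_ex; exists ((l1, l2) : dsum E F); apply/cvgrPdist_lt => e e0.
have e20 : 0 < e / 2 by rewrite divr_gt0.
have := l1P _ e20; have := l2P _ e20.
apply: filterS2 => z z2 z1; apply: le_lt_trans (norm_le _) _.
by rewrite (splitr e) ltrD.
Qed.

HB.instance Definition _ := Uniform_isComplete.Build (dsum E F) complete.

Definition dinner x y : C := inner x.1 y.1 + inner x.2 y.2.

Let dinnerDl (a : C) x y z :
  dinner (a *: x + y) z = a * dinner x z + dinner y z.
Proof. by rewrite /dinner /= !innerDl mulrDr addrACA. Qed.

Let dinnerC x y : dinner y x = (dinner x y)^*.
Proof. by rewrite /dinner rmorphD /= -!innerC. Qed.

Let dinner_norm x : dinner x x = `|x| ^+ 2.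
Proof. by rewrite normE dnorm2 /dinner !inner_norm. Qed.

HB.instance Definition _ :=
  NormedModule_hasInner.Build R (dsum E F) dinnerDl dinnerC dinner_norm.

End DirectSum.

Definition separable (T : topologicalType) : Prop :=
  exists2 A : set T, countable A & dense A.

Definition has_dim (R : realType) (E : hilbertType R) (n : nat) : Prop :=
  inhabited (Vector.axiom n E).

Record circle (R : realType) := Circle {
  cval :> R[i] ;
  cvalP : `|cval| == 1
}.

HB.instance Definition _ (R : realType) := [isSub for @cval R].
HB.instance Definition _ (R : realType) := [Choice of circle R by <:].

Section Circle.
Context {R : realType}.

Let one_subproof : `|1 : R[i]| == 1. Proof. by rewrite normr1. Qed.

HB.instance Definition _ := isPointed.Build (circle R) (Circle one_subproof).

Let conj_subproof (z : circle R) : `|(z : R[i])^*| == 1.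
Proof. by rewrite norm_conjC cvalP. Qed.

Definition cconj (z : circle R) : circle R := Circle (conj_subproof z).

Let expi_subproof (t : R) : `|cos t +i* sin t : R[i]|%C == 1.
Proof. by rewrite normc_def /= cos2Dsin2 sqrtr1. Qed.

Definition expi (t : measurableTypeR R) : circle R := Circle (expi_subproof t).

(* The sigma-algebra on the circle is the one coinduced by [t |-> e^(it)],
   which is the Borel sigma-algebra. *)
Definition circle_measurable : set (set (circle R)) :=
  [set A | measurable (expi @^-1` A)].

Let circle_measurable0 : circle_measurable set0.
Proof. by rewrite /circle_measurable /= preimage_set0; exact: measurable0. Qed.

Let circle_measurableC A : circle_measurable A -> circle_measurable (~` A).
Proof.
by rewrite /circle_measurable /= preimage_setC; exact: measurableC.
Qed.

Let circle_measurable_bigcup (A : (set (circle R))^nat) :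
  (forall i, circle_measurable (A i)) -> circle_measurable (\bigcup_i A i).
Proof.
move=> mA; rewrite /circle_measurable /= preimage_bigcup.
by apply: bigcupT_measurable => i; exact: mA.
Qed.

HB.instance Definition _ := @isMeasurable.Build default_measure_display
  (circle R) circle_measurable circle_measurable0 circle_measurableC
  circle_measurable_bigcup.

Lemma measurable_expi : measurable_fun [set: measurableTypeR R] expi.
Proof. by move=> _ A mA; rewrite setTI. Qed.

HB.instance Definition _ :=
  isMeasurableFun.Build _ _ _ _ expi measurable_expi.

Let twopi_gt0 : 0 < 2 * pi :> R. Proof. by rewrite mulr_gt0// pi_gt0. Qed.

(* Normalized arc_length length. *)
Definition arc_length : probability (circle R) R :=
  distribution (uniform_prob twopi_gt0) expi.

End Circle.

(* Elements of the L^2 and L^oo spaces are represented by functions on the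
   circle, which are equal in these spaces when they agree almost everywhere.
   The sets of functions called subspaces below are closed for the L^2 seminorm
   within the square integrable functions, hence saturated for a.e. equality. *)
Section FunctionSpaces.
Context {R : realType}.
Local Notation C := R[i].
Local Notation T := (circle R).
Implicit Types E F G : hilbertType R.

(* On a separable Hilbert space weak and strong measurability coincide. *)
Definition wmeasurable G (f : T -> G) : Prop := forall x : G,
  measurable_fun setT (fun z => complex.Re (inner (f z) x)) /\
  measurable_fun setT (fun z => complex.Im (inner (f z) x)).

Definition sqnorm G (f : T -> G) : \bar R :=
  (\int[arc_length]_z ((complex.Re `|f z|) ^+ 2)%:E)%E.

Definition L2 G : set (T -> G) :=
  [set f | wmeasurable f /\ (sqnorm f < +oo)%E].

Definition ip G (f g : T -> G) : C :=
  Complex (\int[arc_length]_z complex.Re (inner (f z) (g z)))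
          (\int[arc_length]_z complex.Im (inner (f z) (g z))).

(* [ip f (fun z => (cval z)^* ^+ n *: x)] is the inner product with [x] of the
   Fourier coefficient of [f] of index [- n]. *)
Definition H2 G : set (T -> G) :=
  [set f | L2 f /\ forall (n : nat) (x : G), (0 < n)%N ->
     ip f (fun z => ((z : C)^* ^+ n) *: x) = 0].

Definition H2in G (G0 : set G) : set (T -> G) :=
  [set f | H2 f /\ \forall z \ae arc_length, G0 (f z)].

Definition linear_subspace (V : lmodType C) (V0 : set V) : Prop :=
  V0 0 /\ forall (a : C) x y, V0 x -> V0 y -> V0 (a *: x + y).

Definition subspaceL2 G (N : set (T -> G)) : Prop :=
  [/\ N `<=` @L2 G, N (fun=> 0),
      forall (a : C) f g, N f -> N g -> N (fun z => a *: f z + g z) &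
      forall (u : (T -> G)^nat) f, (forall n, N (u n)) -> L2 f ->
        sqnorm (fun z => u n z - f z) @[n --> \oo] --> 0%E -> N f].

Definition invariant_subspace G (X : (T -> G) -> (T -> G)) (N : set (T -> G)) : Prop :=
  subspaceL2 N /\ forall f, N f -> N (X f).

Definition ominus G (M N : set (T -> G)) : set (T -> G) :=
  [set f | M f /\ forall g, N g -> ip f g = 0].

(* The values of [Phi z] outside the subspace [D] are irrelevant: [Linfty D Phi]
   means that [Phi] represents an element of [L^oo_B(D,F)]. *)
Definition Linfty E F (D : set E) (Phi : T -> E -> F) : Prop :=
  [/\ forall z (a : C) x y, D x -> D y ->
        Phi z (a *: x + y) = a *: Phi z x + Phi z y,
      exists M : R, forall z x, D x -> `|Phi z x| <= M%:C%C * `|x| &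
      forall x, D x -> wmeasurable (fun z => Phi z x)].

Definition Hinfty E F (Phi : T -> E -> F) : Prop :=
  Linfty setT Phi /\ forall x, H2 (fun z => Phi z x).

Definition isometry_valued E F (D : set E) (Phi : T -> E -> F) : Prop :=
  \forall z \ae arc_length, forall x y, D x -> D y ->
    inner (Phi z x) (Phi z y) = inner x y.

Definition mulz G (f : T -> G) : T -> G := fun z => (z : C) *: f z.

Definition Jflip G (f : T -> G) : T -> G :=
  fun z => (z : C)^* *: f (cconj z).

(* Both functions below are determined up to a.e. equality, on [L2] for the
   projection and on [H2] for the adjoint of a bounded operator between Hardy
   spaces. *)
Definition projH2 G (f : T -> G) : T -> G :=
  xget (fun=> 0) [set g | H2 g /\ forall h, H2 h -> ip (fun z => f z - g z) h = 0].

Definition adjoint E F (X : (T -> E) -> (T -> F)) (g : T -> F) : T -> E :=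
  xget (fun=> 0) [set f | H2 f /\ forall u, H2 u -> ip (X u) g = ip u f].

Definition toeplitz E F (Phi : T -> E -> F) (h : T -> E) : T -> F :=
  projH2 (fun z => Phi z (h z)).

Definition hankel E F (Phi : T -> E -> F) (h : T -> E) : T -> F :=
  projH2 (Jflip (fun z => Phi z (h z))).

Definition ker G (H : set (T -> G)) (X : (T -> G) -> (T -> G)) :
    set (T -> G) :=
  [set f | H f /\ \forall z \ae arc_length, X f z = 0].

Definition partial_isometry G (H : set (T -> G)) (X : (T -> G) -> (T -> G)) :
    Prop :=
  forall f, ominus H (ker H X) f -> sqnorm (X f) = sqnorm f.

End FunctionSpaces.

Section ModelSpace.
Context {R : realType} {E F : hilbertType R}.
Local Notation T := (circle R).

Definition pairf (f : T -> E) (g : T -> F) : T -> dsum E F :=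
  fun z => (f z, g z).
Definition fstf (w : T -> dsum E F) : T -> E := fun z => (w z).1.
Definition sndf (w : T -> dsum E F) : T -> F := fun z => (w z).2.

Definition oplus (M : set (T -> E)) (N : set (T -> F)) : set (T -> dsum E F) :=
  [set w | M (fstf w) /\ N (sndf w)].

Definition opsum (X : (T -> E) -> (T -> E)) (Y : (T -> F) -> (T -> F))
    (w : T -> dsum E F) : T -> dsum E F :=
  pairf (X (fstf w)) (Y (sndf w)).

Record symbol := Symbol {
  symC : T -> E -> E ; symD : T -> F -> E ;
  symA : T -> E -> F ; symB : T -> F -> F
}.

Definition Lambda (Psi : symbol) : Prop :=
  [/\ Hinfty (symA Psi), Hinfty (symB Psi),
      Linfty setT (symC Psi) & Linfty setT (symD Psi)].

Definition W (Psi : symbol) (w : T -> dsum E F) : T -> dsum E F :=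
  pairf
    (fun z => adjoint (hankel (symC Psi)) (fstf w) z +
              adjoint (toeplitz (symA Psi)) (sndf w) z)
    (fun z => adjoint (hankel (symD Psi)) (fstf w) z +
              adjoint (toeplitz (symB Psi)) (sndf w) z).

Definition invariant_shift (N : set (T -> dsum E F)) : Prop :=
  N `<=` oplus (@H2 R E) (@H2 R F) /\
  invariant_subspace (opsum (@mulz R E) (adjoint (@mulz R F))) N.

Definition J2 (w : T -> dsum E F) : T -> dsum E F :=
  pairf (fun z => fstf w (cconj z)) (sndf w).

Definition typeI (N : set (T -> dsum E F)) : Prop :=
  exists N3 : set (T -> dsum E F),
    [/\ invariant_subspace (opsum (@mulz R E) (@mulz R F)) N3,
        [set pairf (mulz f) (fun=> 0) | f in @H2 R E] `<=` N3,
        N3 `<=` oplus (@L2 R E) (@H2 R F),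
        N = ominus (oplus (@L2 R E) (@H2 R F)) (J2 @` N3) &
        exists (E0 : set (dsum E F)) (U : T -> dsum E F -> dsum E F),
          [/\ linear_subspace E0 /\ closed E0, exists2 x, E0 x & x != 0,
              Linfty E0 U, isometry_valued E0 U &
              N3 = [set w | L2 w /\ exists2 h, H2in E0 h &
                              \forall z \ae arc_length, w z = U z (h z)]]].

End ModelSpace.

Arguments symbol {R} E F.
Arguments oplus {R E F} M N.

(* Main.v *)
(* Put [N3 = J2 ((L2(E) + H2(F)) - N)], a subspace invariant under multiplication
   by [z] with [N] recovered as the set of [w] in [H2(E) + H2(F)] orthogonal to
   [J2 N3].  If a symbol [Psi] is assembled from a bounded function [Psi0] with
   values in [B(E + F)], its first row being multiplied by the conjugate of [z],
   then [W_Psi^*] is [h |-> P J2 (Psi0 h)], so that [ker W_Psi] consists of the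
   [w] orthogonal to [J2 (Psi0 h)] for every [h] in [H2].

   If [N3 = U H2(E0)], take [Psi0 = U P_E0]: the projection onto [H2 + H2] maps
   [J2 N3] into itself, so [W_Psi^*] is a partial isometry.

   In general let [e_k] be an orthogonal basis of the wandering subspace
   [N3 - z N3].  The pointwise inner products [<e_j(z), e_k(z)>] are a.e. constant,
   so that the values [x_k = e_k(z0)] at a suitable point [z0] are orthogonal, and
   [Psi0(z) x = sum_k c_k <x, x_k> e_k(z)] works when [N3] has no reducing part.
   Otherwise, because [dim E = 1], the reducing part is all of [L2(E)]; it is
   generated, together with [z H2(E)], by the indicator function of an arc. *)

Require Import Defs.
From mathcomp Require Import all_boot all_order all_algebra.
From mathcomp Require Import all_classical all_reals all_analysis.
From mathcomp Require Import measurable_realfun complex ring lra.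

Set Implicit Arguments.
Unset Strict Implicit.
Unset Printing Implicit Defensive.

Import Order.TTheory GRing.Theory Num.Theory.
Import numFieldNormedType.Exports.

Local Open Scope classical_set_scope.
Local Open Scope ring_scope.

(** * Complex numbers and pre-Hilbert spaces *)

(** Functions that agree almost everywhere are never identified. Each space is a set of functions
    with a possibly degenerate inner product, and projection and Riesz representation are proved
    once in that generality. The constancy of <e_j(z), e_k(z)> does double duty. It makes each e_k
    a.e. bounded, as a bounded symbol requires, and it places the orthogonal vectors x_k inside E +
    F itself, so the values of Psi0 act on E + F however large the wandering subspace is. As Psi0(z)
    x_k is a nonzero multiple of e_k(z) whenever x_k is nonzero, testing w against z^n x_k recovers
    orthogonality to J2 (z^n e_k). A kernel depends only on the closure of the range of the adjoint,
    so the c_k need only make the series converge. Wandering vectors cannot reach a reducing part.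
    What helps is that a function q vanishing on a set of positive measure is orthogonal to every g
    orthogonal to all z^n q with n > 0. Repeating this with conj(z)^l q yields all integer
    frequencies. Both an arc and its complement have this property, which is why one indicator
    suffices next to z H2(E). The space J2 (z H2(E)) has only negative frequencies, hence is
    orthogonal to N for free. *)

Local Notation Re := complex.Re.
Local Notation Im := complex.Im.

Section ComplexParts.
Context {R : realType}.
Implicit Types (x y : R[i]) (a : R).

Lemma cReD x y : Re (x + y) = Re x + Re y. Proof. by case: x; case: y. Qed.
Lemma cImD x y : Im (x + y) = Im x + Im y. Proof. by case: x; case: y. Qed.
Lemma cReN x : Re (- x) = - Re x. Proof. by case: x. Qed.
Lemma cImN x : Im (- x) = - Im x. Proof. by case: x. Qed.
Lemma cReM x y : Re (x * y) = Re x * Re y - Im x * Im y.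
Proof. by case: x; case: y. Qed.
Lemma cImM x y : Im (x * y) = Re x * Im y + Im x * Re y.
Proof. by case: x; case: y. Qed.
Lemma cReJ x : Re x^* = Re x. Proof. by case: x. Qed.
Lemma cImJ x : Im x^* = - Im x. Proof. by case: x. Qed.

Lemma cP x y : Re x = Re y -> Im x = Im y -> x = y.
Proof. by case: x => ? ?; case: y => ? ? /= -> ->. Qed.

Definition cn2 x : R := Re x ^+ 2 + Im x ^+ 2.

Lemma cn2_ge0 x : 0 <= cn2 x. Proof. by rewrite addr_ge0 ?sqr_ge0. Qed.

Lemma cn2_eq0 x : cn2 x = 0 -> x = 0.
Proof.
move=> /eqP; rewrite paddr_eq0 ?sqr_ge0// !sqrf_eq0 => /andP[/eqP r /eqP i].
exact: cP.
Qed.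

Lemma cn2M x y : cn2 (x * y) = cn2 x * cn2 y.
Proof. by rewrite /cn2 cReM cImM; ring. Qed.

Lemma cn2J x : cn2 x^* = cn2 x.
Proof. by rewrite /cn2 cReJ cImJ sqrrN. Qed.

Lemma cn2R a : cn2 (a%:C)%C = a ^+ 2.
Proof. by rewrite /cn2 /= expr0n addr0. Qed.

Lemma cmulJ x : x * x^* = (cn2 x)%:C%C.
Proof.
by apply: cP; rewrite ?cReM ?cImM cReJ cImJ /cn2 /=; ring.
Qed.

Lemma cJmul x : x^* * x = (cn2 x)%:C%C.
Proof. by rewrite mulrC cmulJ. Qed.

Lemma cJM x y : (x * y)^* = x^* * y^*. Proof. exact: rmorphM. Qed.
Lemma cJD x y : (x + y)^* = x^* + y^*. Proof. exact: rmorphD. Qed.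
Lemma cJR a : (a%:C%C)^* = a%:C%C.
Proof. by apply: cP; rewrite ?cReJ ?cImJ//= oppr0. Qed.

Lemma cJZmul a x : (a%:C%C * x)^* * x = (a * cn2 x)%:C%C.
Proof. by rewrite cJM cJR -mulrA cJmul rmorphM. Qed.

Lemma c_ge0 x : 0 <= x -> x = ((Re x)%:C)%C /\ 0 <= Re x.
Proof.
by rewrite lecE /= => /andP[/eqP i r]; split=> //; apply: cP.
Qed.

End ComplexParts.

(** The form may be degenerate on [L], which spares a quotient by a.e. equality. Completeness is
    asked only for sequences with fast geometric increments, enough for minimizing sequences. The
    ratio 1/8 leaves a summable 2^-n after the weight 4^n that yields pointwise convergence in
    L^2. *)
Record preHilbert (R : realType) (V : lmodType R[i]) (L : set V)
    (ip : V -> V -> R[i]) : Prop := PreHilbert {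
  ph_lin : linear_subspace L ;
  ph_Dl : forall a f g h, L f -> L g -> L h ->
    ip (a *: f + g) h = a * ip f h + ip g h ;
  ph_C : forall f g, L f -> L g -> ip g f = (ip f g)^* ;
  ph_ge0 : forall f, L f -> 0 <= ip f f ;
  ph_complete : forall u : nat -> V, (forall n, L (u n)) ->
    (forall n, Re (ip (u n.+1 - u n) (u n.+1 - u n)) <= 8^-1 ^+ n) ->
    exists2 l, L l & Re (ip (u n - l) (u n - l)) @[n --> \oo] --> (0 : R)
}.

(** * Projections in a complete semi-inner product space *)

Section PreHilbertTheory.
Context (R : realType) (V : lmodType R[i]) (L : set V) (ip : V -> V -> R[i]).
Hypothesis H : preHilbert L ip.
Implicit Types (f g h : V) (a b : R[i]) (M S : set V).

Definition nsq f : R := Re (ip f f).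

Lemma phL0 : L 0. Proof. by have [] := ph_lin H. Qed.

Lemma phLl a f g : L f -> L g -> L (a *: f + g).
Proof. by have [_] := ph_lin H; apply. Qed.

Lemma phLD f g : L f -> L g -> L (f + g).
Proof. by move=> Lf Lg; rewrite -[f]scale1r; apply: phLl. Qed.

Lemma phLZ a f : L f -> L (a *: f).
Proof. by move=> Lf; rewrite -[_ *: _]addr0; apply: phLl => //; exact: phL0. Qed.

Lemma phLN f : L f -> L (- f).
Proof. by move=> Lf; rewrite -scaleN1r; exact: phLZ. Qed.

Lemma phLB f g : L f -> L g -> L (f - g).
Proof. by move=> Lf Lg; apply: phLD => //; exact: phLN. Qed.

Lemma phDl f g h : L f -> L g -> L h -> ip (f + g) h = ip f h + ip g h.
Proof. by move=> Lf Lg Lh; rewrite -{1}[f]scale1r (ph_Dl H)// mul1r. Qed.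

Lemma ph0l h : L h -> ip 0 h = 0.
Proof.
move=> Lh; have := phDl phL0 phL0 Lh; rewrite addr0 => /eqP.
by rewrite -subr_eq0 opprD addrA subrr sub0r oppr_eq0 => /eqP.
Qed.

Lemma phZl a f h : L f -> L h -> ip (a *: f) h = a * ip f h.
Proof.
move=> Lf Lh; rewrite -[_ *: _]addr0 (ph_Dl H)//; last exact: phL0.
by rewrite ph0l ?addr0.
Qed.

Lemma phNl f h : L f -> L h -> ip (- f) h = - ip f h.
Proof. by move=> Lf Lh; rewrite -scaleN1r phZl// mulN1r. Qed.

Lemma phBl f g h : L f -> L g -> L h -> ip (f - g) h = ip f h - ip g h.
Proof. by move=> Lf Lg Lh; rewrite phDl ?phNl//; exact: phLN. Qed.

Lemma phDr f g h : L f -> L g -> L h -> ip f (g + h) = ip f g + ip f h.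
Proof.
move=> Lf Lg Lh; rewrite (ph_C H (phLD Lg Lh))// phDl// rmorphD /=.
by rewrite -!(ph_C H).
Qed.

Lemma phZr a f g : L f -> L g -> ip f (a *: g) = a^* * ip f g.
Proof.
move=> Lf Lg; rewrite (ph_C H (phLZ a Lg))// phZl// rmorphM /=.
by rewrite -(ph_C H).
Qed.

Lemma ph0r f : L f -> ip f 0 = 0.
Proof. by move=> Lf; rewrite (ph_C H phL0)// ph0l// rmorph0. Qed.

Lemma phNr f g : L f -> L g -> ip f (- g) = - ip f g.
Proof. by move=> Lf Lg; rewrite -scaleN1r phZr// rmorphN rmorph1 mulN1r. Qed.

Lemma phBr f g h : L f -> L g -> L h -> ip f (g - h) = ip f g - ip f h.
Proof. by move=> Lf Lg Lh; rewrite phDr ?phNr//; exact: phLN. Qed.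

Lemma phC0 f g : L f -> L g -> ip f g = 0 -> ip g f = 0.
Proof. by move=> Lf Lg fg; rewrite (ph_C H)// fg rmorph0. Qed.

Lemma phff f : L f -> ip f f = (nsq f)%:C%C.
Proof. by move=> /(ph_ge0 H)/c_ge0[]. Qed.

Lemma nsq_ge0 f : L f -> 0 <= nsq f.
Proof. by move=> /(ph_ge0 H)/c_ge0[]. Qed.

Lemma nsqD f g : L f -> L g -> nsq (f + g) = nsq f + nsq g + Re (ip f g) *+ 2.
Proof.
move=> Lf Lg; rewrite /nsq phDl// ?phDr//; try exact: phLD.
by rewrite !cReD (ph_C H Lf Lg) cReJ; ring.
Qed.

Lemma nsqZ a f : L f -> nsq (a *: f) = cn2 a * nsq f.
Proof.
move=> Lf; rewrite {1}/nsq phZl ?phZr//; try exact: phLZ.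
by rewrite mulrA cmulJ phff// cReM /=; ring.
Qed.

Lemma nsqN f : L f -> nsq (- f) = nsq f.
Proof. by move=> Lf; rewrite -scaleN1r nsqZ// /cn2 /= oppr0; ring. Qed.

Lemma nsqB f g : L f -> L g -> nsq (f - g) = nsq f + nsq g - Re (ip f g) *+ 2.
Proof.
by move=> Lf Lg; rewrite nsqD ?nsqN ?phNr// ?cReN ?mulNrn//; exact: phLN.
Qed.

Lemma nsqBC f g : L f -> L g -> nsq (f - g) = nsq (g - f).
Proof. by move=> Lf Lg; rewrite -nsqN ?opprB//; exact: phLB. Qed.

Lemma ph_CS f g : L f -> L g -> cn2 (ip f g) <= nsq f * nsq g.
Proof.
move=> Lf Lg.
have key (t : R) : 0 <= nsq f - t * cn2 (ip f g) *+ 2 + t ^+ 2 * cn2 (ip f g) * nsq g.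
  have := nsq_ge0 (phLB Lf (phLZ ((t%:C)%C * ip f g) Lg)).
  rewrite nsqB// ?nsqZ ?phZr//; try exact: phLZ.
  rewrite cn2M cn2R cJZmul.
  by rewrite /=; congr (_ <= _); ring.
set c := cn2 _ in key *; have c0 : 0 <= c := cn2_ge0 _.
have f0 := nsq_ge0 Lf; have g0 := nsq_ge0 Lg.
have [g1|g1] := eqVneq (nsq g) 0.
  move: c0; rewrite le_eqVlt => /predU1P[<-|c0]; first by rewrite mulr_ge0.
  (* When [nsq g] vanishes the quadratic in t is affine, and this t makes it negative. *)
  have := key ((nsq f + 1) / c); rewrite g1 mulr0 addr0 divfK ?gt_eqF// mulr2n.
  by move=> ?; exfalso; lra.
have := key (nsq g)^-1.
have -> : nsq f - (nsq g)^-1 * c *+ 2 + (nsq g)^-1 ^+ 2 * c * nsq g =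
  (nsq f * nsq g - c) / nsq g by field.
by rewrite pmulr_lge0 ?subr_ge0// invr_gt0 lt_neqAle eq_sym g1.
Qed.

Lemma nsqD_le f g : L f -> L g -> nsq (f + g) <= 2 * nsq f + 2 * nsq g.
Proof.
move=> Lf Lg; have := nsq_ge0 (phLB Lf Lg).
by rewrite nsqB// nsqD// !mulr2n => ?; lra.
Qed.

(** This is |e f - g|^2 >= 0 divided by e. A factor 1 + e close to 1 lets an infimum of squared
    distances pass to a limit without square roots. *)
Lemma nsqD_eps (e : R) f g : 0 < e -> L f -> L g ->
  nsq (f + g) <= (1 + e) * nsq f + (1 + e^-1) * nsq g.
Proof.
move=> e0 Lf Lg; rewrite nsqD//.
have := nsq_ge0 (phLB (phLZ (e%:C)%C Lf) Lg).
rewrite nsqB// ?nsqZ ?phZl//; try exact: phLZ.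
rewrite cn2R cReM /= mul0r subr0 => h.
have : 0 <= e^-1 * (e ^+ 2 * nsq f + nsq g - e * Re (ip f g) *+ 2).
  by rewrite mulr_ge0// invr_ge0 ltW.
have -> : e^-1 * (e ^+ 2 * nsq f + nsq g - e * Re (ip f g) *+ 2) =
  e * nsq f + e^-1 * nsq g - Re (ip f g) *+ 2 by field; rewrite gt_eqF.
by move: (e^-1) => e'; rewrite !mulr2n !mulrDl !mul1r => ?; lra.
Qed.

Definition closed_sub M := [/\ M `<=` L, linear_subspace M &
  forall (u : nat -> V) f, (forall n, M (u n)) -> L f ->
    nsq (u n - f) @[n --> \oo] --> (0 : R) -> M f].

Definition orth S : set V := [set f | L f /\ forall s, S s -> ip f s = 0].

Lemma closed_subB M f g : closed_sub M -> M f -> M g -> M (f - g).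
Proof.
by move=> [_ [_ Ml] _] Mf Mg; rewrite addrC -scaleN1r; apply: Ml.
Qed.

Lemma closed_sub_ae M f g : closed_sub M -> M f -> L g -> nsq (f - g) = 0 -> M g.
Proof.
move=> [_ _ Mc] Mf Lg fg; apply: (Mc (fun=> f)) => //.
by rewrite fg; exact: cvg_cst.
Qed.

Lemma orth_closed S : S `<=` L -> closed_sub (orth S).
Proof.
move=> SL; split.
- by move=> f [].
- split; first by split=> [|s /SL Ls]; [exact: phL0|exact: ph0l].
  move=> a f g [Lf fS] [Lg gS]; split; first exact: phLl.
  by move=> s Ss; rewrite (ph_Dl H)// ?fS ?gS ?mulr0 ?addr0//; exact: SL.
- move=> u f uS Lf uf; split=> // s Ss; have Ls := SL _ Ss.
  apply: cn2_eq0; apply/eqP; rewrite eq_le cn2_ge0 andbT.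
  have le n : cn2 (ip f s) <= nsq (u n - f) * nsq s.
    have [Lu us] := uS n.
    have := ph_CS (phLB Lu Lf) Ls; rewrite phBl// us// sub0r.
    by rewrite /cn2 cReN cImN !sqrrN.
  have cv : nsq (u n - f) * nsq s @[n --> \oo] --> 0 * nsq s.
    by apply: cvgM => //; exact: cvg_cst.
  rewrite mul0r in cv.
  have := cvg_lim _ cv; move=> <-//.
  by apply: limr_ge; [apply/cvg_ex; exists 0|near=> n; exact: le].
Unshelve. all: by end_near. Qed.

Lemma exp8_cvg : (8^-1 ^+ n : R) @[n --> \oo] --> (0 : R).
Proof. by apply: cvg_expr; rewrite ger0_norm// invf_lt1// ltr1n. Qed.

Theorem projection M f : closed_sub M -> L f ->
  exists2 g, M g & forall h, M h -> ip (f - g) h = 0.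
Proof.
move=> [ML [M0 Ml] Mc] Lf.
pose D := [set nsq (f - h) | h in M].
have D0 : D !=set0 by exists (nsq (f - 0)), 0.
have Dlb : has_lbound D.
  by exists 0 => _ [h Mh <-]; apply: nsq_ge0; apply: phLB => //; exact: ML.
pose d := inf D.
have dle h : M h -> d <= nsq (f - h) by move=> Mh; apply: ge_inf => //; exists h.
(* With this tolerance the parallelogram identity bounds the squared increments by 2 (1/4) 8^-n (1 +
   1/8), below the 8^-n that completeness asks for. *)
have e0 n : (0 : R) < 4^-1 * 8^-1 ^+ n by rewrite mulr_gt0 ?exprn_gt0 ?invr_gt0.
have appr n : exists h, M h /\ nsq (f - h) < d + 4^-1 * 8^-1 ^+ n.
  have [_ [h Mh <-] hd] := @inf_adherent _ D _ (e0 n) (conj D0 Dlb).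
  by exists h.
have [u uP] := choice appr.
have Mu n : M (u n) := (uP n).1.
have Lu n : L (u n) := ML _ (Mu n).
have step n : nsq (u n.+1 - u n) <= 8^-1 ^+ n.
  have Mm : M (2^-1 *: (u n + u n.+1)).
    by rewrite -[_ *: _]addr0; apply: (Ml) => //; rewrite -[u n]scale1r; apply: (Ml).
  have fm : (f - u n) + (f - u n.+1) = 2 *: (f - 2^-1 *: (u n + u n.+1)).
    rewrite scalerBr scalerA divff ?pnatr_eq0// scale1r addrACA -opprD.
    by rewrite scaler_nat mulr2n.
  have := dle _ Mm; have := uP n; have := uP n.+1.
  have Lfn k : L (f - u k) by apply: phLB.
  have := nsqB (Lfn n) (Lfn n.+1); have := nsqD (Lfn n) (Lfn n.+1).
  rewrite fm nsqZ; last by apply: phLB => //; exact: ML.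
  have -> : cn2 (2 : R[i]) = 4.
    by rewrite -[2](rmorph_nat (real_complex R)) cn2R; ring.
  have -> : f - u n - (f - u n.+1) = u n.+1 - u n by rewrite opprB addrC addrA subrK.
  rewrite exprS !mulr2n => h1 h2 [_ h3] [_ h4] h5.
  have h6 : (0:R) < 8^-1 ^+ n by rewrite exprn_gt0// invr_gt0.
  by rewrite -/(nsq _); lra.
have [g Lg ug] := ph_complete H Lu step.
have Mg : M g by apply: (Mc u).
have gd : nsq (f - g) <= d.
  apply/ler_addgt0Pr => e e1.
  have Lgu n : L (u n - g) by apply: phLB.
  have le (r : R) : 0 < r -> nsq (f - g) <= (1 + r) * d.
    move=> r0.
    have le n : nsq (f - g) <= (1 + r) * (d + 4^-1 * 8^-1 ^+ n) + (1 + r^-1) * nsq (u n - g).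
      have -> : f - g = (f - u n) + (u n - g) by rewrite addrA subrK.
      apply: le_trans (nsqD_eps r0 _ _) _ => //; first exact: phLB.
      by rewrite lerD2r ler_pM2l ?addr_gt0// ltW// (uP n).2.
    have cv : (1 + r) * (d + 4^-1 * 8^-1 ^+ n) + (1 + r^-1) * nsq (u n - g)
        @[n --> \oo] --> (1 + r) * (d + 4^-1 * 0) + (1 + r^-1) * 0.
      apply: cvgD; apply: cvgM => //; try exact: cvg_cst.
      by apply: cvgD; [exact: cvg_cst|apply: cvgM; [exact: cvg_cst|exact: exp8_cvg]].
    rewrite !mulr0 !addr0 in cv.
    rewrite -(cvg_lim _ cv)//.
    by apply: limr_ge; [apply/cvg_ex; eexists; exact: cv|near=> n; exact: le].
  have d0 : 0 <= d.
    by apply: lb_le_inf => // _ [h Mh <-]; apply: nsq_ge0; apply: phLB => //; exact: ML.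
  (* For r = e / (d + 1) the excess r d is at most e; the added 1 covers d = 0. *)
  have r0 : 0 < e / (d + 1) by rewrite divr_gt0// ltr_pwDr.
  apply: le_trans (le _ r0) _; rewrite mulrDl mul1r lerD2l -mulrAC.
  by rewrite ler_pdivrMr ?ltr_pwDr// mulrDr mulr1 lerDl ltW.
exists g => // h Mh; have Lh := ML _ Mh.
set c := ip (f - g) h.
have Lfg : L (f - g) by apply: phLB.
(* Moving g by t c h would bring it closer to f unless c = 0. Since t |h|^2 = 1 - t, minimality
   gives 2 t |c|^2 <= t |c|^2. The 1 in t avoids dividing by |h|^2, which may be zero. *)
pose t : R := (1 + nsq h)^-1.
have t0 : 0 < 1 + nsq h by rewrite ltr_pwDl// nsq_ge0.
have Mt : M ((t%:C)%C * c *: h + g) by apply: (Ml).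
have := dle _ Mt.
rewrite opprD addrCA [_ + (f - g)]addrC nsqB//; last exact: phLZ.
rewrite nsqZ// phZr//.
rewrite -/c cn2M cn2R cJZmul.
rewrite /= => h1.
apply: cn2_eq0; apply/eqP; rewrite eq_le cn2_ge0 andbT.
have : t * cn2 c *+ 2 <= t ^+ 2 * cn2 c * nsq h by move: h1 gd; rewrite mulr2n; lra.
have -> : t ^+ 2 * cn2 c * nsq h = t * cn2 c - t ^+ 2 * cn2 c.
  by rewrite /t; field; rewrite gt_eqF.
have : 0 <= t ^+ 2 * cn2 c by rewrite mulr_ge0 ?sqr_ge0 ?cn2_ge0.
rewrite mulr2n => h2 h3.
have : t * cn2 c <= 0 by lra.
by rewrite pmulr_rle0// invr_gt0.
Unshelve. all: by end_near. Qed.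

End PreHilbertTheory.

(** * Double complements, Riesz representation and Gram-Schmidt *)

Section PreHilbertMore.
Context (R : realType) (V : lmodType R[i]) (L : set V) (ip : V -> V -> R[i]).
Hypothesis H : preHilbert L ip.
Local Notation closed_sub := (closed_sub L ip).
Local Notation orth := (orth L ip).
Local Notation nsq := (nsq ip).
Implicit Types (f g h : V) (M S : set V).

Lemma orth_sub S : orth S `<=` L. Proof. by move=> f []. Qed.

Lemma sub_orth_orth S : S `<=` L -> S `<=` orth (orth S).
Proof.
move=> SL f Sf; split=> [|g [Lg gS]]; first exact: SL.
by apply: (phC0 H) => //; [exact: SL|exact: gS].
Qed.

Lemma orth_orth_sub S M : closed_sub M -> S `<=` M -> orth (orth S) `<=` M.
Proof.
move=> cM SM f [Lf fS]; have ML : M `<=` L by case: cM.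
have [g Mg gP] := projection H cM Lf; have Lg := ML _ Mg.
have Lfg := phLB H Lf Lg.
apply: (closed_sub_ae cM Mg Lf).
rewrite (nsqBC H)// /nsq (phBr H)// (gP _ Mg) subr0.
by rewrite (phC0 H)//; apply: fS; split => // s Ss; apply: gP; exact: SM.
Qed.

Lemma orth_decomp S f : S `<=` L -> L f ->
  exists2 p, orth (orth S) p & orth S (f - p).
Proof.
move=> SL Lf.
have [p pS pP] := projection H (orth_closed H (@orth_sub S)) Lf.
exists p => //; split; first by apply: (phLB H) => //; exact: orth_sub pS.
by move=> s Ss; apply: pP; exact: sub_orth_orth.
Qed.

(** The bound on [phi] makes its kernel closed in [M]. The component [q] of [u] orthogonal to that
    kernel then represents [phi] up to a scalar, read off from [phi q]. Linearity is needed only on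
    [M], so [phi] may be arbitrary elsewhere. *)
Theorem riesz M (phi : V -> R[i]) (K : R) : closed_sub M ->
  (forall a f g, M f -> M g -> phi (a *: f + g) = a * phi f + phi g) ->
  (forall f, M f -> cn2 (phi f) <= K * nsq f) ->
  exists2 g, M g & forall f, M f -> phi f = ip f g.
Proof.
move=> cM phil phib; have [ML [M0 Ml] Mc] := cM.
have [[u [Mu u0]]|phi0] := pselect (exists u, M u /\ phi u != 0); last first.
  exists 0 => // f Mf; rewrite (ph0r H); last exact: ML.
  by apply/eqP/negPn/negP => f0; apply: phi0; exists f.
have phiB f g : M f -> M g -> phi (f - g) = phi f - phi g.
  by move=> Mf Mg; rewrite addrC -scaleN1r phil// mulN1r addrC.
pose K0 := [set f | M f /\ phi f = 0].
have cK : closed_sub K0.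
  split.
  - by move=> f [/ML].
  - split=> [|a f g [Mf f0] [Mg g0]].
      by split=> //; rewrite -(subrr 0) phiB// subrr.
    by split; [exact: Ml|rewrite phil// f0 g0 mulr0 addr0].
  - move=> v f vK Lf vf.
    have Mf : M f by apply: Mc vf => // n; case: (vK n).
    split=> //; apply: cn2_eq0; apply/eqP; rewrite eq_le cn2_ge0 andbT.
    have le n : cn2 (phi f) <= K * nsq (v n - f).
      have [Mv v0] := vK n.
      have := phib _ (closed_subB cM Mv Mf); rewrite phiB// v0 sub0r.
      by rewrite /cn2 cReN cImN !sqrrN.
    have cv : K * nsq (v n - f) @[n --> \oo] --> K * 0.
      by apply: cvgM => //; exact: cvg_cst.
    rewrite mulr0 in cv; rewrite -(cvg_lim _ cv)//.
    by apply: limr_ge; [apply/cvg_ex; exists 0|near=> n; exact: le].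
have [p [Mp p0] pP] := projection H cK (ML _ Mu).
set q := u - p in pP.
have Mq : M q := closed_subB cM Mu Mp.
have Lq := ML _ Mq.
have q0 : phi q = phi u by rewrite phiB// p0 subr0.
have qq : ip q q != 0.
  rewrite (phff H)//; apply/eqP => /(congr1 (@complex.Re R))/= q1.
  have := phib _ Mq; rewrite q1 mulr0 => h.
  move/eqP: u0; apply; rewrite -q0; apply: cn2_eq0; apply/eqP.
  by rewrite eq_le h cn2_ge0.
exists ((phi q)^* / (ip q q)^* *: q); first by rewrite -[_ *: _]addr0; apply: Ml.
move=> f Mf; have Lf := ML _ Mf.
rewrite (phZr H)// cJM; set c := (phi q)^*^*.
have -> : c = phi q by rewrite /c conjCK.
have -> : ((ip q q)^*^-1)^* = (ip q q)^-1 by rewrite -fmorphV conjCK.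
have Kf : K0 (- (phi f / phi q) *: q + f).
  split; first exact: Ml.
  by rewrite phil// mulNr divfK ?q0// addNr.
have := pP _ Kf; rewrite (phDr H) ?(phZr H)//; try exact: (phLZ H).
move=> /(congr1 (fun z : R[i] => z^*)); rewrite cJD cJM conjCK -!(ph_C H)// rmorph0.
rewrite mulNr => /eqP; rewrite addrC subr_eq0 => /eqP ->.
by field; rewrite qq q0 u0.
Unshelve. all: by end_near. Qed.

(* Gram-Schmidt without normalization, so that [e k] may vanish. *)
Lemma gram_schmidt M (tau : nat -> V) : closed_sub M -> (forall k, M (tau k)) ->
  exists e : nat -> V, [/\ forall k, M (e k),
    forall j k, j != k -> ip (e j) (e k) = 0 &
    forall f, L f -> (forall k, ip f (e k) = 0) -> forall k, ip f (tau k) = 0].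
Proof.
move=> cM Mtau; have ML : M `<=` L by case: cM.
pose S k := [set tau j | j in [set j | (j < k)%N]].
have SM k : S k `<=` M by move=> _ [j _ <-].
have SL k : S k `<=` L by move=> f /SM/ML.
have Ltau k := ML _ (Mtau k).
have /choice[p pP] k : exists p, orth (orth (S k)) p /\ orth (S k) (tau k - p).
  by have [p ? ?] := orth_decomp (SL k) (Ltau k); exists p.
have Mp k : M (p k) by apply: (orth_orth_sub cM (SM k)); have [] := pP k.
have Me k : M (tau k - p k) := closed_subB cM (Mtau k) (Mp k).
exists (fun k => tau k - p k); split=> //.
- have lt j k : (j < k)%N -> ip (tau k - p k) (tau j - p j) = 0.
    move=> jk; have [_ [Lk ek]] := pP k; have [pj _] := pP j.
    rewrite (phBr H)//; last exact: ML.
    rewrite ek; last by exists j.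
    rewrite sub0r; apply/eqP; rewrite oppr_eq0; apply/eqP.
    apply: (phC0 H) => //; first exact: ML.
    have [_] := pj; apply; split=> // _ [i /= ij <-]; apply: ek; exists i => //=.
    exact: ltn_trans jk.
  move=> j k; case: ltngtP => // [jk|kj] _; last exact: lt.
  by apply: (phC0 H); [exact: ML|exact: ML|exact: lt].
- move=> f Lf fe k; have [n] := ubnP k; elim: n k => // n IH k kn.
  have [p0 _] := pP k; have := fe k; rewrite (phBr H)//; last exact: ML.
  suff -> : ip f (p k) = 0 by rewrite subr0.
  apply: (phC0 H) => //; first exact: ML.
  have [_] := p0; apply; split=> // _ [j /= jk <-]; apply: IH.
  exact: leq_trans jk _.
Qed.

End PreHilbertMore.

(** * Real norms and completeness in a Hilbert space *)

Section HilbertType.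
Context {R : realType} {G : hilbertType R}.
Implicit Types (x y z : G) (a : R[i]).

Definition rn x : R := Re `|x|.

Lemma normE x : `|x| = (rn x)%:C%C.
Proof. by have /c_ge0[] := normr_ge0 x. Qed.

Lemma rn_ge0 x : 0 <= rn x.
Proof. by have /c_ge0[] := normr_ge0 x. Qed.

Lemma rnD x y : rn (x + y) <= rn x + rn y.
Proof. by rewrite -lecR rmorphD/= -!normE; exact: ler_normD. Qed.

Lemma rn_eq0 x : rn x = 0 -> x = 0.
Proof. by move=> x0; apply/eqP; rewrite -normr_eq0 normE x0. Qed.

Lemma rn0 : rn 0 = 0. Proof. by rewrite /rn normr0. Qed.

Lemma rnN x : rn (- x) = rn x. Proof. by rewrite /rn normrN. Qed.

Lemma rnB x y : rn (x - y) = rn (y - x). Proof. by rewrite -rnN opprB. Qed.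

Lemma inner_rn x : inner x x = (rn x ^+ 2)%:C%C.
Proof. by rewrite inner_norm normE rmorphXn. Qed.

(** Telescoping keeps an explicit rate. Both the a.e. limits in L^2 and the operator series of the
    symbol need the rate, not only convergence. *)
Lemma dyadic_complete (u : nat -> G) (C : R) :
  (forall n, rn (u n.+1 - u n) <= C * 2^-1 ^+ n) ->
  exists l, forall n, rn (u n - l) <= 2 * C * 2^-1 ^+ n.
Proof.
move=> uC.
have C0 : 0 <= C by have := uC 0%N; rewrite expr0 mulr1; apply: le_trans (rn_ge0 _).
have p0 n : 0 <= 2 * C * 2^-1 ^+ n.
  by apply: mulr_ge0; [apply: mulr_ge0|rewrite exprn_ge0// invr_ge0].
have tel n k : rn (u (n + k)%N - u n) <= 2 * C * 2^-1 ^+ n - 2 * C * 2^-1 ^+ (n + k).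
  elim: k => [|k IH]; first by rewrite addn0 !subrr rn0.
  have -> : u (n + k.+1)%N - u n = (u (n + k).+1 - u (n + k)%N) + (u (n + k)%N - u n).
    by rewrite addrA subrK addnS.
  apply: le_trans (rnD _ _) _; have := uC (n + k)%N; move: IH.
  rewrite addnS exprS; set r := _ ^+ (n + k); set s := _ ^+ n => h1 h2.
  by lra.
have tel' n k : rn (u (n + k)%N - u n) <= 2 * C * 2^-1 ^+ n.
  by apply: le_trans (tel n k) _; rewrite gerBl.
have cv0 : (2 * C * 2^-1 ^+ n : R) @[n --> \oo] --> (0 : R).
  rewrite -(mulr0 (2 * C)); apply: cvgM; first exact: cvg_cst.
  by apply: cvg_expr; rewrite ger0_norm// invf_lt1// ltr1n.
have cau : cauchy (u @ \oo).
  apply/cauchy_ballP => e e0; have [eE Re0] := c_ge0 (ltW e0).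
  have R0 : 0 < Re e by rewrite lt_neqAle Re0 andbT eq_sym; apply/eqP => h;
    move: e0; rewrite eE h ltxx.
  move/cvgrPdist_lt/(_ (Re e / 2)): cv0 => /(_ _)[|N _ NP]; first by rewrite divr_gt0.
  pose A := [set u n | n in [set n | (N <= n)%N]].
  exists (A, A) => /=.
    by split; exists N => // n /= Nn; exists n.
  move=> [_ _] /= [[n Nn <-] [m Nm <-]].
  rewrite -ball_normE /= normE eE ltcR.
  have := NP N (leqnn _); rewrite /= sub0r normrN ger0_norm//.
  move=> hN.
  have -> : u n - u m = (u n - u N) - (u m - u N) by rewrite opprB addrA subrK.
  apply: le_lt_trans (rnD _ _) _; rewrite rnN.
  have := tel' N (n - N)%N; have := tel' N (m - N)%N; rewrite !subnKC// => h1 h2.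
  by lra.
have cu : cvg (u @ \oo) by apply: cauchy_cvg.
exists (lim (u @ \oo)) => n; apply/ler_addgt0Pr => e e0.
move/cvgrPdist_lt: cu => /(_ (e%:C)%C); rewrite ltcR => /(_ e0)[N _ NP].
have := NP (n + N)%N (leq_addl _ _); rewrite /= normE ltcR => h1.
have -> : u n - lim (u @ \oo) = - (u (n + N)%N - u n) - (lim (u @ \oo) - u (n + N)%N).
  by rewrite !opprB addrA subrK.
apply: le_trans (rnD _ _) _; rewrite !rnN lerD// ?ltW//.
Qed.

Lemma hilbert_preHilbert : preHilbert [set: G] (@inner R G).
Proof.
split=> //.
- by move=> *; exact: innerDl.
- by move=> *; exact: innerC.
- by move=> f _; rewrite inner_norm exprn_ge0.
- move=> u _ uP.
  have [|l lP] := @dyadic_complete u 1.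
    move=> n; rewrite mul1r; have := uP n; rewrite inner_rn /= => h.
    rewrite -(@ler_pXn2r _ 2)// ?nnegrE ?rn_ge0 ?exprn_ge0 ?invr_ge0//.
    apply: le_trans h _; rewrite -exprM mulnC exprM.
    by apply: lerXn2r; rewrite ?nnegrE ?exprn_ge0 ?invr_ge0//; lra.
  exists l => //.
  have cv1 : (2 * 2^-1 ^+ n : R) @[n --> \oo] --> (2 * 0 : R).
    apply: cvgM; first exact: cvg_cst.
    by apply: cvg_expr; rewrite ger0_norm// invf_lt1// ltr1n.
  have cv0 : (2 * 2^-1 ^+ n * (2 * 2^-1 ^+ n) : R) @[n --> \oo] --> (2 * 0 * (2 * 0) : R).
    by apply: cvgM; exact: cv1.
  rewrite !mulr0 in cv0.
  apply: squeeze_cvgr (cvg_cst 0) cv0; near=> n.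
  rewrite inner_rn/= sqr_ge0/= -expr2; apply: lerXn2r; rewrite ?nnegrE ?rn_ge0 ?mulr_ge0 ?exprn_ge0 ?invr_ge0//.
  by have := lP n; rewrite mulr1.
Unshelve. all: by end_near. Qed.

End HilbertType.

(** * Integrals of complex functions *)

Section Integral.
Context d (T : measurableType d) (R : realType) (P : probability T R).
Implicit Types (f g : T -> R) (a M : R).

Definition rint f := P.-integrable setT (EFin \o f).

Lemma rint_meas f : rint f -> measurable_fun setT f.
Proof. by move=> /measurable_int/measurable_EFinP. Qed.

Lemma rint_le f g : measurable_fun setT f -> (forall z, `|f z| <= g z) ->
  rint g -> rint f.
Proof.
move=> mf fg; apply: le_integrable => //; first exact/measurable_EFinP.
by move=> x _ /=; rewrite lee_fin (le_trans (fg x)) ?ler_norm.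
Qed.

Lemma rint_cst a : rint (fun=> a).
Proof. exact: finite_measure_integrable_cst. Qed.

Lemma rintZ a f : rint f -> rint (fun z => a * f z).
Proof. by move=> /(integrableZl measurableT a); exact: eq_integrable. Qed.

Lemma rintD f g : rint f -> rint g -> rint (fun z => f z + g z).
Proof. by move=> rf rg; have := integrableD measurableT rf rg; exact: eq_integrable. Qed.

Lemma rintN f : rint f -> rint (fun z => - f z).
Proof. by move=> /(rintZ (-1)); apply: eq_integrable => // z _ /=; rewrite mulN1r. Qed.

Lemma rintB f g : rint f -> rint g -> rint (fun z => f z - g z).
Proof. by move=> rf /rintN; exact: rintD. Qed.

Lemma rintMb (h : T -> R) M f : measurable_fun setT h -> (forall z, `|h z| <= M) ->
  rint f -> rint (fun z => h z * f z).
Proof.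
move=> mh hM rf.
apply: (@rint_le _ (fun z => M * `|f z|)); first exact: measurable_funM (rint_meas rf).
  by move=> z; rewrite normrM ler_wpM2r.
by apply: rintZ; exact: integrable_norm.
Qed.

Lemma RintZ a f : rint f -> \int[P]_z (a * f z) = a * \int[P]_z f z.
Proof. by move=> rf; rewrite RintegralZl. Qed.

Lemma RintD f g : rint f -> rint g ->
  \int[P]_z (f z + g z) = \int[P]_z f z + \int[P]_z g z.
Proof. by move=> rf rg; rewrite RintegralD. Qed.

Lemma RintN f : rint f -> \int[P]_z (- f z) = - \int[P]_z f z.
Proof.
by move=> rf; rewrite -mulN1r -RintZ//; apply: eq_Rintegral => z _; rewrite mulN1r.
Qed.

Lemma RintB f g : rint f -> rint g ->
  \int[P]_z (f z - g z) = \int[P]_z f z - \int[P]_z g z.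
Proof. by move=> rf rg; rewrite RintegralB. Qed.

Lemma Rint_cst a : \int[P]_z a = a.
Proof. by rewrite Rintegral_cst//= probability_setT mulr1. Qed.

Lemma Rint_EFin f : rint f -> ((\int[P]_z f z)%:E = \int[P]_z (f z)%:E)%E.
Proof. by move=> rf; rewrite /Rintegral fineK//; exact: integrable_fin_num. Qed.

Lemma Rint_ae f g : measurable_fun setT f -> measurable_fun setT g ->
  (\forall z \ae P, f z = g z) -> \int[P]_z f z = \int[P]_z g z.
Proof.
move=> mf mg fg; congr fine; apply: ae_eq_integral => //; try exact/measurable_EFinP.
by apply: filterS fg => z fgz _ /=; rewrite fgz.
Qed.

Lemma rint_ae f g : measurable_fun setT g ->
  (\forall z \ae P, f z = g z) -> rint f -> rint g.
Proof.
move=> mg fg rf; have mf := rint_meas rf.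
move/integrableP: (rf) => [_ fi].
apply/integrableP; split; first exact/measurable_EFinP.
rewrite (_ : integral _ _ _ = \int[P]_x `|(f x)%:E|)%E//.
apply: ge0_ae_eq_integral => //; try (by apply: measurableT_comp => //; exact/measurable_EFinP).
by apply: filterS fg => z fgz _ /=; rewrite fgz.
Qed.

Lemma Rint_eq0 f : rint f -> (forall z, 0 <= f z) -> \int[P]_z f z = 0 ->
  \forall z \ae P, f z = 0.
Proof.
move=> rf f0 If.
have : (\int[P]_z `|(f z)%:E| = 0)%E.
  under eq_integral do rewrite gee0_abs ?lee_fin//.
  by rewrite -Rint_EFin// If.
have mf : measurable_fun setT (EFin \o f) by exact/measurable_EFinP/rint_meas.
move=> /(ae_eq_integral_abs P measurableT mf) h.
have h' : \forall z \ae P, setT z -> (f z)%:E = 0%E := h.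
by apply: filterS h' => z /(_ I)[].
Qed.

Lemma Rint_dct (u : nat -> T -> R) f g :
  (forall n, measurable_fun setT (u n)) -> rint g ->
  (forall n z, `|u n z| <= g z) -> (forall z, u n z @[n --> \oo] --> f z) ->
  rint f /\ \int[P]_z u n z @[n --> \oo] --> \int[P]_z f z.
Proof.
move=> mu rg ug uf.
have mf : measurable_fun setT f by apply: measurable_fun_cvg => // z _; exact: uf.
have [||||_ _] := @dominated_convergence _ T R P setT measurableT
    (fun n z => (u n z)%:E) (EFin \o f) (EFin \o g) _ _ _ rg.
- by move=> n; exact/measurable_EFinP.
- exact/measurable_EFinP.
- by apply: aeW => z _; apply/fine_cvgP; split; [exact: nearW|exact: uf].
- by apply: aeW => z n _ /=; rewrite lee_fin.
have rf : rint f.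
  apply: (rint_le mf _ rg) => z.
  have cv : `|u n z| @[n --> \oo] --> `|f z| by apply: cvg_norm; exact: uf.
  rewrite -(cvg_lim _ cv)//.
  by apply: limr_le; [apply/cvg_ex; eexists; exact: cv|near=> n; exact: ug].
move=> h; split=> //.
have h' : (\int[P]_z (u n z)%:E)%E @[n --> \oo] --> (\int[P]_z f z)%:E.
  by rewrite Rint_EFin.
exact: (fine_cvg h').
Unshelve. all: by end_near. Qed.

End Integral.

Section ComplexIntegral.
Context d (T : measurableType d) (R : realType) (P : probability T R).
Implicit Types (f g : T -> R[i]) (a : R[i]) (M : R).

Definition cmeas f := measurable_fun setT (fun z => Re (f z)) /\
  measurable_fun setT (fun z => Im (f z)).

Definition cint f := rint P (fun z => Re (f z)) /\ rint P (fun z => Im (f z)).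

Definition Cint f : R[i] := Complex (\int[P]_z Re (f z)) (\int[P]_z Im (f z)).

Lemma cint_meas f : cint f -> cmeas f.
Proof. by move=> [/rint_meas ? /rint_meas ?]. Qed.

Lemma eq_Cint f g : f =1 g -> Cint f = Cint g.
Proof. by move=> /funext ->. Qed.

Lemma cmeasD f g : cmeas f -> cmeas g -> cmeas (fun z => f z + g z).
Proof.
move=> [rf mf] [rg mg]; split.
  by under eq_fun do rewrite cReD; exact: measurable_funD.
by under eq_fun do rewrite cImD; exact: measurable_funD.
Qed.

Lemma cmeasM f g : cmeas f -> cmeas g -> cmeas (fun z => f z * g z).
Proof.
move=> [rf mf] [rg mg]; split.
  by under eq_fun do rewrite cReM; apply: measurable_funB; exact: measurable_funM.
by under eq_fun do rewrite cImM; apply: measurable_funD; exact: measurable_funM.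
Qed.

Lemma cmeas_cst a : cmeas (fun=> a).
Proof. by split; exact: measurable_cst. Qed.

Lemma cmeasJ f : cmeas f -> cmeas (fun z => (f z)^*).
Proof.
move=> [rf mf]; split; first by under eq_fun do rewrite cReJ.
by under eq_fun do rewrite cImJ; exact: measurableT_comp.
Qed.

Lemma cintD f g : cint f -> cint g -> cint (fun z => f z + g z).
Proof.
move=> [rf mf] [rg mg]; split.
  by under eq_fun do rewrite cReD; exact: rintD.
by under eq_fun do rewrite cImD; exact: rintD.
Qed.

Lemma CintD f g : cint f -> cint g -> Cint (fun z => f z + g z) = Cint f + Cint g.
Proof.
move=> [rf mf] [rg mg]; apply: cP => /=.
  by under eq_fun do rewrite cReD; rewrite RintD.
by under eq_fun do rewrite cImD; rewrite RintD.
Qed.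

Lemma cintZ a f : cint f -> cint (fun z => a * f z).
Proof.
move=> [rf mf]; split.
  by under eq_fun do rewrite cReM; apply: rintB; exact: rintZ.
by under eq_fun do rewrite cImM; apply: rintD; exact: rintZ.
Qed.

Lemma CintZ a f : cint f -> Cint (fun z => a * f z) = a * Cint f.
Proof.
move=> [rf mf]; apply: cP => /=.
  by under eq_fun do rewrite cReM; rewrite RintB ?RintZ ?cReM//; exact: rintZ.
by under eq_fun do rewrite cImM; rewrite RintD ?RintZ ?cImM//; exact: rintZ.
Qed.

Lemma cintN f : cint f -> cint (fun z => - f z).
Proof. by move=> /(cintZ (-1)); under eq_fun do rewrite mulN1r. Qed.

Lemma CintN f : cint f -> Cint (fun z => - f z) = - Cint f.
Proof. by move=> /(CintZ (-1)); under eq_fun do rewrite mulN1r; rewrite mulN1r. Qed.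

Lemma cintB f g : cint f -> cint g -> cint (fun z => f z - g z).
Proof. by move=> ? /cintN; exact: cintD. Qed.

Lemma CintB f g : cint f -> cint g -> Cint (fun z => f z - g z) = Cint f - Cint g.
Proof. by move=> cf cg; rewrite CintD ?CintN//; exact: cintN. Qed.

Lemma CintJ f : cint f -> Cint (fun z => (f z)^*) = (Cint f)^*.
Proof.
move=> [rf mf]; apply: cP; rewrite ?cReJ ?cImJ/=.
  by under eq_fun do rewrite cReJ.
by under eq_fun do rewrite cImJ; rewrite RintN.
Qed.

Lemma cint_cst a : cint (fun=> a).
Proof. by split; exact: rint_cst. Qed.

Lemma Cint_cst a : Cint (fun=> a) = a.
Proof. by apply: cP => /=; rewrite Rint_cst. Qed.

Lemma cintMb (h f : T -> R[i]) M : cmeas h ->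
  (forall z, `|Re (h z)| <= M) -> (forall z, `|Im (h z)| <= M) ->
  cint f -> cint (fun z => h z * f z).
Proof.
move=> [rh ih] rM iM [rf jf]; split.
  by under eq_fun do rewrite cReM; apply: rintB; apply: rintMb; eassumption.
by under eq_fun do rewrite cImM; apply: rintD; apply: rintMb; eassumption.
Qed.

Lemma Cint_ae f g : cmeas f -> cmeas g -> (\forall z \ae P, f z = g z) -> Cint f = Cint g.
Proof.
move=> [? ?] [? ?] fg; apply: cP => /=; apply: Rint_ae => //;
  by apply: filterS fg => z ->.
Qed.

Lemma Cint_cvg (u : nat -> T -> R[i]) f (g : T -> R) :
  (forall n, cmeas (u n)) -> rint P g ->
  (forall n z, `|Re (u n z)| <= g z) -> (forall n z, `|Im (u n z)| <= g z) ->
  (forall z, Re (u n z) @[n --> \oo] --> Re (f z)) ->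
  (forall z, Im (u n z) @[n --> \oo] --> Im (f z)) ->
  [/\ cint f, Re (Cint (u n)) @[n --> \oo] --> Re (Cint f) &
     Im (Cint (u n)) @[n --> \oo] --> Im (Cint f)].
Proof.
move=> mu rg rb ib rc ic.
have [rf rl] := Rint_dct (fun n => (mu n).1) rg rb rc.
by have [jf il] := Rint_dct (fun n => (mu n).2) rg ib ic.
Qed.

End ComplexIntegral.

(** * Polynomial approximation of step functions *)

Section Step.
Context {R : realType}.

(** With s the square root of r, Bernoulli and s (2 - s) <= 1 bound n s^n by 1 / (1 - s); the other
    factor s^n tends to 0. *)
Lemma natmul_expr_cvg0 (r : R) : 0 <= r < 1 -> r ^+ n *+ n @[n --> \oo] --> 0.
Proof.
move=> /andP[r0 r1].
pose s := Num.sqrt r.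
have s0 : 0 <= s by exact: sqrtr_ge0.
have s1 : s < 1 by rewrite -sqrtr1 ltr_sqrt.
have rs : r = s * s by rewrite -expr2 sqr_sqrtr.
have b n : n%:R * s ^+ n * (1 - s) <= 1.
  have bern : 1 + n%:R * (1 - s) <= (1 + (1 - s)) ^+ n.
    elim: n => [|n IH]; first by rewrite mul0r addr0 expr0.
    rewrite exprS; apply: le_trans (ler_wpM2l _ IH); last by lra.
    rewrite -natr1; have : 0 <= n%:R * ((1 - s) * (1 - s)).
      by rewrite mulr_ge0 ?mulr_ge0//; lra.
    by move: (n%:R) => m; rewrite !mulrDl !mulrDr !mulr1 !mul1r; lra.
  have h : s ^+ n * (1 + (1 - s)) ^+ n <= 1.
    rewrite -exprMn; apply: exprn_ile1; first by rewrite mulr_ge0//; lra.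
    by have : 0 <= (1 - s) * (1 - s) by [apply: mulr_ge0; lra]; lra.
  apply: le_trans h; rewrite mulrAC [_ * s ^+ n]mulrC; apply: ler_wpM2l; first exact: exprn_ge0.
  by apply: le_trans bern; lra.
have cv : (1 - s)^-1 * s ^+ n @[n --> \oo] --> (1 - s)^-1 * 0.
  by apply: cvgM; [exact: cvg_cst|apply: cvg_expr; rewrite ger0_norm].
rewrite mulr0 in cv.
apply: squeeze_cvgr (cvg_cst 0) cv; near=> n.
rewrite mulrn_wge0 ?exprn_ge0//= rs exprMn -mulr_natl mulrA ler_wpM2r ?exprn_ge0//.
by rewrite -[leRHS]mul1r ler_pdivlMr ?subr_gt0.
Unshelve. all: by end_near. Qed.

(** Bernoulli replaces 1 + N u by (1 + u)^N, and (1 - u)(1 + u) <= 1. *)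
Lemma expr1B_le (u : R) N : 0 <= u <= 1 -> (1 - u) ^+ N * (1 + u *+ N) <= 1.
Proof.
move=> /andP[u0 u1].
have bern : 1 + u *+ N <= (1 + u) ^+ N.
  elim: N => [|n IH]; first by rewrite mulr0n addr0 expr0.
  rewrite exprS; apply: le_trans (ler_wpM2l _ IH); last by lra.
  rewrite mulrSr; have : 0 <= u * (u *+ n) by rewrite mulr_ge0 ?mulrn_wge0.
  by rewrite !mulrDl !mulrDr !mulr1 !mul1r; lra.
apply: le_trans (ler_wpM2l _ bern) _; first by rewrite exprn_ge0//; lra.
rewrite -exprMn; apply: exprn_ile1; first by rewrite mulr_ge0//; lra.
have : 0 <= u * u by rewrite mulr_ge0.
by lra.
Qed.

Lemma expr1B_ge (u : R) N : 0 <= u <= 1 -> 1 - u *+ N <= (1 - u) ^+ N.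
Proof.
move=> /andP[u0 u1]; elim: N => [|n IH]; first by rewrite mulr0n subr0 expr0.
rewrite exprS; apply: le_trans (ler_wpM2l _ IH); last by lra.
rewrite mulrSr; have : 0 <= u * (u *+ n) by rewrite mulr_ge0 ?mulrn_wge0.
by rewrite !mulrBl !mulrBr !mulr1 !mul1r; lra.
Qed.

(* The exponent [n * 2 ^ n] rather than [2 ^ n] makes the limit at [1 / 2] vanish. *)
Lemma step_cvg (v : R) : 0 <= v <= 1 ->
  (1 - v ^+ n) ^+ (n * 2 ^ n) @[n --> \oo] --> ((v < 2^-1)%R%:R : R).
Proof.
move=> /andP[v0 v1].
have vn n : 0 <= v ^+ n <= 1 by rewrite exprn_ge0//= exprn_ile1.
have vE n : v ^+ n *+ (n * 2 ^ n) = (2 * v) ^+ n *+ n.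
  by rewrite exprMn -[RHS]mulr_natl -[LHS]mulr_natl natrM natrX mulrA.
case: ltP => v2.
  have cv : 1 - (2 * v) ^+ n *+ n @[n --> \oo] --> (1 - 0 : R).
    by apply: cvgB; [exact: cvg_cst|apply: natmul_expr_cvg0; lra].
  rewrite subr0 in cv.
  rewrite mulr1n; apply: squeeze_cvgr cv (cvg_cst (1 : R)); near=> n.
  rewrite -vE expr1B_ge//=; apply: exprn_ile1; have := vn n; lra.
have cv : n.+1%:R^-1 @[n --> \oo] --> (0 : R) by exact: cvg_harmonic.
rewrite mulr0n; apply: squeeze_cvgr (cvg_cst 0) cv; near=> n.
rewrite exprn_ge0/=; last by have := vn n; lra.
have n0 : (0 : R) < n.+1%:R by [].
rewrite -[leRHS]mul1r ler_pdivlMr//.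
(* For v >= 1/2 one has (2 v)^n >= 1, so that v^n times the exponent is at least n and the power is
   at most 1 / (n + 1). *)
apply: le_trans (expr1B_le (n * 2 ^ n) (vn n)).
apply: ler_wpM2l; first by rewrite exprn_ge0//; have := vn n; lra.
rewrite vE -natr1 addrC lerD2l -[_ ^+ n *+ n]mulr_natl ler_peMr// exprn_ege1//.
by rewrite -(@ler_pM2l _ 2^-1)// mulrA mulVf// mul1r mulr1.
Unshelve. all: by end_near. Qed.

End Step.

(** * The sigma-algebra of the circle *)

Section MeasurableSup.
Context {R : realType}.

Lemma measurable_gt d (U : measurableType d) (f : U -> R) :
  (forall r, measurable [set z | r < f z]) -> measurable_fun setT f.
Proof.
move=> h; apply: (measurability _ (RGenOInfty.measurableE R)).
move=> _ [_ [r ->]] <-; rewrite setTI.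
rewrite (_ : _ @^-1` _ = [set z | r < f z])//.
by apply/seteqP; split => z /=; rewrite in_itv/= andbT.
Qed.

Lemma measurable_sup d (U : measurableType d) (f : U -> R) (g : nat -> U -> R) :
  (forall j, measurable_fun setT (g j)) -> (forall j z, g j z <= f z) ->
  (forall z e, 0 < e -> exists j, f z < g j z + e) -> measurable_fun setT f.
Proof.
move=> mg gf fg; apply: measurable_gt => r.
have -> : [set z | r < f z] = \bigcup_j (setT `&` g j @^-1` `]r, +oo[).
  apply/seteqP; split => z /=.
    rewrite -subr_gt0 => /(fg z)[j] h.
    by exists j => //; split=> //=; rewrite in_itv/= andbT; lra.
  by move=> [j _ [_ /=]]; rewrite in_itv/= andbT => h; apply: lt_le_trans (gf j z).
by apply: bigcup_measurable => j _; apply: mg => //; exact: measurable_itv.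
Qed.

Lemma measurable_inf d (U : measurableType d) (f : U -> R) (g : nat -> U -> R) :
  (forall j, measurable_fun setT (g j)) -> (forall j z, f z <= g j z) ->
  (forall z e, 0 < e -> exists j, g j z < f z + e) -> measurable_fun setT f.
Proof.
move=> mg gf fg.
have -> : f = (-%R \o (fun z => - f z)) by apply: funext => z /=; rewrite opprK.
apply: measurableT_comp => //; apply: (@measurable_sup _ _ _ (fun j z => - g j z)).
- by move=> j; exact: measurableT_comp.
- by move=> j z; rewrite lerN2.
- by move=> z e /(fg z)[j h]; exists j; lra.
Qed.

End MeasurableSup.

Section CircleMeasure.
Context {R : realType}.
Local Notation T := (circle R).
Implicit Types (z : T) (A : set T).

Definition cx z : R := Re (z : R[i]).
Definition cy z : R := Im (z : R[i]).

Lemma cxy z : cx z ^+ 2 + cy z ^+ 2 = 1.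
Proof.
have /eqP := cvalP z; rewrite normc_def => /(congr1 (@complex.Re R))/= h.
have h0 : 0 <= cx z ^+ 2 + cy z ^+ 2 by rewrite addr_ge0 ?sqr_ge0.
by rewrite -(sqr_sqrtr h0) h expr1n.
Qed.

Lemma cx_le1 z : `|cx z| <= 1.
Proof.
rewrite -(@ler_pXn2r _ 2)// ?nnegrE// real_normK ?num_real// expr1n -(cxy z).
by rewrite lerDl sqr_ge0.
Qed.

Lemma cy_le1 z : `|cy z| <= 1.
Proof.
rewrite -(@ler_pXn2r _ 2)// ?nnegrE// real_normK ?num_real// expr1n -(cxy z).
by rewrite lerDr sqr_ge0.
Qed.

Lemma circle_eq (z w : T) : cx z = cx w -> cy z = cy w -> z = w.
Proof. by move=> hx hy; apply: val_inj; exact: cP. Qed.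

Lemma measurable_circleP (f : T -> R) :
  measurable_fun setT (f \o expi : measurableTypeR R -> R) -> measurable_fun setT f.
Proof.
by move=> mf _ B mB; rewrite setTI; have := mf measurableT B mB; rewrite setTI.
Qed.

Lemma measurable_cx : measurable_fun setT cx.
Proof.
by apply: measurable_circleP; apply: continuous_measurable_fun; exact: continuous_cos.
Qed.

Lemma measurable_cy : measurable_fun setT cy.
Proof.
by apply: measurable_circleP; apply: continuous_measurable_fun; exact: continuous_sin.
Qed.

(** A family closed under intersection, generating the Borel sets, whose indicators are bounded
    limits of polynomials in the two coordinates. *)
Definition quadrants : set (set T) :=
  [set A | exists a b, A = [set z | a < cx z /\ b < cy z]].

(** The principal argument, a section of [expi]. *)
Definition carg z : R := if 0 <= cy z then acos (cx z) else - acos (cx z).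

Lemma expi_carg z : expi (carg z) = z.
Proof.
have /andP[x1 x2] : -1 <= cx z <= 1 by rewrite -ler_norml cx_le1.
have xI : cx z \in `[-1, 1] by rewrite in_itv/= x1.
have sq : Num.sqrt (1 - cx z ^+ 2) = `|cy z|.
  by rewrite -(cxy z) [X in X - _]addrC addrK sqrtr_sqr.
apply: circle_eq; rewrite /carg.
  by case: ifP => _; rewrite /cx/= ?cosN acosK.
case: ifP => y0; rewrite /cy/= ?sinN sin_acos ?x1// sq; first by rewrite ger0_norm.
by rewrite ltr0_norm ?opprK// ltNge y0.
Qed.

Local Notation TQ := (g_sigma_algebraType quadrants).

Let mq a b : measurable ([set z | a < cx z /\ b < cy z] : set TQ).
Proof. by apply: sub_sigma_algebra; exists a, b. Qed.

Let mqx a : measurable ([set z | a < cx z] : set TQ).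
Proof.
rewrite (_ : mkset _ = [set z | a < cx z /\ -2 < cy z]); first exact: mq.
apply/seteqP; split=> z /=; last by case.
by have := cy_le1 z; rewrite ler_norml => /andP[? _] ?; split=> //; lra.
Qed.

Let mqy a : measurable ([set z | a < cy z] : set TQ).
Proof.
rewrite (_ : mkset _ = [set z | -2 < cx z /\ a < cy z]); first exact: mq.
apply/seteqP; split=> z /=; last by case.
by have := cx_le1 z; rewrite ler_norml => /andP[? _] ?; split=> //; lra.
Qed.

Let mcx : measurable_fun setT (cx : TQ -> R).
Proof. exact: measurable_gt. Qed.

Let mcy : measurable_fun setT (cy : TQ -> R).
Proof. exact: measurable_gt. Qed.

Let macos : measurable_fun setT ((fun z => acos (cx z)) : TQ -> R).
Proof.
apply: measurable_gt => r.
have xI z : -1 <= cx z <= 1 by rewrite -ler_norml cx_le1.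
have [r0|r0] := ltP r 0.
  rewrite (_ : mkset _ = setT); first exact: measurableT.
  by apply/seteqP; split=> z //= _; apply: lt_le_trans r0 _; exact: acos_ge0.
have [rp|rp] := leP r pi; last first.
  rewrite (_ : mkset _ = set0); first exact: measurable0.
  apply/seteqP; split=> z //= h.
  by have := lt_trans rp h; rewrite ltNge acos_lepi.
rewrite (_ : mkset _ = setT `&` (cx : TQ -> R) @^-1` `]-oo, cos r[).
  by apply: mcx => //; exact: measurable_itv.
apply/seteqP; split=> z /=; rewrite in_itv/=.
  move=> h; split=> //; rewrite -[ltLHS]acosK ?in_itv//=.
  by rewrite ltr_cos// in_itv/= ?r0// acos_ge0// acos_lepi.
move=> [_]; rewrite -{1}[cx z]acosK ?in_itv//= ltr_cos// in_itv/= ?r0//.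
by rewrite acos_ge0// acos_lepi.
Qed.

Let mcarg : measurable_fun setT (carg : TQ -> R).
Proof.
apply: measurable_gt => r.
have mge : measurable ([set z | 0 <= cy z] : set TQ).
  rewrite (_ : mkset _ = setT `&` (cy : TQ -> R) @^-1` `[0, +oo[).
    by apply: mcy => //; exact: measurable_itv.
  by apply/seteqP; split=> z /=; rewrite in_itv/= andbT// => -[].
have mN : measurable_fun setT ((fun z => - acos (cx z)) : TQ -> R).
  exact: measurableT_comp macos.
have mr (f : TQ -> R) : measurable_fun setT f -> measurable [set z | r < f z].
  move=> mf; rewrite (_ : mkset _ = setT `&` f @^-1` `]r, +oo[).
    by apply: mf => //; exact: measurable_itv.
  by apply/seteqP; split=> z /=; rewrite in_itv/= andbT// => -[].
rewrite (_ : mkset _ = ([set z | 0 <= cy z] `&` [set z | r < acos (cx z)]) `|`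
   (~` [set z | 0 <= cy z] `&` [set z | r < - acos (cx z)])).
  by apply: measurableU; apply: measurableI; [|exact: mr|exact: measurableC|exact: mr].
apply/seteqP; split=> z /=; rewrite /carg.
  by case: ifP => y0 h; [left|right].
by case: ifP => y0 [[]|[]].
Qed.

(** For the inclusion from left to right, [carg] is measurable for the generated sigma-algebra and
    [A] is its preimage of the Borel set of all t with [expi t] in [A]. *)
Lemma circle_sigma : @measurable _ T = <<s quadrants >>.
Proof.
apply/seteqP; split=> A mA.
  have -> : A = setT `&` carg @^-1` (expi @^-1` A).
    by rewrite setTI; apply/seteqP; split=> z /=; rewrite expi_carg.
  exact: mcarg.
apply: (smallest_sub _ _ mA); first exact: sigma_algebra_measurable.
move=> _ [a [b ->]].
rewrite (_ : mkset _ = (setT `&` cx @^-1` `]a, +oo[) `&` (setT `&` cy @^-1` `]b, +oo[)).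
  apply: measurableI; [apply: measurable_cx|apply: measurable_cy] => //;
    exact: measurable_itv.
by apply/seteqP; split=> z /=; rewrite !in_itv/= !andbT => -[]; [move=> ? ?|move=> [_ ?] [_ ?]].
Qed.

Section CircleClass.
Variable B : set (T -> R).
Hypothesis B1 : B (fun=> 1).
Hypothesis Bl : forall a f g, B f -> B g -> B (fun z => a * f z + g z).
Hypothesis Bx : forall f, B f -> B (fun z => cx z * f z).
Hypothesis By : forall f, B f -> B (fun z => cy z * f z).
Hypothesis Bbd : forall f, B f -> exists M, forall z, `|f z| <= M.
Hypothesis Blim : forall (u : nat -> T -> R) f M, (forall n, B (u n)) ->
  (forall n z, `|u n z| <= M) -> (forall z, u n z @[n --> \oo] --> f z) -> B f.

Let B0 : B (fun=> 0).
Proof.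
have := Bl (-1) B1 B1; congr B; apply: funext => z; lra.
Qed.

Let BN f : B f -> B (fun z => 1 - f z).
Proof.
move=> Bf; have := Bl (-1) Bf B1; congr B; apply: funext => z; lra.
Qed.

(* The indicator of [a < w] is a bounded limit of polynomials in [w]. *)
Let Bhalf (w : T -> R) (a : R) : (forall z, `|w z| <= 1) ->
  (forall f, B f -> B (fun z => w z * f z)) ->
  forall f, B f -> B (fun z => (a < w z)%R%:R * f z).
Proof.
move=> w1 Bw f Bf; have [M fM] := Bbd Bf.
(* The affine map w -> 1/2 - (w - a) / c sends [-1, 1] into [0, 1] and a to 1/2, and it is
   decreasing: a < w becomes v < 1/2, the case treated by [step_cvg]. *)
pose c := 2 * (1 + `|a|).
have c0 : 0 < c by rewrite mulr_gt0// ltr_wpDr.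
pose v z := 2^-1 - (w z - a) / c.
have v01 z : 0 <= v z <= 1.
  have : `|(w z - a) / c| <= 2^-1.
    rewrite normrM normfV (gtr0_norm c0) ler_pdivrMr// /c mulrA mulVf// mul1r.
    by apply: le_trans (ler_normB _ _) _; rewrite lerD2r.
  by rewrite ler_norml => /andP[? ?]; apply/andP; split; rewrite /v; lra.
have Bv g : B g -> B (fun z => v z * g z).
  move=> Bg; have := Bl (2^-1 + a / c) Bg (Bl (- c^-1) (Bw _ Bg) B0).
  by congr B; apply: funext => z; rewrite /v; ring.
have Bvn n g : B g -> B (fun z => v z ^+ n * g z).
  move=> Bg; elim: n => [|n IH].
    by move: Bg; congr B; apply: funext => z; rewrite expr0 mul1r.
  by have := Bv _ IH; congr B; apply: funext => z; rewrite exprS mulrA.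
have Bv1 n g : B g -> B (fun z => (1 - v z ^+ n) * g z).
  move=> Bg; have := Bl (-1) (Bvn n _ Bg) Bg.
  by congr B; apply: funext => z; ring.
have BvN n N g : B g -> B (fun z => (1 - v z ^+ n) ^+ N * g z).
  move=> Bg; elim: N => [|N IH].
    by move: Bg; congr B; apply: funext => z; rewrite expr0 mul1r.
  by have := Bv1 n _ IH; congr B; apply: funext => z; rewrite exprS mulrA.
apply: (Blim (u := fun n z => (1 - v z ^+ n) ^+ (n * 2 ^ n) * f z) (M := M)).
- by move=> n; exact: BvN.
- move=> n z; rewrite normrM -[M]mul1r ler_pM//.
  have /andP[v0 v1] := v01 z; have := exprn_ge0 n v0; have := exprn_ile1 n v0 v1.
  by move=> ? ?; rewrite normrX exprn_ile1// ger0_norm//; lra.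
- move=> z; apply: cvgM; last exact: cvg_cst.
  have -> : (a < w z) = (v z < 2^-1).
    by rewrite /v gtrBl pmulr_lgt0 ?invr_gt0// subr_gt0.
  exact: step_cvg.
Qed.

(** A functional monotone class theorem: the coordinates act as multipliers on [B], which gives the
    indicators of [quadrants] as bounded limits, and Dynkin's lemma extends them to all measurable
    sets. *)
Lemma circle_class A : measurable A -> B \1_A.
Proof.
move=> mA; have sA : <<s quadrants >> A by rewrite -circle_sigma.
apply: (@dynkin_induction _ T quadrants (fun A => B \1_A) circle_sigma _ _ _ _ _ A sA).
- move=> _ _ [a [b ->]] [a' [b' ->]]; exists (Num.max a a'), (Num.max b b').
  apply/seteqP; split=> z /=; rewrite !gt_max.
    by move=> [[-> ->] [-> ->]].
  by move=> [/andP[-> ->] /andP[-> ->]].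
- by move: B1; congr B; apply: funext => z; rewrite indicT.
- move=> _ [a [b ->]].
  have := Bhalf a cx_le1 Bx (Bhalf b cy_le1 By B1).
  congr B; apply: funext => z; rewrite mulr1 -natrM mulnb indicE; congr (_%:R).
  by congr nat_of_bool; apply/idP/idP; [move=> /andP[? ?]; rewrite inE|rewrite inE => -[-> ->]].
- move=> S _ BS; have := BN BS; congr B; apply: funext => z.
  by rewrite !indicE in_setC; case: (z \in S); rewrite /= ?subrr ?subr0.
- move=> F _ tF BF.
  pose u n z : R := \sum_(k < n) \1_(F k) z.
  have uE n z : u n z = \1_(\bigcup_(k < n) F k) z.
    elim: n => [|n IH]; first by rewrite /u big_ord0 bigcup_mkord big_ord0 indic0.
    rewrite /u big_ord_recr/= -/(u n z) IH.
    rewrite (_ : \bigcup_(k < n.+1) F k = \bigcup_(k < n) F k `|` F n); last first.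
      by rewrite !bigcup_mkord big_ord_recr.
    rewrite !indicE in_setU; case: (boolP (z \in F n)); last by rewrite orbF addr0.
    rewrite inE => Fn; rewrite orbT; case: (boolP (z \in _)); last by rewrite add0r.
    rewrite inE => -[k /= kn Fk]; have := tF k n I I (ex_intro _ z (conj Fk Fn)).
    by move=> kn'; move: kn; rewrite kn' ltnn.
  apply: (Blim (u := u) (M := 1)).
  + elim=> [|n IH].
      by move: B0; congr B; apply: funext => z; rewrite /u big_ord0.
    have := Bl 1 (BF n) IH; congr B; apply: funext => z.
    by rewrite /u big_ord_recr/= mul1r addrC.
  + by move=> n z; rewrite uE indicE; case: (_ \in _); rewrite ?normr1 ?normr0.
  + move=> z; have [[k _ Fk]|nF] := pselect ((\bigcup_k F k) z).
      apply: cvg_near_cst; near=> n; rewrite uE !indicE !mem_set//; first by exists k.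
      by exists k => //=; near: n; exists k.+1.
    apply: cvg_near_cst; near=> n; rewrite uE !indicE !memNset//.
    by move=> [k _ Fk]; apply: nF; exists k.
Unshelve. all: by end_near. Qed.

End CircleClass.

End CircleMeasure.

(** * Fourier coefficients on the circle *)

Section CircleFourier.
Context {R : realType}.
Local Notation T := (circle R).
Local Notation C := R[i].
Local Notation mu := (@arc_length R).
Implicit Types (z : T) (A : set T).

Lemma arc_length_FTC (f : T -> R) (F : R -> R) : (forall z, 0 <= f z) ->
  continuous (fun t : R => f (expi t)) ->
  (forall t : R, derivable F t 1 /\ 'D_1 F t = f (expi t)) ->
  \int[mu]_z f z = (2 * pi)^-1 * (F (2 * pi) - F 0).
Proof.
move=> f0 cf dF.
have mf : measurable_fun setT f.
  by apply: measurable_circleP; exact: continuous_measurable_fun.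
have p0 : 0 < 2 * pi :> R by rewrite mulr_gt0// pi_gt0.
have cF : continuous F.
  by move=> t; apply: differentiable_continuous; apply/derivable1_diffP; by have [] := dF t.
rewrite /Rintegral /arc_length ge0_integral_distribution//=; last exact/measurable_EFinP.
have mg : measurable_fun setT (EFin \o (fun t : measurableTypeR R => f (expi t))).
  by apply/measurable_EFinP; exact: continuous_measurable_fun.
rewrite integral_uniform//; last by move=> z; rewrite lee_fin.
rewrite (@continuous_FTC2 _ (fun t => f (expi t)) F)//.
- by rewrite subr0.
- exact: continuous_subspaceT.
- split; last 2 first.
  + exact/cvg_at_right_filter/cF.
  + exact/cvg_at_left_filter/cF.
  by move=> t _; by have [] := dF t.
- by move=> t _; rewrite derive1E; have [_ ->] := dF t.
Qed.

Lemma expiX (t : R) k : (expi t : C) ^+ k = Complex (cos (k%:R * t)) (sin (k%:R * t)).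
Proof.
elim: k => [|k IH]; first by rewrite expr0 mul0r cos0 sin0.
rewrite exprS IH -nat1r mulrDl mul1r cosD sinD.
apply: cP; first by rewrite cReM.
by rewrite cImM addrC.
Qed.

Lemma cos_sin_2npi k : cos (k%:R * (2 * pi)) = 1 :> R /\ sin (k%:R * (2 * pi)) = 0 :> R.
Proof.
have e1 : (expi (2 * pi : R) : C) = 1.
  by apply: cP => /=; rewrite mulr_natl ?cos2pi ?sin2pi.
have := expiX (2 * pi) k; rewrite e1 expr1n => h.
by split; [have := congr1 (@complex.Re R) h|have := congr1 (@complex.Im R) h].
Qed.

Lemma cn2_circle z : cn2 (z : C) = 1. Proof. exact: cxy. Qed.

Lemma circle_mulJ z : (z : C) * (z : C)^* = 1.
Proof. by rewrite cmulJ cn2_circle. Qed.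

Lemma cmeas_circle : cmeas (fun z : T => (z : C)).
Proof. by split; [exact: measurable_cx|exact: measurable_cy]. Qed.

Lemma cmeasX (f : T -> C) k : cmeas f -> cmeas (fun z => f z ^+ k).
Proof.
move=> mf; elim: k => [|k IH]; first exact: cmeas_cst.
by under eq_fun do rewrite exprS; exact: cmeasM.
Qed.

Lemma cn2X (x : C) k : cn2 (x ^+ k) = cn2 x ^+ k.
Proof.
elim: k => [|k IH]; last by rewrite !exprS cn2M IH.
by rewrite !expr0 /cn2 /= expr1n expr0n addr0.
Qed.

(** On the circle this is z^(k - l): two naturals encode an integer frequency, and multiplying by a
    coordinate only raises one of them. *)
Definition trig k l z : C := (z : C) ^+ k * (z : C)^* ^+ l.

Lemma cn2_trig k l z : cn2 (trig k l z) = 1.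
Proof. by rewrite cn2M !cn2X cn2J cn2_circle !expr1n mulr1. Qed.

Lemma cmeas_trig k l : cmeas (trig k l).
Proof. by apply: cmeasM; apply: cmeasX; [|apply: cmeasJ]; exact: cmeas_circle. Qed.

Lemma Re_le_cn2 (x : C) (M : R) : 0 <= M -> cn2 x <= M ^+ 2 -> `|Re x| <= M.
Proof.
move=> M0 xM; rewrite -(@ler_pXn2r _ 2)// ?nnegrE// real_normK ?num_real//.
by apply: le_trans xM; rewrite lerDl sqr_ge0.
Qed.

Lemma Im_le_cn2 (x : C) (M : R) : 0 <= M -> cn2 x <= M ^+ 2 -> `|Im x| <= M.
Proof.
move=> M0 xM; rewrite -(@ler_pXn2r _ 2)// ?nnegrE// real_normK ?num_real//.
by apply: le_trans xM; rewrite lerDr sqr_ge0.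
Qed.

Lemma cint_bdM (h f : T -> C) (M : R) : 0 <= M -> cmeas h ->
  (forall z, cn2 (h z) <= M ^+ 2) -> cint mu f -> cint mu (fun z => h z * f z).
Proof.
move=> M0 mh hM; apply: (@cintMb _ _ _ _ _ _ M) => // z.
  by apply: Re_le_cn2.
by apply: Im_le_cn2.
Qed.

Lemma cint_trig k l (f : T -> C) : cint mu f -> cint mu (fun z => trig k l z * f z).
Proof.
apply: (@cint_bdM _ _ 1) => //; first exact: cmeas_trig.
by move=> z; rewrite cn2_trig expr1n.
Qed.

Lemma trigE k l z : trig k l z = if (l <= k)%N then (z : C) ^+ (k - l) else (z : C)^* ^+ (l - k).
Proof.
rewrite /trig; case: leqP => [lk|/ltnW kl].
  by rewrite -{1}(subnK lk) exprD -mulrA -exprMn circle_mulJ expr1n mulr1.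
by rewrite -{1}(subnK kl) exprD mulrCA -exprMn circle_mulJ expr1n mulr1.
Qed.

Lemma trigJ k l z : (trig k l z)^* = trig l k z.
Proof. by rewrite /trig rmorphM !rmorphXn /= conjCK mulrC. Qed.

Lemma Cint_expr k : (0 < k)%N -> Cint mu (fun z => (z : C) ^+ k) = 0.
Proof.
move=> k0; have kR : k%:R != 0 :> R by rewrite pnatr_eq0 -lt0n.
have tp : 2 * pi != 0 :> R by rewrite mulf_neq0// gt_eqF// pi_gt0.
have mk := cmeasX k cmeas_circle.
have ck : cint mu (fun z : T => (z : C) ^+ k).
  have := cint_trig k 0 (cint_cst mu 1).
  by congr cint; apply: funext => z; rewrite /trig expr0 !mulr1.
have b z : -1 <= Re ((z : C) ^+ k) <= 1 /\ -1 <= Im ((z : C) ^+ k) <= 1.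
  by rewrite -!ler_norml Re_le_cn2 ?Im_le_cn2// cn2X cn2_circle !expr1n.
(* The constant 1 makes the integrand nonnegative, as [arc_length_FTC] requires. *)
have cosk : \int[mu]_z (1 + Re ((z : C) ^+ k)) = 1.
  rewrite (@arc_length_FTC _ (fun t => t + k%:R^-1 * sin (k%:R * t))).
  - by have [_ ->] := cos_sin_2npi k; rewrite !mulr0 sin0 !mulr0 !addr0 subr0 mulVf.
  - by move=> z; have [/andP[? _] _] := b z; lra.
  - move=> t; rewrite (_ : (fun t => _) = (fun t : R => 1 + cos (k%:R * t))).
      apply: cvgD; first exact: cvg_cst.
      apply: continuous_comp; last exact: continuous_cos.
      by apply: cvgM; [exact: cvg_cst|exact: cvg_id].
    by apply: funext => s; rewrite expiX.
  - move=> t; have [d ->] : is_derive t (1 : R)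
        (fun t => t + k%:R^-1 * sin (k%:R * t)) (1 + cos (k%:R * t)).
      by apply: is_derive_eq; rewrite /GRing.scale/=; field.
    by rewrite expiX.
have sink : \int[mu]_z (1 + Im ((z : C) ^+ k)) = 1.
  rewrite (@arc_length_FTC _ (fun t => t - k%:R^-1 * cos (k%:R * t))).
  - by have [-> _] := cos_sin_2npi k; rewrite mulr0 cos0 sub0r opprK subrK mulVf.
  - by move=> z; have [_ /andP[? _]] := b z; lra.
  - move=> t; rewrite (_ : (fun t => _) = (fun t : R => 1 + sin (k%:R * t))).
      apply: cvgD; first exact: cvg_cst.
      apply: continuous_comp; last exact: continuous_sin.
      by apply: cvgM; [exact: cvg_cst|exact: cvg_id].
    by apply: funext => s; rewrite expiX.
  - move=> t; have [d ->] : is_derive t (1 : R)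
        (fun t => t - k%:R^-1 * cos (k%:R * t)) (1 + sin (k%:R * t)).
      by apply: is_derive_eq; rewrite /GRing.scale/=; field.
    by rewrite expiX.
apply: cP => /=.
  by move: cosk; rewrite RintD ?Rint_cst; [lra|exact: rint_cst|case: ck].
by move: sink; rewrite RintD ?Rint_cst; [lra|exact: rint_cst|case: ck].
Qed.

Lemma Cint_trig k l : Cint mu (trig k l) = (k == l)%:R.
Proof.
have expk n : cint mu (fun z : T => (z : C) ^+ n).
  have := cint_trig n 0 (cint_cst mu 1).
  by congr cint; apply: funext => z; rewrite /trig expr0 !mulr1.
rewrite (eq_Cint _ (trigE k l)); case: (ltngtP k l) => [kl|lk|<-].
- rewrite (@eq_Cint _ _ _ _ _ (fun z : T => ((z : C) ^+ (l - k))^*)).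
    by rewrite CintJ// Cint_expr ?rmorph0//; rewrite subn_gt0.
  by move=> z; apply/esym; exact: rmorphXn.
- by rewrite Cint_expr//; rewrite subn_gt0.
- by rewrite subnn; under eq_Cint do rewrite expr0; rewrite Cint_cst.
Qed.

End CircleFourier.

(** * Uniqueness of Fourier coefficients and invariance under conjugation *)

Section FourierUniqueness.
Context {R : realType}.
Local Notation T := (circle R).
Local Notation C := R[i].
Local Notation mu := (@arc_length R).
Implicit Types (z : T) (A : set T) (phi : T -> R).

Lemma cx_trig z k l : (cx z)%:C%C * trig k l z = 2^-1 * (trig k.+1 l z + trig k l.+1 z).
Proof.
have -> : ((cx z)%:C)%C = 2^-1 * ((z : C) + (z : C)^*) by rewrite ReJ_add mulrC.
by rewrite /trig !exprS; ring.
Qed.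

Lemma cy_trig z k l :
  (cy z)%:C%C * trig k l z = (2^-1 * 'i) * (trig k l.+1 z - trig k.+1 l z).
Proof.
have -> : ((cy z)%:C)%C = (2^-1 * 'i) * ((z : C)^* - (z : C)) by rewrite ImJ_sub complexiE; ring.
by rewrite /trig !exprS; ring.
Qed.

Definition bdmeas phi := measurable_fun setT phi /\ exists M, forall z, `|phi z| <= M.

Lemma bdmeas_cint phi (f : T -> C) : bdmeas phi -> cint mu f ->
  cint mu (fun z => (phi z)%:C%C * f z).
Proof.
move=> [mp [M pM]]; apply: (@cint_bdM _ _ _ (Num.max M 0)).
- by rewrite le_max lexx orbT.
- by split=> //; exact: measurable_cst.
- move=> z; rewrite cn2R -real_normK ?num_real//.
  by apply: lerXn2r; rewrite ?nnegrE// le_max ?lexx ?orbT// pM.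
Qed.

Lemma bdmeas_lin a f g : bdmeas f -> bdmeas g -> bdmeas (fun z => a * f z + g z).
Proof.
move=> [mf [M fM]] [mg [M' gM]]; split.
  by apply: measurable_funD => //; apply: measurable_funM => //; exact: measurable_cst.
exists (`|a| * M + M') => z; apply: le_trans (ler_normD _ _) _; apply: lerD => //.
by rewrite normrM ler_wpM2l.
Qed.

Lemma bdmeasM f g : bdmeas f -> bdmeas g -> bdmeas (fun z => f z * g z).
Proof.
move=> [mf [M fM]] [mg [M' gM]]; split; first exact: measurable_funM.
by exists (M * M') => z; rewrite normrM ler_pM.
Qed.

Lemma bdmeas_cx : bdmeas cx.
Proof. by split; [exact: measurable_cx|exists 1; exact: cx_le1]. Qed.

Lemma bdmeas_cy : bdmeas cy.
Proof. by split; [exact: measurable_cy|exists 1; exact: cy_le1]. Qed.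

Lemma bdmeas_cst a : bdmeas (fun=> a).
Proof. by split; [exact: measurable_cst|exists `|a|]. Qed.

Lemma bdmeas_lim (u : nat -> T -> R) (f : T -> R) M : (forall n, bdmeas (u n)) ->
  (forall n z, `|u n z| <= M) -> (forall z, u n z @[n --> \oo] --> f z) -> bdmeas f.
Proof.
move=> bu uM uf; split.
  by apply: measurable_fun_cvg => [m|z _]; [have [] := bu m|exact: uf].
exists M => z; have cv : `|u n z| @[n --> \oo] --> `|f z| by apply: cvg_norm; exact: uf.
rewrite -(cvg_lim _ cv)//.
by apply: limr_le; [apply/cvg_ex; eexists; exact: cv|near=> n; exact: uM].
Unshelve. all: by end_near. Qed.

(** Two sequences and two integrands let the same dominated convergence serve Fourier uniqueness,
    where the second sequence is 0, and the conjugation symmetry of the measure, where it is the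
    first one reflected. *)
Lemma bd_lim_eq (u v : nat -> T -> R) (f f' : T -> R) M (g h : T -> C) :
  (forall n, bdmeas (u n)) -> (forall n, bdmeas (v n)) ->
  (forall n z, `|u n z| <= M) -> (forall n z, `|v n z| <= M) ->
  (forall z, u n z @[n --> \oo] --> f z) -> (forall z, v n z @[n --> \oo] --> f' z) ->
  cint mu g -> cint mu h ->
  (forall n, Cint mu (fun z => (u n z)%:C%C * g z) = Cint mu (fun z => (v n z)%:C%C * h z)) ->
  Cint mu (fun z => (f z)%:C%C * g z) = Cint mu (fun z => (f' z)%:C%C * h z).
Proof.
have Re0 (a : R) (b : C) : Re (a%:C%C * b) = a * Re b by rewrite cReM/= mul0r subr0.
have Im0 (a : R) (b : C) : Im (a%:C%C * b) = a * Im b by rewrite cImM/= mul0r addr0.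
have limw (w : nat -> T -> R) (k : T -> R) (p : T -> C) : (forall n, bdmeas (w n)) ->
    (forall n z, `|w n z| <= M) -> (forall z, w n z @[n --> \oo] --> k z) -> cint mu p ->
    Re (Cint mu (fun z => (w n z)%:C%C * p z)) @[n --> \oo] -->
      Re (Cint mu (fun z => (k z)%:C%C * p z)) /\
    Im (Cint mu (fun z => (w n z)%:C%C * p z)) @[n --> \oo] -->
      Im (Cint mu (fun z => (k z)%:C%C * p z)).
  move=> bw wM wk cp; have [rp ip] := cp.
  have [] // := @Cint_cvg _ _ _ mu (fun n z => (w n z)%:C%C * p z)
    (fun z => (k z)%:C%C * p z) (fun z => M * (`|Re (p z)| + `|Im (p z)|)).
  - by move=> n; apply: cint_meas; apply: bdmeas_cint.
  - by apply: rintZ; apply: rintD; exact: integrable_norm.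
  - by move=> n z; rewrite Re0 normrM; apply: ler_pM; rewrite ?lerDl.
  - by move=> n z; rewrite Im0 normrM; apply: ler_pM; rewrite ?lerDr.
  - move=> z; under eq_fun do rewrite Re0; rewrite Re0.
    by apply: cvgM; [exact: wk|exact: cvg_cst].
  - move=> z; under eq_fun do rewrite Im0; rewrite Im0.
    by apply: cvgM; [exact: wk|exact: cvg_cst].
move=> bu bv uM vM uf vf' cg ch E.
have [r1 i1] := limw _ _ _ bu uM uf cg; have [r2 i2] := limw _ _ _ bv vM vf' ch.
have Eu : (fun n => Cint mu (fun z => (u n z)%:C%C * g z)) =
    (fun n => Cint mu (fun z => (v n z)%:C%C * h z)) by apply: funext => n; exact: E.
apply: cP.
  rewrite -(cvg_lim _ r1)// -(cvg_lim _ r2)//.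
  by have := congr1 (fun w : nat -> C => lim (Re (w n) @[n --> \oo])) Eu.
rewrite -(cvg_lim _ i1)// -(cvg_lim _ i2)//.
by have := congr1 (fun w : nat -> C => lim (Im (w n) @[n --> \oo])) Eu.
Qed.

Section Uniqueness.
Variable f : T -> C.
Hypothesis cf : cint mu f.

(** All frequencies are tested at once, since multiplying [phi] by a coordinate shifts them. *)
Let B : set (T -> R) := [set phi | bdmeas phi /\
  forall k l, Cint mu (fun z => (phi z)%:C%C * (trig k l z * f z)) = 0].

Lemma fourier_indic : (forall k l, Cint mu (fun z => trig k l z * f z) = 0) ->
  forall A, measurable A -> Cint mu (fun z => ((\1_A z : R)%:C)%C * f z) = 0.
Proof.
move=> f0 A mA.
have ci phi k l : bdmeas phi -> cint mu (fun z => (phi z)%:C%C * (trig k l z * f z)).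
  by move=> bp; apply: bdmeas_cint => //; exact: cint_trig.
suff [_ /(_ 0%N 0%N)] : B \1_A.
  by under eq_Cint do rewrite /trig !expr0 !mul1r.
apply: circle_class mA.
- split; first exact: bdmeas_cst.
  by move=> k l; under eq_Cint do rewrite mul1r; exact: f0.
- move=> a g h [bg g0] [bh h0]; split; first exact: bdmeas_lin.
  move=> k l; rewrite (@eq_Cint _ _ _ _ _ (fun z => (a%:C)%C *
    ((g z)%:C%C * (trig k l z * f z)) + (h z)%:C%C * (trig k l z * f z))).
    rewrite CintD ?CintZ ?g0 ?h0 ?mulr0 ?addr0//; try exact: ci.
    by apply: cintZ; exact: ci.
  by move=> z; rewrite rmorphD rmorphM/=; ring.
- move=> g [bg g0]; split; first exact: bdmeasM bdmeas_cx bg.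
  move=> k l; rewrite (@eq_Cint _ _ _ _ _ (fun z => 2^-1 *
    ((g z)%:C%C * (trig k.+1 l z * f z) + (g z)%:C%C * (trig k l.+1 z * f z)))).
    by rewrite CintZ ?CintD ?g0 ?addr0 ?mulr0//; try apply: cintD; exact: ci.
  move=> z; transitivity ((cx z)%:C%C * trig k l z * ((g z)%:C%C * f z)).
    by rewrite rmorphM/=; ring.
  by rewrite cx_trig; ring.
- move=> g [bg g0]; split; first exact: bdmeasM bdmeas_cy bg.
  move=> k l; rewrite (@eq_Cint _ _ _ _ _ (fun z => (2^-1 * 'i) *
    ((g z)%:C%C * (trig k l.+1 z * f z) - (g z)%:C%C * (trig k.+1 l z * f z)))).
    by rewrite CintZ ?CintB ?g0 ?subr0 ?mulr0//; try apply: cintB; exact: ci.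
  move=> z; transitivity ((cy z)%:C%C * trig k l z * ((g z)%:C%C * f z)).
    by rewrite rmorphM/=; ring.
  by rewrite cy_trig; ring.
- by move=> g [[_ [x gx]] _]; exists x.
- move=> u g M Bu uM ug; split.
    by apply: (bdmeas_lim _ uM ug) => n; have [] := Bu n.
  move=> k l; transitivity (Cint mu (fun z => ((fun=> 0 : R) z)%:C%C * (trig k l z * f z))).
    apply: (bd_lim_eq (u := u) (v := fun _ _ => 0) (M := M)) => //.
    - by move=> n; have [] := Bu n.
    - by move=> n; exact: bdmeas_cst.
    - by move=> n z; rewrite normr0 (le_trans _ (uM 0%N z)).
    - by move=> z; exact: cvg_cst.
    - exact: cint_trig.
    - exact: cint_trig.
    - move=> n; have [_ ->] := Bu n.
      by under eq_Cint do rewrite mul0r; rewrite Cint_cst.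
  by under eq_Cint do rewrite mul0r; rewrite Cint_cst.
Qed.

End Uniqueness.

(** Testing on the set where f > 0 forces f <= 0 a.e.; the same applies to - f. *)
Lemma Rint_indic_eq0 (f : T -> R) : rint mu f ->
  (forall A, measurable A -> \int[mu]_z (\1_A z * f z) = 0) -> \forall z \ae mu, f z = 0.
Proof.
move=> rf f0; have mf := rint_meas rf.
have key g : rint mu g -> (forall A, measurable A -> \int[mu]_z (\1_A z * g z) = 0) ->
    \forall z \ae mu, g z <= 0.
  move=> rg g0; have mg := rint_meas rg.
  pose A := setT `&` g @^-1` `]0, +oo[.
  have mA : measurable A by apply: mg => //; exact: measurable_itv.
  have AE z : (\1_A z : R) = (0 < g z)%R%:R.
    rewrite indicE /A setTI; congr (_%:R); congr nat_of_bool.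
    by apply/idP/idP; [rewrite inE/= in_itv/= andbT|rewrite inE/= in_itv/= andbT].
  have h : \forall z \ae mu, \1_A z * g z = 0.
    apply: Rint_eq0; last exact: g0.
      apply: (rintMb _ (M := 1)) => //.
      by move=> z; rewrite AE; case: (0 < _); rewrite ?normr1 ?normr0.
    by move=> z; rewrite AE; case: ltP => [/ltW|]; rewrite ?mul1r ?mul0r.
  apply: filterS h => z; rewrite AE; case: ltP => // g1; rewrite mul1r => g2.
  by move: g1; rewrite g2 ltxx.
have h1 := key _ rf f0.
have h2 : \forall z \ae mu, - f z <= 0.
  apply: key; first exact: rintN.
  move=> A mA; under eq_Rintegral do rewrite mulrN.
  rewrite RintN ?f0 ?oppr0//.
  apply: (rintMb _ (M := 1)) => //.
  by move=> z; rewrite indicE; case: (_ \in _); rewrite ?normr1 ?normr0.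
by apply: filterS2 h1 h2 => z ? ?; apply/eqP; rewrite eq_le; apply/andP; split=> //; lra.
Qed.

Theorem fourier_unique (f : T -> C) : cint mu f ->
  (forall n, Cint mu (fun z => (z : C) ^+ n * f z) = 0) ->
  (forall n, Cint mu (fun z => (z : C)^* ^+ n * f z) = 0) ->
  \forall z \ae mu, f z = 0.
Proof.
move=> cf fp fn.
have f0 k l : Cint mu (fun z => trig k l z * f z) = 0.
  by under eq_Cint do rewrite trigE; case: leqP.
have h := fourier_indic cf f0.
have [rf jf] := cf.
have r0 : \forall z \ae mu, Re (f z) = 0.
  apply: Rint_indic_eq0 => // A mA; have := congr1 (@complex.Re R) (h A mA) => /= <-.
  by congr fine; apply: eq_integral => z _ /=; rewrite cReM/= mul0r subr0.
have i0 : \forall z \ae mu, Im (f z) = 0.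
  apply: Rint_indic_eq0 => // A mA; have := congr1 (@complex.Im R) (h A mA) => /= <-.
  by congr fine; apply: eq_integral => z _ /=; rewrite cImM/= mul0r addr0.
by apply: filterS2 r0 i0 => z ? ?; exact: cP.
Qed.

Lemma measurable_cconj : measurable_fun setT (@cconj R).
Proof.
move=> _ A mA; rewrite setTI.
have := @oppr_measurable R setT measurableT _ mA; rewrite setTI.
congr measurable; apply/seteqP; split=> t /=; congr A; apply: circle_eq;
  by rewrite /cx /cy/= ?cosN ?sinN.
Qed.

Lemma cconjK : involutive (@cconj R).
Proof. by move=> z; apply: val_inj; rewrite /= conjCK. Qed.

Lemma trig_cconj k l z : trig k l (cconj z) = trig l k z.
Proof. by rewrite /trig/= conjCK mulrC. Qed.

Lemma cx_cconj z : cx (cconj z) = cx z. Proof. exact: cReJ. Qed.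
Lemma cy_cconj z : cy (cconj z) = - cy z. Proof. exact: cImJ. Qed.

(** The parameter interval [0, 2 pi] is not symmetric under t -> - t. Rather than cutting and
    translating it, the proof compares trigonometric moments: conjugation exchanges k and l, and
    [Cint_trig] is symmetric in them. *)
Lemma arc_length_cconj A : measurable A -> mu (@cconj R @^-1` A) = mu A.
Proof.
move=> mA.
pose B : set (T -> R) := [set phi | bdmeas phi /\ forall k l,
  Cint mu (fun z => (phi (cconj z))%:C%C * trig k l z) =
  Cint mu (fun z => (phi z)%:C%C * trig l k z)].
have bJ phi : bdmeas phi -> bdmeas (fun z => phi (cconj z)).
  move=> [mp [M pM]]; split; last by exists M.
  exact: measurableT_comp mp measurable_cconj.
have ct k l : cint mu (trig k l).
  have := cint_trig k l (cint_cst mu 1).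
  by congr cint; apply: funext => z; rewrite mulr1.
have ci phi k l : bdmeas phi -> cint mu (fun z => (phi z)%:C%C * trig k l z).
  by move=> bp; apply: bdmeas_cint.
suff [_ /(_ 0%N 0%N)] : B \1_A.
  move=> /(congr1 (@complex.Re R))/=.
  have E phi : \int[mu]_z Re ((phi z)%:C%C * trig 0 0 z) = \int[mu]_z phi z.
    by apply: eq_Rintegral => z _; rewrite /trig !expr0 !mulr1.
  rewrite (E (fun z => \1_A (cconj z))) E.
  have F D : measurable D -> ((\int[mu]_z \1_D z)%:E = mu D)%E.
    by move=> mD; rewrite Rint_EFin ?integral_indic ?setIT//; exact: integrable_indic.
  have mJA : measurable (@cconj R @^-1` A).
    by rewrite -[X in measurable X]setTI; exact: measurable_cconj.
  move=> h; apply: etrans (esym (F _ mJA)) _; apply: etrans _ (F _ mA).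
  by congr EFin; rewrite -h; apply: eq_Rintegral => z _; rewrite !indicE.
apply: circle_class mA.
- split; first exact: bdmeas_cst.
  by move=> k l; under eq_Cint do rewrite mul1r; under [RHS]eq_Cint do rewrite mul1r;
    rewrite !Cint_trig eq_sym.
- move=> a g h [bg g0] [bh h0]; split; first exact: bdmeas_lin.
  have E (p q : T -> R) k l : bdmeas p -> bdmeas q ->
    Cint mu (fun z => (a * p z + q z)%:C%C * trig k l z) =
    a%:C%C * Cint mu (fun z => (p z)%:C%C * trig k l z) +
    Cint mu (fun z => (q z)%:C%C * trig k l z).
    move=> bp bq; rewrite -CintZ -?CintD//; try exact: ci; try by apply: cintZ; exact: ci.
    by apply: eq_Cint => z; rewrite rmorphD rmorphM/= mulrDl mulrA.
  move=> k l; rewrite [RHS]E//.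
  apply: etrans (E (fun z => g (cconj z)) (fun z => h (cconj z)) k l (bJ _ bg) (bJ _ bh)) _.
  by rewrite g0 h0.
- move=> g [bg g0]; split; first exact: bdmeasM bdmeas_cx bg.
  have E (p : T -> R) k l : bdmeas p ->
    Cint mu (fun z => (cx z * p z)%:C%C * trig k l z) =
    2^-1 * (Cint mu (fun z => (p z)%:C%C * trig k.+1 l z) +
    Cint mu (fun z => (p z)%:C%C * trig k l.+1 z)).
    move=> bp; rewrite -CintD ?[in RHS]CintZ//; try exact: ci.
    rewrite -CintZ; last by apply: cintD; exact: ci.
    apply: eq_Cint => z; transitivity ((cx z)%:C%C * trig k l z * (p z)%:C%C).
      by rewrite rmorphM/=; ring.
    by rewrite cx_trig; ring.
  move=> k l; rewrite E// addrC -!g0 -E; last exact: bJ.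
  by apply: eq_Cint => z; rewrite cx_cconj.
- move=> g [bg g0]; split; first exact: bdmeasM bdmeas_cy bg.
  have E (p : T -> R) k l : bdmeas p ->
    Cint mu (fun z => (cy z * p z)%:C%C * trig k l z) =
    (2^-1 * 'i) * (Cint mu (fun z => (p z)%:C%C * trig k l.+1 z) -
    Cint mu (fun z => (p z)%:C%C * trig k.+1 l z)).
    move=> bp; rewrite -CintB//; try exact: ci.
    rewrite -CintZ; last by apply: cintB; exact: ci.
    apply: eq_Cint => z; transitivity ((cy z)%:C%C * trig k l z * (p z)%:C%C).
      by rewrite rmorphM/=; ring.
    by rewrite cy_trig; ring.
  move=> k l; rewrite E// -opprB mulrN -!g0 -E; last exact: bJ.
  rewrite -CintN; last by apply: (ci (fun z => cy z * g (cconj z)));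
    apply: bdmeasM; [exact: bdmeas_cy|exact: bJ].
  by apply: eq_Cint => z; rewrite cy_cconj mulNr rmorphN mulNr.
- by move=> g [[_ [x gx]] _]; exists x.
- move=> u g M Bu uM ug; have bu n : bdmeas (u n) by have [] := Bu n.
  split; first by apply: (bdmeas_lim _ uM ug).
  move=> k l; apply: (bd_lim_eq (u := fun n z => u n (cconj z)) (v := u) (M := M)) => //.
  - by move=> n; exact: bJ.
  - by move=> n; have [_] := Bu n; apply.
Qed.

Lemma integral_cconj (f : T -> \bar R) : measurable_fun setT f -> (forall z, 0 <= f z)%E ->
  (\int[mu]_z f (cconj z) = \int[mu]_z f z)%E.
Proof.
move=> mf f0.
have := ge0_integral_pushforward measurable_cconj mu measurableT mf (fun z _ => f0 z).
rewrite preimage_setT => <-; apply: eq_measure_integral.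
  exact: measurable_cconj.
by move=> ? A mA _; exact: arc_length_cconj.
Qed.

Lemma rint_cconj (f : T -> R) : rint mu f -> rint mu (fun z => f (cconj z)).
Proof.
move=> rf; have mf := rint_meas rf; move/integrableP: (rf) => [_ fi].
apply/integrableP; split.
  by apply/measurable_EFinP; exact: measurableT_comp mf measurable_cconj.
by rewrite (integral_cconj (f := fun z => `|(f z)%:E|%E))//; apply: measurableT_comp => //;
  exact/measurable_EFinP.
Qed.

Lemma Rint_cconj (f : T -> R) : rint mu f -> \int[mu]_z f (cconj z) = \int[mu]_z f z.
Proof.
move=> rf; have mf := rint_meas rf.
have := @integral_pushforward _ _ _ _ _ _ measurable_cconj mu setT (EFin \o f).
rewrite preimage_setT => /(_ _ _ measurableT)/= E.
rewrite /Rintegral -E//; [|exact/measurable_EFinP|exact: rint_cconj].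
congr fine; apply: eq_measure_integral.
  exact: measurable_cconj.
by move=> ? A mA _; exact: arc_length_cconj.
Qed.

Lemma Cint_cconj (f : T -> C) : cint mu f -> Cint mu (fun z => f (cconj z)) = Cint mu f.
Proof. by move=> [/Rint_cconj h1 /Rint_cconj h2]; apply: cP. Qed.

Lemma ae_cconj (Q : set T) : (\forall z \ae mu, Q z) -> \forall z \ae mu, Q (cconj z).
Proof.
move=> [A [mA A0 QA]]; exists (@cconj R @^-1` A); split.
- by rewrite -[X in measurable X]setTI; exact: measurable_cconj.
- by rewrite arc_length_cconj.
- by move=> z /= nQ; apply: QA.
Qed.

End FourierUniqueness.

(** * Square integrable functions *)

Section InnerTheory.
Context {R : realType} {G : hilbertType R}.
Implicit Types (x y w : G) (a : R[i]).
Let H := @hilbert_preHilbert R G.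

Lemma iBl x y w : inner (x - y) w = inner x w - inner y w.
Proof. exact: (phBl H). Qed.
Lemma iZl a x w : inner (a *: x) w = a * inner x w.
Proof. exact: (phZl H). Qed.
Lemma iZr a x w : inner w (a *: x) = a^* * inner w x.
Proof. exact: (phZr H). Qed.
Lemma i0l w : inner 0 w = 0 :> R[i].
Proof. exact: (ph0l H). Qed.
Lemma i0r w : inner w 0 = 0 :> R[i].
Proof. exact: (ph0r H). Qed.

Lemma inner_CS x y : cn2 (inner x y) <= rn x ^+ 2 * rn y ^+ 2.
Proof. by have := ph_CS H (I : setT x) (I : setT y); rewrite /nsq !inner_rn. Qed.

Lemma rn2E x : rn x ^+ 2 = Re (inner x x).
Proof. by rewrite inner_rn. Qed.

Lemma rn2D x y : rn (x + y) ^+ 2 = rn x ^+ 2 + rn y ^+ 2 + Re (inner x y) *+ 2.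
Proof. by have := nsqD H (I : setT x) (I : setT y); rewrite /nsq !inner_rn. Qed.

Lemma rn2B x y : rn (x - y) ^+ 2 = rn x ^+ 2 + rn y ^+ 2 - Re (inner x y) *+ 2.
Proof. by have := nsqB H (I : setT x) (I : setT y); rewrite /nsq !inner_rn. Qed.

Lemma rn2Z a x : rn (a *: x) ^+ 2 = cn2 a * rn x ^+ 2.
Proof. by have := nsqZ H a (I : setT x); rewrite /nsq !inner_rn. Qed.

Lemma rn2D_le x y : rn (x + y) ^+ 2 <= 2 * rn x ^+ 2 + 2 * rn y ^+ 2.
Proof. by have := nsqD_le H (I : setT x) (I : setT y); rewrite /nsq !inner_rn. Qed.

Lemma rnZ a x : rn (a *: x) = Re `|a| * rn x.
Proof. by rewrite /rn normrZ normE cReM /= mulr0 subr0. Qed.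

Lemma inner_Re_le x y : `|Re (inner x y)| <= rn x * rn y.
Proof.
apply: Re_le_cn2; first by rewrite mulr_ge0 ?rn_ge0.
by rewrite exprMn inner_CS.
Qed.

Lemma inner_Im_le x y : `|Im (inner x y)| <= rn x * rn y.
Proof.
apply: Im_le_cn2; first by rewrite mulr_ge0 ?rn_ge0.
by rewrite exprMn inner_CS.
Qed.

Lemma inner_Im_i x y : Im (inner x y) = Re (inner x ('i *: y)).
Proof. by rewrite iZr cReM cReJ cImJ -complexiE/= mul0r sub0r mulN1r opprK. Qed.

End InnerTheory.

Definition seq_dense (R : realType) (G : hilbertType R) (d : nat -> G) :=
  forall x e, 0 < e -> exists j, rn (x - d j) < e.

Lemma separable_seq_dense (R : realType) (G : hilbertType R) :
  separable G -> exists d : nat -> G, seq_dense d.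
Proof.
move=> [A cA dA].
have bo (x : G) (e : R) : 0 < e -> exists2 a, A a & rn (x - a) < e.
  move=> e0; have e0' : 0 < (e%:C)%C :> R[i] by rewrite ltcR.
  have := dA (ball x (e%:C)%C) _ (ball_open x _).
  case; first by exists x; exact: ballxx.
  move=> a []; rewrite -ball_normE /= normE ltcR => h Aa; by exists a.
have [a0 Aa0 _] := bo 0 1 ltr01.
have /pfcard_geP[A0|[f]] := cA; first by rewrite A0 in Aa0.
exists f => x e /(bo x)[a Aa h].
by have [n _ fn] := 'surj_f Aa; exists n; rewrite fn.
Qed.

(** * Weakly measurable functions into a separable space *)

Section WeakMeasurability.
Context {R : realType} {G : hilbertType R} (d : nat -> G) (dd : seq_dense d).
Local Notation T := (circle R).
Implicit Types (f g : T -> G) (a : R[i]).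

Lemma wm_cst (x : G) : wmeasurable (fun _ : T => x).
Proof. by move=> y; split; exact: measurable_cst. Qed.

Lemma wm_lin a f g : wmeasurable f -> wmeasurable g -> wmeasurable (fun z => a *: f z + g z).
Proof.
move=> mf mg x; suff : cmeas (fun z => inner (a *: f z + g z) x) by [].
under eq_fun do rewrite innerDl.
exact: cmeasD (cmeasM (cmeas_cst _ a) (mf x)) (mg x).
Qed.

(* [|v|^2] is the supremum of [|v|^2 - |v - d_j|^2], which is affine in [v]. *)
Lemma wm_rn2 f : wmeasurable f -> measurable_fun setT (fun z => rn (f z) ^+ 2).
Proof.
move=> mf.
apply: (@measurable_sup _ _ _ _ (fun j z => Re (inner (f z) (d j)) *+ 2 - rn (d j) ^+ 2)).
- move=> j; apply: measurable_funB; last exact: measurable_cst.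
  under eq_fun do rewrite mulr2n; apply: measurable_funD; exact: (mf (d j)).1.
- by move=> j z; have := sqr_ge0 (rn (f z - d j)); rewrite rn2B; lra.
- move=> z e e0.
  have [j hj] : exists j, rn (f z - d j) < Num.sqrt e by apply: dd; rewrite sqrtr_gt0.
  exists j; have : rn (f z - d j) ^+ 2 < e.
    by rewrite -[ltRHS]sqr_sqrtr ?ltW// ltr_pXn2r ?nnegrE ?rn_ge0 ?sqrtr_ge0.
  by rewrite rn2B; lra.
Qed.

Lemma wm_inner f g : wmeasurable f -> wmeasurable g ->
  cmeas (fun z => inner (f z) (g z)).
Proof.
have key (h k : T -> G) : wmeasurable h -> wmeasurable k ->
    measurable_fun setT (fun z => Re (inner (h z) (k z))).
  move=> mh mk.
  have E z : Re (inner (h z) (k z)) =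
      2^-1 * (rn (1 *: h z + k z) ^+ 2 - rn (h z) ^+ 2 - rn (k z) ^+ 2).
    by rewrite scale1r rn2D; lra.
  under eq_fun do rewrite E.
  apply: measurable_funM; first exact: measurable_cst.
  apply: measurable_funB; last exact: (wm_rn2 mk).
  by apply: measurable_funB; [exact: (wm_rn2 (wm_lin 1 mh mk))|exact: (wm_rn2 mh)].
move=> mf mg; split; first exact: key.
under eq_fun do rewrite inner_Im_i.
apply: key => //.
have := wm_lin 'i mg (wm_cst 0); by under eq_fun do rewrite addr0.
Qed.

Lemma wm_scale (h : T -> R[i]) f : cmeas h -> wmeasurable f -> wmeasurable (fun z => h z *: f z).
Proof.
move=> mh mf x; suff : cmeas (fun z => inner (h z *: f z) x) by [].
by under eq_fun do rewrite iZl; apply: cmeasM => //; exact: mf.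
Qed.

Lemma wm_cconj f : wmeasurable f -> wmeasurable (fun z => f (cconj z)).
Proof.
move=> mf x; have [m1 m2] := mf x; split.
  exact: measurableT_comp m1 measurable_cconj.
exact: measurableT_comp m2 measurable_cconj.
Qed.

Lemma wm_cvg (u : nat -> T -> G) f : (forall n, wmeasurable (u n)) ->
  (forall z e, 0 < e -> exists N, forall n, (N <= n)%N -> rn (u n z - f z) < e) ->
  wmeasurable f.
Proof.
move=> mu uf x.
have cv (p : R[i] -> R) : (forall a b, p (a - b) = p a - p b) ->
    (forall y, `|p (inner y x)| <= rn y * rn x) ->
    forall z, p (inner (u n z) x) @[n --> \oo] --> p (inner (f z) x).
  move=> pB pb z; apply/cvgrPdist_lt => e e0.
  have e1 : 0 < e / (rn x + 1) by rewrite divr_gt0// ltr_wpDl ?rn_ge0.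
  have [N NP] := uf z _ e1; exists N => // n /= /NP h.
  rewrite -pB -iBl; apply: le_lt_trans (pb _) _; rewrite rnB.
  apply: (@le_lt_trans _ _ (rn (u n z - f z) * (rn x + 1))).
    by rewrite ler_wpM2l ?rn_ge0// lerDl.
  by rewrite -ltr_pdivlMr// ltr_wpDl ?rn_ge0.
split.
  apply: (@measurable_fun_cvg _ _ _ _ (fun n z => Re (inner (u n z) x))).
    by move=> n; have [] := mu n x.
  move=> z _; apply: cv => [a b|y]; first by rewrite cReD cReN.
  exact: inner_Re_le.
apply: (@measurable_fun_cvg _ _ _ _ (fun n z => Im (inner (u n z) x))).
  by move=> n; have [] := mu n x.
move=> z _; apply: cv => [a b|y]; first by rewrite cImD cImN.
exact: inner_Im_le.
Qed.

End WeakMeasurability.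

Section L2Theory.
Context {R : realType} {G : hilbertType R} (d : nat -> G) (dd : seq_dense d).
Local Notation T := (circle R).
Local Notation mu := (@arc_length R).
Local Notation nsq := (nsq (@ip R G)).
Implicit Types (f g : T -> G) (a : R[i]).

Lemma L2P f : L2 f <-> wmeasurable f /\ rint mu (fun z => rn (f z) ^+ 2).
Proof.
split=> -[mf fi]; split=> //.
  apply/integrableP; split; first by apply/measurable_EFinP; exact: wm_rn2 dd _ mf.
  apply: le_lt_trans fi; rewrite le_eqVlt; apply/orP; left; apply/eqP.
  by apply: eq_integral => z _ /=; rewrite ger0_norm ?sqr_ge0.
move/integrableP: fi => [_]; apply: le_lt_trans; rewrite le_eqVlt; apply/orP; left; apply/eqP.
by apply: eq_integral => z _ /=; rewrite ger0_norm ?sqr_ge0.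
Qed.

Lemma L2_wm f : L2 f -> wmeasurable f. Proof. by case. Qed.

Lemma L2_rint f : L2 f -> rint mu (fun z => rn (f z) ^+ 2).
Proof. by move=> /L2P[]. Qed.

Lemma L2_cint f g : L2 f -> L2 g -> cint mu (fun z => inner (f z) (g z)).
Proof.
move=> Lf Lg; have [mr mi] := wm_inner dd (L2_wm Lf) (L2_wm Lg).
have b z : rn (f z) * rn (g z) <= rn (f z) ^+ 2 + rn (g z) ^+ 2.
  have := sqr_ge0 (rn (f z) - rn (g z)); have := sqr_ge0 (rn (f z) + rn (g z)).
  by rewrite sqrrB sqrrD; move: (rn (f z)) (rn (g z)) => r s; lra.
split; apply: rint_le (rintD (L2_rint Lf) (L2_rint Lg)) => // z.
  exact: le_trans (inner_Re_le _ _) (b z).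
exact: le_trans (inner_Im_le _ _) (b z).
Qed.

Lemma L2_0 : L2 (0 : T -> G).
Proof.
apply/L2P; split; first exact: wm_cst.
by rewrite (_ : (fun z => _) = fun=> 0); [exact: rint_cst|apply: funext => z; rewrite rn0 expr0n].
Qed.

Lemma L2_dom f (h : T -> R) : wmeasurable f -> (forall z, rn (f z) ^+ 2 <= h z) -> rint mu h -> L2 f.
Proof.
move=> mf fh rh; apply/L2P; split=> //; apply: rint_le rh; first exact: wm_rn2 dd _ mf.
by move=> z; rewrite ger0_norm ?sqr_ge0.
Qed.

Lemma L2_lin a f g : L2 f -> L2 g -> L2 (a *: f + g).
Proof.
move=> Lf Lg; apply: (@L2_dom _ (fun z => 2 * (cn2 a * rn (f z) ^+ 2) + 2 * rn (g z) ^+ 2)).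
- exact: wm_lin (L2_wm Lf) (L2_wm Lg).
- by move=> z; rewrite /= -rn2Z; exact: rn2D_le.
- by apply: rintD; apply: rintZ; [apply: rintZ|]; exact: L2_rint.
Qed.

Lemma ip_cint f g : ip f g = Cint mu (fun z => inner (f z) (g z)).
Proof. by []. Qed.

Lemma nsqE f : nsq f = \int[mu]_z rn (f z) ^+ 2.
Proof. by rewrite /Defs.ip/=; apply: eq_Rintegral => z _; rewrite rn2E. Qed.

Lemma sqnorm_nsq f : L2 f -> sqnorm f = (nsq f)%:E.
Proof. by move=> Lf; rewrite nsqE Rint_EFin; [|exact: L2_rint]. Qed.

Lemma L2_ae f g : wmeasurable g -> L2 f -> (\forall z \ae mu, f z = g z) -> L2 g.
Proof.
move=> mg Lf fg; apply/L2P; split=> //.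
apply: rint_ae (L2_rint Lf); first exact: wm_rn2 dd _ mg.
by apply: filterS fg => z ->.
Qed.

Lemma nsq_ae0 f : L2 f -> nsq f = 0 -> \forall z \ae mu, f z = 0.
Proof.
move=> Lf; rewrite nsqE => f0.
have := Rint_eq0 (L2_rint Lf) (fun z => sqr_ge0 _) f0.
by apply: filterS => z /eqP; rewrite sqrf_eq0 => /eqP/rn_eq0.
Qed.

Lemma ip_ae f f' g g' : L2 f -> L2 f' -> L2 g -> L2 g' ->
  (\forall z \ae mu, f z = f' z) -> (\forall z \ae mu, g z = g' z) -> ip f g = ip f' g'.
Proof.
move=> Lf Lf' Lg Lg' ff' gg'; rewrite !ip_cint; apply: Cint_ae.
- exact/cint_meas/L2_cint.
- exact/cint_meas/L2_cint.
- by apply: filterS2 ff' gg' => z -> ->.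
Qed.

End L2Theory.

(** * Completeness of L^2 *)

Section L2Complete.
Context {R : realType} {G : hilbertType R} (d : nat -> G) (dd : seq_dense d).
Local Notation T := (circle R).
Local Notation mu := (@arc_length R).
Local Notation nsq := (nsq (@ip R G)).
Implicit Types (f g h : T -> G) (a : R[i]).

Lemma ip_Dl a f g h : L2 f -> L2 g -> L2 h -> ip (a *: f + g) h = a * ip f h + ip g h.
Proof.
move=> Lf Lg Lh; rewrite !ip_cint.
rewrite -CintZ; last exact: (L2_cint dd Lf Lh).
rewrite -CintD; [|apply: cintZ; exact: (L2_cint dd Lf Lh)|exact: (L2_cint dd Lg Lh)].
by apply: eq_Cint => z; rewrite /= innerDl.
Qed.

Lemma ip_C f g : L2 f -> L2 g -> ip g f = (ip f g)^*.
Proof.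
move=> Lf Lg; rewrite !ip_cint -CintJ; last exact: (L2_cint dd Lf Lg).
by apply: eq_Cint => z; rewrite -innerC.
Qed.

Lemma ip_ge0 f : L2 f -> 0 <= ip f f.
Proof.
move=> Lf; rewrite lecE/=; apply/andP; split.
  by apply/eqP; rewrite -(Rint_cst mu 0); apply: eq_Rintegral => z _; rewrite inner_rn.
by apply: Rintegral_ge0 => z _; rewrite inner_rn/= sqr_ge0.
Qed.

(** The sum of the series has integral at most 2, so it is finite a.e.; [A] is the set where it is
    finite, and [s] is the sum there and 0 elsewhere. *)
Lemma summable_ae (a_ : nat -> T -> R) : (forall k, rint mu (a_ k)) ->
  (forall k z, 0 <= a_ k z) -> (forall k, \int[mu]_z a_ k z <= 2^-1 ^+ k) ->
  exists (A : set T) (s : T -> R), [/\ measurable A, \forall z \ae mu, A z,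
    rint mu s, forall z, 0 <= s z & forall k z, A z -> a_ k z <= s z].
Proof.
move=> ra a0 ia.
have ma k : measurable_fun setT (fun z => (a_ k z)%:E) by have := measurable_int _ (ra k).
pose S z := (\sum_(0 <= k <oo) (a_ k z)%:E)%E.
have a0' k z : (0 <= (a_ k z)%:E)%E by rewrite lee_fin.
have mS : measurable_fun setT S.
  by apply: (@ge0_emeasurable_sum _ _ _ _ (fun k z => (a_ k z)%:E) xpredT).
have S0 z : (0 <= S z)%E by apply: nneseries_ge0.
have iS : (\int[mu]_z S z <= 2%:E)%E.
  rewrite /S integral_nneseries//; apply: lime_le.
    by apply: is_cvg_nneseries => n _ _; apply: integral_ge0.
  apply: nearW => n.
  apply: (@le_trans _ _ (\sum_(0 <= k < n) ((2^-1 ^+ k : R)%:E))%E).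
    by apply: lee_sum => k _; rewrite -Rint_EFin// lee_fin.
  rewrite sumEFin lee_fin.
  suff -> : \sum_(0 <= k < n) (2^-1 ^+ k : R) = 2 - 2 * 2^-1 ^+ n.
    by rewrite gerBl mulr_ge0// exprn_ge0// invr_ge0.
  elim: n => [|n IH]; first by rewrite big_geq// expr0 mulr1 subrr.
  by rewrite big_nat_recr//= IH exprS; lra.
pose A := [set z | S z \is a fin_num].
have intS : mu.-integrable setT S.
  apply/integrableP; split=> //.
  under eq_integral do rewrite gee0_abs//.
  exact: le_lt_trans iS (ltry _).
have mA : measurable A.
  by have := emeasurable_fin_num measurableT mS; rewrite setTI.
exists A, (fine \o S); split=> //.
- by have := integrable_ae measurableT intS; apply: filterS => z /(_ I).
- have mfS : measurable_fun setT (fine \o S) by apply: measurableT_comp.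
  apply/integrableP; split; first exact/measurable_EFinP.
  apply: le_lt_trans (ltry 2); apply: le_trans iS; apply: ge0_le_integral => //.
    by apply: measurableT_comp => //; apply/measurable_EFinP; apply: measurableT_comp.
  move=> z _ /=; rewrite ger0_norm ?fine_ge0//.
  by have := S0 z; case: (S z) => [r||]//=; rewrite ?leey.
- by move=> z /=; rewrite fine_ge0.
- move=> k z Az; rewrite -lee_fin /= fineK//.
  apply: le_trans (nneseries_lim_ge k.+1 _) => //.
  by rewrite big_nat_recr//= leeDr// sume_ge0.
Qed.

(** The weighted squared increments 4^k |u_(k+1) - u_k|^2 have integrals at most (4/8)^k, so a
    common integrable [s] bounds them a.e. Pointwise limits then come with the error bound 4 4^-n s,
    which integrates to convergence in norm. *)
Lemma L2_complete (u : nat -> T -> G) : (forall n, L2 (u n)) ->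
  (forall n, nsq (u n.+1 - u n) <= 8^-1 ^+ n) ->
  exists2 l, L2 l & nsq (u n - l) @[n --> \oo] --> (0 : R).
Proof.
move=> Lu us.
have LB f g : L2 f -> L2 g -> L2 (f - g).
  by move=> Lf Lg; rewrite addrC -scaleN1r; exact: (L2_lin dd _ Lg Lf).
have ra k : rint mu (fun z => 4 ^+ k * rn (u k.+1 z - u k z) ^+ 2).
  by apply: rintZ; exact: (L2_rint dd (LB _ _ (Lu k.+1) (Lu k))).
have ia k : \int[mu]_z (4 ^+ k * rn (u k.+1 z - u k z) ^+ 2) <= 2^-1 ^+ k.
  rewrite RintZ; last exact: (L2_rint dd (LB _ _ (Lu k.+1) (Lu k))).
  have := us k; rewrite nsqE => h; apply: le_trans (ler_wpM2l _ h) _.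
    exact: exprn_ge0.
  by rewrite -exprMn; apply: lerXn2r; rewrite ?nnegrE; lra.
have [A [s [mA aeA rs s0 As]]] := summable_ae ra
  (fun k z => mulr_ge0 (exprn_ge0 _ (ler0n _ _)) (sqr_ge0 _)) ia.
have limz z : exists l, A z -> forall n, rn (u n z - l) <= 2 * Num.sqrt (s z) * 2^-1 ^+ n.
  have [Az|nA] := pselect (A z); last by exists 0.
  have [|l lP] := @dyadic_complete _ _ (fun n => u n z) (Num.sqrt (s z)); last by exists l.
  move=> n; rewrite -(@ler_pXn2r _ 2)// ?nnegrE ?rn_ge0 ?mulr_ge0 ?sqrtr_ge0 ?exprn_ge0 ?invr_ge0//.
  rewrite exprMn sqr_sqrtr// -exprM mulnC exprM.
  rewrite (_ : 2^-1 ^+ 2 = 4^-1 :> R); last by lra.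
  by rewrite exprVn ler_pdivlMr ?exprn_gt0// mulrC; exact: As.
have [l lP] := choice limz.
pose c z : R[i] := ((\1_A z : R)%:C)%C.
have mc : cmeas c by split; [exact: measurable_indic|exact: measurable_cst].
have cA z : A z -> c z = 1 by move=> Az; rewrite /c indicE mem_set.
have cnA z : ~ A z -> c z = 0 by move=> Az; rewrite /c indicE memNset.
(* Cutting off outside [A] makes the convergence hold at every point, as [wm_cvg] requires. *)
pose f z := c z *: l z.
pose v n z := c z *: u n z.
have mv n : wmeasurable (v n) by apply: wm_scale => //; exact: L2_wm (Lu n).
have vf n z : rn (v n z - f z) ^+ 2 <= 4 * 4^-1 ^+ n * s z.
  have [Az|nA] := pselect (A z); last first.
    rewrite /v /f cnA// !scale0r subrr rn0 expr0n/=.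
    by rewrite !mulr_ge0// exprn_ge0// invr_ge0.
  rewrite /v /f cA// !scale1r.
  rewrite (_ : 4 * 4^-1 ^+ n * s z = (2 * Num.sqrt (s z) * 2^-1 ^+ n) ^+ 2).
    by apply: lerXn2r; rewrite ?nnegrE ?rn_ge0 ?mulr_ge0 ?sqrtr_ge0 ?exprn_ge0 ?invr_ge0//; exact: lP.
  have e2 : (2^-1 ^+ n) ^+ 2 = 4^-1 ^+ n :> R.
    by rewrite -exprM mulnC exprM; congr (_ ^+ _); lra.
  by rewrite !exprMn sqr_sqrtr// e2; ring.
have cv4 : (4^-1 ^+ n : R) @[n --> \oo] --> (0 : R).
  by apply: cvg_expr; rewrite ger0_norm// invf_lt1// ltr1n.
have mf : wmeasurable f.
  apply: (wm_cvg mv) => z e e0.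
  have p : 0 < e ^+ 2 / (4 * s z + 1) by rewrite divr_gt0 ?exprn_gt0// ltr_wpDl ?mulr_ge0.
  move/cvgrPdist_lt : cv4 => /(_ _ p)[N _ NP]; exists N => n /NP /=.
  rewrite sub0r normrN ger0_norm ?exprn_ge0 ?invr_ge0// ltr_pdivlMr ?ltr_wpDl ?mulr_ge0// => h.
  rewrite -(@ltr_pXn2r _ 2)// ?nnegrE ?rn_ge0 ?ltW//.
  apply: le_lt_trans (vf n z) _; apply: le_lt_trans h.
  rewrite [4 * _]mulrC -mulrA ler_wpM2l ?exprn_ge0 ?invr_ge0//.
  by rewrite lerDl.
have Lvf n : L2 (v n - f).
  apply: (L2_dom dd _ (vf n)); last exact: rintZ.
  have := wm_lin (-1) mf (mv n).
  by congr wmeasurable; apply: funext => z; rewrite scaleN1r addrC.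
have Lv n : L2 (v n).
  apply: (L2_dom dd (mv n) _ (L2_rint dd (Lu n))) => z.
  rewrite /v; have [/cA ->|/cnA ->] := pselect (A z); first by rewrite scale1r.
  by rewrite scale0r rn0 expr0n/= sqr_ge0.
have Lf : L2 f by rewrite -[f](subKr (v 0%N)); exact: LB.
exists f => //.
have E n : nsq (u n - f) = nsq (v n - f).
  suff h : ip (u n - f) (u n - f) = ip (v n - f) (v n - f) by exact: congr1 h.
  apply: (ip_ae dd) => //; try exact: LB.
    by apply: filterS aeA => z Az; change (u n z - f z = c z *: u n z - f z); rewrite cA// scale1r.
  by apply: filterS aeA => z Az; change (u n z - f z = c z *: u n z - f z); rewrite cA// scale1r.
have cv : 4 * 4^-1 ^+ n * \int[mu]_z s z @[n --> \oo] --> 4 * 0 * \int[mu]_z s z.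
  by apply: cvgM; [apply: cvgM => //|]; exact: cvg_cst.
rewrite mulr0 mul0r in cv.
apply: squeeze_cvgr (cvg_cst 0) cv; near=> n.
rewrite E nsqE -RintZ//; apply/andP; split.
  by apply: Rintegral_ge0 => z _; exact: sqr_ge0.
by apply: le_Rintegral => //; [exact: (L2_rint dd (Lvf n))|exact: rintZ|move=> z _; exact: vf].
Unshelve. all: by end_near. Qed.

Theorem L2_preHilbert : preHilbert (@L2 R G) (@ip R G).
Proof.
split.
- split; first exact: (L2_0 dd).
  by move=> a f g; exact: (L2_lin dd).
- exact: ip_Dl.
- exact: ip_C.
- exact: ip_ge0.
- exact: L2_complete.
Qed.

End L2Complete.

(** * Multiplication by bounded operator functions *)

Section Multiplication.
Context {R : realType} {E F : hilbertType R} (dE : nat -> E) (dF : nat -> F).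
Hypotheses (ddE : seq_dense dE) (ddF : seq_dense dF).
Local Notation T := (circle R).
Local Notation mu := (@arc_length R).
Implicit Types (Phi : T -> E -> F) (f g : T -> E).

Lemma Linfty_bd Phi : Linfty setT Phi ->
  exists2 M : R, 0 <= M & forall z x, rn (Phi z x) <= M * rn x.
Proof.
move=> [_ [M MP] _]; exists (Num.max M 0); first by rewrite le_max lexx orbT.
move=> z x; apply: (@le_trans _ _ (M * rn x)); last first.
  by rewrite ler_wpM2r ?rn_ge0// le_max lexx.
by have := MP z x I; rewrite !normE -rmorphM/= lecR.
Qed.

Lemma Linfty_lin Phi z a x y : Linfty setT Phi ->
  Phi z (a *: x + y) = a *: Phi z x + Phi z y.
Proof. by move=> [h _ _]; exact: h. Qed.

Lemma Linfty_0 Phi z : Linfty setT Phi -> Phi z 0 = 0.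
Proof.
move=> LP; have := Linfty_lin z 1 0 0 LP; rewrite !scale1r addr0 => /eqP.
by rewrite -subr_eq0 opprD addrA subrr sub0r oppr_eq0 => /eqP.
Qed.

Lemma Linfty_B Phi z x y : Linfty setT Phi -> Phi z (x - y) = Phi z x - Phi z y.
Proof. by move=> LP; rewrite addrC -scaleN1r Linfty_lin// scaleN1r addrC. Qed.

(* By the Lipschitz bound [Re <Phi z v, y>] is the infimum over [j] of
   [Re <Phi z d_j, y> + M |y| |v - d_j|]. *)
Lemma Linfty_wm Phi f : Linfty setT Phi -> wmeasurable f -> wmeasurable (fun z => Phi z (f z)).
Proof.
move=> LP mf; have [M M0 MP] := Linfty_bd LP; have [_ _ mP] := LP.
have key y : measurable_fun setT (fun z => Re (inner (Phi z (f z)) y)).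
  apply: (@measurable_inf _ _ _ _ (fun j z => Re (inner (Phi z (dE j)) y) +
      M * rn y * Num.sqrt (rn ((-1) *: f z + dE j) ^+ 2))).
  - move=> j; apply: measurable_funD; first by have [] := mP (dE j) I y.
    apply: measurable_funM; first exact: measurable_cst.
    apply: (measurableT_comp (continuous_measurable_fun (@sqrt_continuous R))).
    exact: (wm_rn2 ddE (wm_lin (-1) mf (wm_cst (dE j)))).
  - move=> j z; rewrite sqrtr_sqr ger0_norm ?rn_ge0// scaleN1r -lerBlDl -cReN -cReD -iBl -Linfty_B//.
    apply: le_trans (ler_norm _) _; apply: le_trans (inner_Re_le _ _) _.
    rewrite mulrAC ler_wpM2r ?rn_ge0//; apply: le_trans (MP _ _) _.
    by rewrite rnB [- f z + _]addrC.
  - move=> z e e0.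
    have p : 0 < 2 * (M * rn y) + 1 by rewrite ltr_wpDl ?mulr_ge0 ?rn_ge0.
    have [j hj] := ddE (f z) (divr_gt0 e0 p).
    exists j; rewrite sqrtr_sqr ger0_norm ?rn_ge0// scaleN1r [- f z + _]addrC.
    move: hj; rewrite ltr_pdivlMr// rnB => hj.
    have h1 : Re (inner (Phi z (dE j)) y) - Re (inner (Phi z (f z)) y) <= M * rn y * rn (dE j - f z).
      rewrite -cReN -cReD -iBl -Linfty_B//.
      apply: le_trans (ler_norm _) _; apply: le_trans (inner_Re_le _ _) _.
      by rewrite mulrAC ler_wpM2r ?rn_ge0.
    have := rn_ge0 (dE j - f z); move: hj h1.
    set r := rn (dE j - f z); set p1 := M * rn y.
    have -> : r * (2 * p1 + 1) = 2 * (p1 * r) + r by ring.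
    by lra.
move=> y; split; first exact: key.
by under eq_fun do rewrite inner_Im_i; exact: key.
Qed.

Lemma Linfty_mul Phi f : Linfty setT Phi -> L2 f -> L2 (fun z => Phi z (f z)).
Proof.
move=> LP Lf; have [M M0 MP] := Linfty_bd LP.
apply: (L2_dom ddF (Linfty_wm LP (L2_wm Lf)) (h := fun z => M ^+ 2 * rn (f z) ^+ 2)).
  by move=> z; rewrite -exprMn; apply: lerXn2r; rewrite ?nnegrE ?rn_ge0 ?mulr_ge0 ?rn_ge0.
by apply: rintZ; exact: (L2_rint ddE Lf).
Qed.

Lemma Linfty_nsq Phi : Linfty setT Phi -> exists2 K : R, 0 <= K &
  forall f, L2 f -> nsq (@ip R F) (fun z => Phi z (f z)) <= K * nsq (@ip R E) f.
Proof.
move=> LP; have [M M0 MP] := Linfty_bd LP; exists (M ^+ 2); first exact: sqr_ge0.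
move=> f Lf; rewrite !nsqE -RintZ; last exact: (L2_rint ddE Lf).
apply: le_Rintegral => //.
- exact: (L2_rint ddF (Linfty_mul LP Lf)).
- by apply: rintZ; exact: (L2_rint ddE Lf).
- by move=> z _; rewrite -exprMn; apply: lerXn2r; rewrite ?nnegrE ?rn_ge0 ?mulr_ge0 ?rn_ge0.
Qed.

End Multiplication.

(** * Scalar multipliers and Fourier uniqueness in L^2 *)

Section Scaling.
Context {R : realType} {G : hilbertType R} (d : nat -> G) (dd : seq_dense d).
Local Notation T := (circle R).
Local Notation C := R[i].
Local Notation mu := (@arc_length R).
Local Notation nsq := (nsq (@ip R G)).
Implicit Types (f g h : T -> G) (c : T -> C) (x : G).
Let H := L2_preHilbert dd.

Lemma L2_scale c (M : R) f : cmeas c -> (forall z, cn2 (c z) <= M) -> L2 f ->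
  L2 (fun z => c z *: f z).
Proof.
move=> mc cM Lf; apply: (L2_dom dd (wm_scale mc (L2_wm Lf)) (h := fun z => M * rn (f z) ^+ 2)).
  by move=> z; rewrite rn2Z ler_wpM2r ?sqr_ge0.
by apply: rintZ; exact: (L2_rint dd Lf).
Qed.

Lemma ip_scale c f g : ip (fun z => c z *: f z) g = ip f (fun z => (c z)^* *: g z).
Proof. by apply: eq_Cint => z; rewrite iZl iZr conjCK. Qed.

Lemma nsq_unimod c f : (forall z, cn2 (c z) = 1) -> nsq (fun z => c z *: f z) = nsq f.
Proof.
by move=> c1; rewrite !nsqE; apply: eq_Rintegral => z _; rewrite rn2Z c1 mul1r.
Qed.

Definition tmul k l f : T -> G := fun z => trig k l z *: f z.

Lemma L2_tmul k l f : L2 f -> L2 (tmul k l f).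
Proof. by apply: (L2_scale (M := 1)); [exact: cmeas_trig|move=> z; rewrite cn2_trig]. Qed.

Lemma ip_tmul k l f g : ip (tmul k l f) g = ip f (tmul l k g).
Proof. by rewrite /tmul ip_scale; apply: eq_Cint => z; rewrite trigJ. Qed.

Lemma trigM k l k' l' (z : T) : trig k l z * trig k' l' z = trig (k + k') (l + l') z.
Proof. by rewrite /trig mulrACA -!exprD. Qed.

Lemma tmulM k l k' l' f : tmul k l (tmul k' l' f) = tmul (k + k') (l + l') f.
Proof. by apply: funext => z; rewrite /tmul scalerA trigM. Qed.

Lemma trigSS k l (z : T) : trig k.+1 l.+1 z = trig k l z.
Proof. by rewrite !trigE ltnS !subSS. Qed.

Lemma tmulSS k l f : tmul k.+1 l.+1 f = tmul k l f.
Proof. by apply: funext => z; rewrite /tmul trigSS. Qed.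

Lemma tmul00 f : tmul 0 0 f = f.
Proof. by apply: funext => z; rewrite /tmul /trig !expr0 mulr1 scale1r. Qed.

Lemma tmulnn k f : tmul k k f = f.
Proof. by elim: k => [|k IH]; rewrite ?tmul00// tmulSS. Qed.

Lemma mulzE f : mulz f = tmul 1 0 f.
Proof. by apply: funext => z; rewrite /tmul /trig expr0 mulr1. Qed.

Lemma tmul_lin k l (a : C) f g : tmul k l (a *: f + g) = a *: tmul k l f + tmul k l g.
Proof.
by apply: funext => z; rewrite /tmul scalerDr scalerA mulrC -scalerA.
Qed.

Lemma nsq_tmul k l f : nsq (tmul k l f) = nsq f.
Proof. by apply: nsq_unimod => z; exact: cn2_trig. Qed.

Lemma L2_cst x : L2 (fun _ : T => x).
Proof. by apply: (L2_dom dd (wm_cst x) (h := fun=> rn x ^+ 2)) => //; exact: rint_cst. Qed.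

Lemma fourier_L2 f : L2 f -> (forall k l j, ip f (tmul k l (fun=> d j)) = 0) ->
  \forall z \ae mu, f z = 0.
Proof.
move=> Lf h.
have h0 j : \forall z \ae mu, inner (f z) (d j) = 0.
  apply: fourier_unique.
  - exact: (L2_cint dd Lf (L2_cst (d j))).
  - move=> n; rewrite -(h 0%N n j); apply: eq_Cint => z.
    by rewrite /tmul /trig iZr expr0 mul1r rmorphXn /= conjCK.
  - move=> n; rewrite -(h n 0%N j); apply: eq_Cint => z.
    by rewrite /tmul /trig iZr expr0 mulr1 rmorphXn.
(* The sequence [d] is countable, so the exceptional null sets can be united; density then turns
   orthogonality to every [d j] into vanishing. *)
have hall : \forall z \ae mu, forall j, inner (f z) (d j) = 0 by exact: ae_foralln.
apply: filterS hall => z hz; apply: rn_eq0; apply/eqP; rewrite -sqrf_eq0; apply/eqP.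
apply/eqP; rewrite eq_le sqr_ge0 andbT; apply/ler_addgt0Pr => e e0.
have [|j hj] := dd (f z) (e := Num.sqrt e); first by rewrite sqrtr_gt0.
have : rn (f z - d j) ^+ 2 < e.
  by rewrite -[ltRHS]sqr_sqrtr ?ltW// ltr_pXn2r ?nnegrE ?rn_ge0 ?sqrtr_ge0.
rewrite rn2B hz/= mul0rn subr0 add0r; have := sqr_ge0 (rn (d j)).
by lra.
Qed.

Lemma nsq_ae f : L2 f -> (\forall z \ae mu, f z = 0) -> nsq f = 0.
Proof.
move=> Lf f0; rewrite nsqE -(Rint_cst mu 0); apply: Rint_ae.
- exact: (wm_rn2 dd (L2_wm Lf)).
- exact: measurable_cst.
- by apply: filterS f0 => z ->; rewrite rn0 expr0n.
Qed.

Lemma nsq_B0 f g : L2 f -> L2 g -> nsq (f - g) = 0 -> \forall z \ae mu, f z = g z.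
Proof.
move=> Lf Lg /(nsq_ae0 dd (phLB H Lf Lg)); apply: filterS => z /eqP.
by rewrite [(f - g) z]/(f z - g z) subr_eq0 => /eqP.
Qed.

End Scaling.

(** * Hardy spaces, Toeplitz and Hankel operators *)

Section Hardy.
Context {R : realType} {G : hilbertType R} (d : nat -> G) (dd : seq_dense d).
Local Notation T := (circle R).
Local Notation C := R[i].
Local Notation mu := (@arc_length R).
Local Notation nsq := (nsq (@ip R G)).
Implicit Types (f g h : T -> G) (x y : G).
Let H := L2_preHilbert dd.

Lemma H2P f : H2 f <-> L2 f /\ forall n x, (0 < n)%N -> ip f (tmul 0 n (fun=> x)) = 0.
Proof.
split=> -[Lf h]; split=> // n x n0; have := h n x n0; move=> <-; apply: eq_Cint => z;
  by rewrite /tmul /trig expr0 mul1r.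
Qed.

Lemma H2_L2 f : H2 f -> L2 f. Proof. by case. Qed.

Lemma ip_cst x y k l : ip (fun=> x) (tmul k l (fun=> y)) = inner x y * Cint mu (trig l k).
Proof.
rewrite -CintZ; last first.
  have := cint_trig l k (cint_cst mu 1); congr cint.
  by apply: funext => z; rewrite mulr1.
by apply: eq_Cint => z; rewrite /tmul iZr trigJ mulrC.
Qed.

Let Sneg : set (T -> G) := [set s | exists n x, (0 < n)%N /\ s = tmul 0 n (fun=> x)].

Lemma H2_closed : closed_sub (@L2 R G) (@ip R G) (@H2 R G).
Proof.
suff -> : @H2 R G = orth (@L2 R G) (@ip R G) Sneg.
  by apply: (orth_closed H) => _ [n [x [_ ->]]]; apply: (L2_tmul dd); exact: (L2_cst dd).
apply/seteqP; split=> f.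
  by move=> /H2P[Lf h]; split=> // _ [n [x [n0 ->]]]; exact: h.
by move=> [Lf h]; apply/H2P; split=> // n x n0; apply: h; exists n, x.
Qed.

Lemma H2_tmul k f : H2 f -> H2 (tmul k 0 f).
Proof.
move=> /H2P[Lf h]; apply/H2P; split=> [|n x n0]; first exact: (L2_tmul dd).
by rewrite ip_tmul tmulM; apply: h; rewrite addn_gt0 n0 orbT.
Qed.

Lemma H2_monomial k x : H2 (tmul k 0 (fun=> x)).
Proof.
apply: H2_tmul; apply/H2P; split=> [|n y n0]; first exact: (L2_cst dd).
by rewrite ip_cst Cint_trig; case: n n0 => // n _; rewrite mulr0.
Qed.

Lemma H2_lin (a : C) f g : H2 f -> H2 g -> H2 (a *: f + g).
Proof. by have [_ [_ h] _] := H2_closed; exact: h. Qed.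

Lemma H2_0 : H2 (0 : T -> G).
Proof. by have [_ [h _] _] := H2_closed. Qed.

Lemma H2_B f g : H2 f -> H2 g -> H2 (f - g).
Proof. exact: closed_subB H2_closed. Qed.

(** Analytic polynomials are dense in H^2: the component of [f] orthogonal to them is still in H^2,
    so its negative coefficients vanish as well as the others, and it is null. *)
Lemma H2_dense f g : H2 f -> L2 g ->
  (forall n x, ip (tmul n 0 (fun=> x)) g = 0) -> ip f g = 0.
Proof.
move=> Hf Lg h.
pose S : set (T -> G) := [set s | exists n x, s = tmul n 0 (fun=> x)].
have LS : S `<=` @L2 R G.
  by move=> _ [n [x ->]]; apply: (L2_tmul dd); exact: (L2_cst dd).
have HS : S `<=` @H2 R G by move=> _ [n [x ->]]; exact: H2_monomial.
have [p pS qS] := orth_decomp H LS (H2_L2 Hf).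
have Hp := orth_orth_sub H H2_closed HS pS.
have Hq : H2 (f - p) := H2_B Hf Hp.
have q0 : \forall z \ae mu, (f - p) z = 0.
  apply: (fourier_L2 dd (H2_L2 Hq)) => k l j; set x := d j.
  have [kl|lk] := ltnP k l.
    have -> : tmul k l (fun=> x) = tmul 0 (l - k) (fun=> x) :> (T -> G).
      by apply: funext => z; rewrite /tmul !trigE leqNgt kl /= subn0 leqn0 subn_eq0 leqNgt kl.
    by have [_] := (H2P _).1 Hq; apply; rewrite subn_gt0.
  have -> : tmul k l (fun=> x) = tmul (k - l) 0 (fun=> x) :> (T -> G).
    by apply: funext => z; rewrite /tmul !trigE lk /= subn0.
  by have [_] := qS; apply; exists (k - l)%N, x.
have gS : orth (@L2 R G) (@ip R G) S g.
  split=> // _ [n [x ->]]; apply: (phC0 H _ Lg (h n x)).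
  by apply: LS; exists n, x.
have -> : ip f g = ip p g.
  apply: (ip_ae dd (H2_L2 Hf) (H2_L2 Hp) Lg Lg); last by apply: nearW.
  by apply: filterS q0 => z /eqP; rewrite [(f - p) z]/(f z - p z) subr_eq0 => /eqP.
by have [_] := pS; apply.
Qed.

Lemma projH2_spec f : L2 f -> H2 (projH2 f) /\ forall h, H2 h -> ip (projH2 f) h = ip f h.
Proof.
move=> Lf.
have [p Hp pP] := projection H H2_closed Lf.
have [] : [set g | H2 g /\ forall h, H2 h -> ip (fun z => f z - g z) h = 0] (projH2 f).
  by apply: (xgetPex (fun=> 0)); exists p; split.
move=> Hg gP; split=> // h Hh; have := gP h Hh.
have -> : (fun z => f z - projH2 f z) = f - projH2 f by [].
rewrite (phBl H) => [/eqP|||]; [|by []|exact: H2_L2|exact: H2_L2].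
by rewrite subr_eq0 => /eqP.
Qed.

End Hardy.

(** * Adjoints of Toeplitz and Hankel operators *)

Section Adjoint.
Context {R : realType} {E F : hilbertType R} (dE : nat -> E) (dF : nat -> F).
Hypotheses (ddE : seq_dense dE) (ddF : seq_dense dF).
Local Notation T := (circle R).
Local Notation C := R[i].
Let HE := L2_preHilbert ddE.
Let HF := L2_preHilbert ddF.

(** [X] involves [projH2], which picks a representative and so need not be linear on functions.
    Riesz is therefore applied to the unprojected [Y], which is linear pointwise and pairs with [g]
    in the same way. *)
Lemma adjoint_spec (X Y : (T -> E) -> (T -> F)) (K : R) (g : T -> F) : 0 <= K -> H2 g ->
  (forall (a : C) u v, L2 u -> L2 v -> Y (a *: u + v) = a *: Y u + Y v) ->
  (forall u, L2 u -> L2 (Y u) /\ nsq (@ip R F) (Y u) <= K * nsq (@ip R E) u) ->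
  (forall u, H2 u -> ip (X u) g = ip (Y u) g) ->
  H2 (adjoint X g) /\ forall u, H2 u -> ip u (adjoint X g) = ip (Y u) g.
Proof.
move=> K0 Hg Yl Yb XY; have Lg := H2_L2 Hg.
have [||f Hf fP] := @riesz _ _ _ _ HE _ (fun u => ip (Y u) g) (K * nsq (@ip R F) g)
    (H2_closed ddE).
- move=> a u v Hu Hv; have [Lu _] := Yb _ (H2_L2 Hu); have [Lv _] := Yb _ (H2_L2 Hv).
  by rewrite Yl ?(ph_Dl HF)//; exact: H2_L2.
- move=> u Hu; have [Lu nu] := Yb _ (H2_L2 Hu).
  apply: le_trans (ph_CS HF Lu Lg) _; rewrite mulrAC ler_wpM2r//.
  exact: (nsq_ge0 HF).
have [] : [set f | H2 f /\ forall u, H2 u -> ip (X u) g = ip u f] (adjoint X g).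
  by apply: (xgetPex (fun=> 0)); exists f; split=> // u Hu; rewrite XY// fP.
by move=> Ha aP; split=> // u Hu; rewrite -aP// XY.
Qed.

Lemma toeplitz_adjoint (Phi : T -> E -> F) g : Linfty setT Phi -> H2 g ->
  H2 (adjoint (toeplitz Phi) g) /\
  forall u, H2 u -> ip u (adjoint (toeplitz Phi) g) = ip (fun z => Phi z (u z)) g.
Proof.
move=> LP Hg; have [K K0 KP] := Linfty_nsq ddE ddF LP.
apply: (@adjoint_spec _ (fun u z => Phi z (u z)) K) => //.
- by move=> a u v _ _; apply: funext => z; exact: Linfty_lin.
- by move=> u Lu; split; [exact: (Linfty_mul ddE ddF)|exact: KP].
- move=> u Hu; have Lu := Linfty_mul ddE ddF LP (H2_L2 Hu).
  by have [_ ->] := projH2_spec ddF Lu.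
Qed.

Lemma L2_cconj f : @L2 R F f -> L2 (fun z => f (cconj z)).
Proof.
move=> Lf; apply/(L2P ddF); split; first exact: wm_cconj (L2_wm Lf).
exact: rint_cconj (L2_rint ddF Lf).
Qed.

Lemma ip_cconj f g : @L2 R F f -> L2 g ->
  ip (fun z => f (cconj z)) (fun z => g (cconj z)) = ip f g.
Proof. by move=> Lf Lg; exact: Cint_cconj (L2_cint ddF Lf Lg). Qed.

Lemma JflipE (f : T -> F) : Jflip f = tmul 0 1 (fun z => f (cconj z)).
Proof. by apply: funext => z; rewrite /Jflip /tmul /trig expr0 mul1r. Qed.

Lemma L2_Jflip f : @L2 R F f -> L2 (Jflip f).
Proof. by move=> Lf; rewrite JflipE; apply: (L2_tmul ddF); exact: L2_cconj. Qed.

Lemma nsq_Jflip f : @L2 R F f -> nsq (@ip R F) (Jflip f) = nsq (@ip R F) f.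
Proof.
by move=> Lf; rewrite JflipE nsq_tmul; exact: (congr1 (@complex.Re R) (ip_cconj Lf Lf)).
Qed.

Lemma hankel_adjoint (Phi : T -> E -> F) g : Linfty setT Phi -> H2 g ->
  H2 (adjoint (hankel Phi) g) /\
  forall u, H2 u -> ip u (adjoint (hankel Phi) g) = ip (Jflip (fun z => Phi z (u z))) g.
Proof.
move=> LP Hg; have [K K0 KP] := Linfty_nsq ddE ddF LP.
apply: (@adjoint_spec _ (fun u => Jflip (fun z => Phi z (u z))) K) => //.
- move=> a u v _ _; apply: funext => z.
  change ((z : C)^* *: Phi (cconj z) (a *: u (cconj z) + v (cconj z)) =
    a *: ((z : C)^* *: Phi (cconj z) (u (cconj z))) + (z : C)^* *: Phi (cconj z) (v (cconj z))).
  by rewrite Linfty_lin// scalerDr !scalerA mulrC.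
- move=> u Lu; have Lm := Linfty_mul ddE ddF LP Lu.
  by split; [exact: L2_Jflip|rewrite nsq_Jflip//; exact: KP].
- move=> u Hu; have Lu := Linfty_mul ddE ddF LP (H2_L2 Hu).
  by have [_ ->] := projH2_spec ddF (L2_Jflip Lu).
Qed.

End Adjoint.

Lemma shift_adjoint (R : realType) (F : hilbertType R) (d : nat -> F) (dd : seq_dense d)
    (g : circle R -> F) : H2 g -> H2 (adjoint (@mulz R F) g) /\
  forall u, H2 u -> ip u (adjoint (@mulz R F) g) = ip (mulz u) g.
Proof.
move=> Hg; apply: (@adjoint_spec _ _ _ _ _ dd dd _ (@mulz R F) 1) => //.
- by move=> a u v _ _; rewrite !mulzE tmul_lin.
- by move=> u Lu; rewrite mulzE nsq_tmul mul1r; split=> //; exact: (L2_tmul dd).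
Qed.

(** * The operator W of a symbol *)

Section DirectSumSpaces.
Context {R : realType} {E F : hilbertType R} (dE : nat -> E) (dF : nat -> F).
Hypotheses (ddE : seq_dense dE) (ddF : seq_dense dF).
Local Notation T := (circle R).
Local Notation C := R[i].
Local Notation mu := (@arc_length R).
Local Notation G := (dsum E F).
Implicit Types (w v : T -> G).

Lemma inner_dsum (x y : G) : inner x y = inner x.1 y.1 + inner x.2 y.2.
Proof. by []. Qed.

Lemma rn2_dsum (x : G) : rn x ^+ 2 = rn x.1 ^+ 2 + rn x.2 ^+ 2.
Proof. by rewrite !rn2E inner_dsum cReD. Qed.

Lemma rn_fst (x : G) : rn x.1 <= rn x.
Proof.
by rewrite -(@ler_pXn2r _ 2)// ?nnegrE ?rn_ge0// [leRHS]rn2_dsum lerDl sqr_ge0.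
Qed.

Lemma rn_snd (x : G) : rn x.2 <= rn x.
Proof.
by rewrite -(@ler_pXn2r _ 2)// ?nnegrE ?rn_ge0// [leRHS]rn2_dsum lerDr sqr_ge0.
Qed.

Lemma rn_inl (x : E) : rn ((x, 0) : G) = rn x.
Proof.
apply/eqP; rewrite -(@eqrXn2 _ 2)// ?rn_ge0// rn2_dsum/=.
by rewrite rn0 expr0n addr0.
Qed.

Lemma rn_inr (x : F) : rn ((0, x) : G) = rn x.
Proof.
apply/eqP; rewrite -(@eqrXn2 _ 2)// ?rn_ge0// rn2_dsum/=.
by rewrite rn0 expr0n add0r.
Qed.

Lemma dsumE (x : G) : x = ((x.1, 0) : G) + ((0, x.2) : G).
Proof.
case: x => a b; change ((a, b) = (a + 0, 0 + b) :> G).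
by rewrite addr0 add0r.
Qed.

Definition dsum_seq n : G :=
  if unpickle n is Some (i, j) then (dE i, dF j) else 0.

Lemma dsum_dense : seq_dense dsum_seq.
Proof.
move=> x e e0.
have [i hi] := ddE x.1 (divr_gt0 e0 (ltr0Sn _ 1)).
have [j hj] := ddF x.2 (divr_gt0 e0 (ltr0Sn _ 1)).
exists (pickle (i, j)); rewrite /dsum_seq pickleK.
rewrite (_ : x - _ = ((x.1 - dE i, 0) : G) + ((0, x.2 - dF j) : G)).
  by apply: le_lt_trans (rnD _ _) _; rewrite rn_inl rn_inr [ltRHS]splitr ltrD.
exact: (dsumE (x - ((dE i, dF j) : G))).
Qed.

Local Notation ddG := dsum_dense.

Lemma wm_pairf (f : T -> E) (g : T -> F) : wmeasurable f -> wmeasurable g ->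
  wmeasurable (pairf f g).
Proof. by move=> mf mg x; exact: cmeasD (mf x.1) (mg x.2). Qed.

Lemma wm_fstf w : wmeasurable w -> wmeasurable (fstf w).
Proof.
move=> mw x; have h : cmeas (fun z => inner (w z) ((x, 0) : G)) := mw _.
suff : cmeas (fun z => inner (fstf w z) x) by [].
by move: h; congr cmeas; apply: funext => z; rewrite inner_dsum/= i0r addr0.
Qed.

Lemma wm_sndf w : wmeasurable w -> wmeasurable (sndf w).
Proof.
move=> mw x; have h : cmeas (fun z => inner (w z) ((0, x) : G)) := mw _.
suff : cmeas (fun z => inner (sndf w z) x) by [].
by move: h; congr cmeas; apply: funext => z; rewrite inner_dsum/= i0r add0r.
Qed.

Lemma L2_pairf (f : T -> E) (g : T -> F) : L2 f -> L2 g -> L2 (pairf f g).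
Proof.
move=> Lf Lg; apply/(L2P ddG); split; first exact: wm_pairf (L2_wm Lf) (L2_wm Lg).
under eq_fun do rewrite rn2_dsum.
exact: rintD (L2_rint ddE Lf) (L2_rint ddF Lg).
Qed.

Lemma L2_fstf w : L2 w -> L2 (fstf w).
Proof.
move=> Lw; apply: (L2_dom ddE (wm_fstf (L2_wm Lw)) _ (L2_rint ddG Lw)) => z.
by apply: lerXn2r; rewrite ?nnegrE ?rn_ge0//; exact: rn_fst.
Qed.

Lemma L2_sndf w : L2 w -> L2 (sndf w).
Proof.
move=> Lw; apply: (L2_dom ddF (wm_sndf (L2_wm Lw)) _ (L2_rint ddG Lw)) => z.
by apply: lerXn2r; rewrite ?nnegrE ?rn_ge0//; exact: rn_snd.
Qed.

Lemma pairfE w : w = pairf (fstf w) (sndf w).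
Proof. by apply: funext => z; rewrite /pairf /fstf /sndf -surjective_pairing. Qed.

Lemma ip_dsum w v : L2 w -> L2 v -> ip w v = ip (fstf w) (fstf v) + ip (sndf w) (sndf v).
Proof.
move=> Lw Lv; rewrite -CintD//.
  exact: (L2_cint ddE (L2_fstf Lw) (L2_fstf Lv)).
exact: (L2_cint ddF (L2_sndf Lw) (L2_sndf Lv)).
Qed.

Lemma H2_dsum w : H2 w <-> oplus (@H2 R E) (@H2 R F) w.
Proof.
split.
  move=> /H2P[Lw h]; split; apply/H2P; split; try exact: L2_fstf; try exact: L2_sndf.
    move=> n x n0; rewrite -(h n ((x, 0) : G) n0); apply: eq_Cint => z.
    by rewrite /tmul inner_dsum/= scaler0 i0r addr0.
  move=> n x n0; rewrite -(h n ((0, x) : G) n0); apply: eq_Cint => z.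
  by rewrite /tmul inner_dsum/= scaler0 i0r add0r.
move=> [/H2P[Lf hf] /H2P[Lg hg]]; apply/H2P; rewrite [w]pairfE.
have Lw : L2 (pairf (fstf w) (sndf w)) by exact: L2_pairf.
split=> // n x n0; rewrite ip_dsum//; last by apply: (L2_tmul ddG); exact: (L2_cst ddG).
by rewrite -[RHS]addr0; congr (_ + _); [exact: (hf n x.1)|exact: (hg n x.2)].
Qed.

Lemma oplus_L2 w : oplus (@L2 R E) (@H2 R F) w -> L2 w.
Proof. by move=> [Lf Hg]; rewrite [w]pairfE; apply: L2_pairf => //; exact: H2_L2. Qed.

Lemma L2_J2 w : L2 w -> L2 (J2 w).
Proof.
by move=> Lw; apply: L2_pairf; [exact: (L2_cconj ddE (L2_fstf Lw))|exact: L2_sndf].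
Qed.

Lemma J2K w : J2 (J2 w) = w.
Proof.
by apply: funext => z; rewrite /J2 /pairf /fstf /sndf/= cconjK -surjective_pairing.
Qed.

Lemma ip_J2 w v : L2 w -> L2 v -> ip (J2 w) (J2 v) = ip w v.
Proof.
move=> Lw Lv; rewrite !ip_dsum//; try exact: L2_J2.
by congr (_ + _); exact: (ip_cconj ddE (L2_fstf Lw) (L2_fstf Lv)).
Qed.

Lemma ip_J2l w v : L2 w -> L2 v -> ip (J2 w) v = ip w (J2 v).
Proof. by move=> Lw Lv; rewrite -{1}[v]J2K ip_J2//; exact: L2_J2. Qed.

Lemma J2_ae w v : (\forall z \ae mu, w z = v z) -> \forall z \ae mu, J2 w z = J2 v z.
Proof.
move=> h; have hc := ae_cconj h.
by apply: filterS2 h hc => z h1 h2; rewrite /J2 /pairf /fstf /sndf h1 h2.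
Qed.

Section Symbols.
Variable Psi : T -> G -> G.
Hypothesis LPsi : Linfty setT Psi.
Hypothesis HPsi : forall x, H2 (sndf (fun z => Psi z x)).

Definition symbol_of : symbol E F := Symbol
  (fun z x => (z : C)^* *: (Psi z ((x, 0) : G)).1)
  (fun z y => (z : C)^* *: (Psi z ((0, y) : G)).1)
  (fun z x => (Psi z ((x, 0) : G)).2)
  (fun z y => (Psi z ((0, y) : G)).2).

Let inl_lin (a : C) (x y : E) : ((a *: x + y, 0) : G) = a *: ((x, 0) : G) + ((y, 0) : G).
Proof.
change ((a *: x + y, 0) = (a *: x + y, a *: 0 + 0) :> G).
by rewrite scaler0 addr0.
Qed.

Let inr_lin (a : C) (x y : F) : ((0, a *: x + y) : G) = a *: ((0, x) : G) + ((0, y) : G).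
Proof.
change ((0, a *: x + y) = (a *: 0 + 0, a *: x + y) :> G).
by rewrite scaler0 addr0.
Qed.

Let rn_zbar (K : hilbertType R) (z : T) (x : K) : rn ((z : C)^* *: x) = rn x.
Proof.
apply/eqP; rewrite -(@eqrXn2 _ 2)// ?rn_ge0// rn2Z cn2J cn2_circle.
by rewrite mul1r.
Qed.

Let Linfty_intro (K L : hilbertType R) (Phi : T -> K -> L) (M : R) :
  (forall z (a : C) x y, Phi z (a *: x + y) = a *: Phi z x + Phi z y) ->
  (forall z x, rn (Phi z x) <= M * rn x) ->
  (forall x, wmeasurable (fun z => Phi z x)) -> Linfty setT Phi.
Proof.
move=> hl hb hm; split.
- by move=> *; exact: hl.
- by exists M => z x _; rewrite !normE -rmorphM/= lecR.
- by move=> *; exact: hm.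
Qed.

Let cmeas_zbar : cmeas (fun z : T => (z : C)^*).
Proof. exact/cmeasJ/cmeas_circle. Qed.

Lemma symbol_of_Lambda : Lambda symbol_of.
Proof.
have [M M0 MP] := Linfty_bd LPsi; have [_ _ mP] := LPsi.
split.
- split; last by move=> x; exact: HPsi.
  apply: (Linfty_intro (M := M)).
  + by move=> z a x y /=; rewrite inl_lin (Linfty_lin _ _ _ _ LPsi).
  + by move=> z x /=; apply: le_trans (rn_snd _) _; rewrite -(rn_inl x).
  + by move=> x; exact: (wm_sndf (mP ((x, 0) : G) I)).
- split; last by move=> x; exact: HPsi.
  apply: (Linfty_intro (M := M)).
  + by move=> z a x y /=; rewrite inr_lin (Linfty_lin _ _ _ _ LPsi).
  + by move=> z x /=; apply: le_trans (rn_snd _) _; rewrite -(rn_inr x).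
  + by move=> x; exact: (wm_sndf (mP ((0, x) : G) I)).
- apply: (Linfty_intro (M := M)).
  + by move=> z a x y /=; rewrite inl_lin (Linfty_lin _ _ _ _ LPsi) scalerDr/= !scalerA mulrC.
  + by move=> z x /=; rewrite rn_zbar; apply: le_trans (rn_fst _) _; rewrite -(rn_inl x).
  + by move=> x; exact: (wm_scale cmeas_zbar (wm_fstf (mP ((x, 0) : G) I))).
- apply: (Linfty_intro (M := M)).
  + by move=> z a x y /=; rewrite inr_lin (Linfty_lin _ _ _ _ LPsi) scalerDr/= !scalerA mulrC.
  + by move=> z x /=; rewrite rn_zbar; apply: le_trans (rn_fst _) _; rewrite -(rn_inr x).
  + by move=> x; exact: (wm_scale cmeas_zbar (wm_fstf (mP ((0, x) : G) I))).
Qed.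

Lemma L2_symbol h : L2 h -> L2 (fun z => Psi z (h z)).
Proof. exact: (Linfty_mul ddG ddG LPsi). Qed.

(* The factor [z^*] in the first row of [symbol_of] turns the Hankel flip [J]
   into the flip [J2]. *)
Lemma W_spec w : oplus (@H2 R E) (@H2 R F) w ->
  H2 (W symbol_of w) /\
  forall h, H2 h -> ip h (W symbol_of w) = ip (J2 (fun z => Psi z (h z))) w.
Proof.
move=> [H1 H2w]; have [[LA _] [LB _] LC LD] := symbol_of_Lambda.
have [HC PC] := hankel_adjoint ddE ddE LC H1.
have [HD PD] := hankel_adjoint ddF ddE LD H1.
have [HA PA] := toeplitz_adjoint ddE ddF LA H2w.
have [HB PB] := toeplitz_adjoint ddF ddF LB H2w.
have HEp := L2_preHilbert ddE; have HFp := L2_preHilbert ddF.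
have add1 (K : hilbertType R) (u v : T -> K) : 1 *: u + v = fun z => u z + v z.
  by apply: funext => z; rewrite -[u z]scale1r.
have HW : H2 (W symbol_of w).
  apply/H2_dsum; split; rewrite /W /fstf /sndf /pairf /=.
    by have := H2_lin ddE 1 HC HA; rewrite add1.
  by have := H2_lin ddF 1 HD HB; rewrite add1.
split=> // h Hh; have [Hh1 Hh2] := (H2_dsum h).1 Hh.
have Lw : L2 w by apply: H2_L2; apply/H2_dsum.
have Lp : L2 (fun z => Psi z (h z)) := L2_symbol (H2_L2 Hh).
rewrite ip_dsum//; try exact: H2_L2.
have -> : fstf (W symbol_of w) = adjoint (hankel (symC symbol_of)) (fstf w) +
  adjoint (toeplitz (symA symbol_of)) (sndf w) by [].
have -> : sndf (W symbol_of w) = adjoint (hankel (symD symbol_of)) (fstf w) +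
  adjoint (toeplitz (symB symbol_of)) (sndf w) by [].
rewrite (phDr HEp); [|exact: H2_L2|exact: H2_L2|exact: H2_L2].
rewrite (phDr HFp); [|exact: H2_L2|exact: H2_L2|exact: H2_L2].
rewrite PC// PA// PD// PB// addrACA.
have LJ1 : L2 (Jflip (fun z => symC symbol_of z (fstf h z))).
  by apply: (L2_Jflip ddE); apply: (Linfty_mul ddE ddE LC); exact: H2_L2.
have LJ2 : L2 (Jflip (fun z => symD symbol_of z (sndf h z))).
  by apply: (L2_Jflip ddE); apply: (Linfty_mul ddF ddE LD); exact: H2_L2.
have LT1 : L2 (fun z => symA symbol_of z (fstf h z)).
  by apply: (Linfty_mul ddE ddF LA); exact: H2_L2.
have LT2 : L2 (fun z => symB symbol_of z (sndf h z)).
  by apply: (Linfty_mul ddF ddF LB); exact: H2_L2.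
rewrite -(phDl HEp)//; last exact: H2_L2.
rewrite -(phDl HFp)//; last exact: H2_L2.
rewrite ip_dsum//; last exact: L2_J2.
have zz (K : hilbertType R) (z : T) (x : K) : (z : C)^* *: ((z : C)^*^* *: x) = x.
  by rewrite conjCK scalerA mulrC circle_mulJ scale1r.
have e1 : Jflip (fun z => symC symbol_of z (fstf h z)) +
    Jflip (fun z => symD symbol_of z (sndf h z)) = fstf (J2 (fun z => Psi z (h z))).
  apply: funext => z.
  change ((z : C)^* *: ((z : C)^*^* *: (Psi (cconj z) ((fstf h (cconj z), 0) : G)).1) +
    (z : C)^* *: ((z : C)^*^* *: (Psi (cconj z) ((0, sndf h (cconj z)) : G)).1) =
    (Psi (cconj z) (h (cconj z))).1).
  rewrite !zz [in RHS](dsumE (h (cconj z))).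
  by have := Linfty_lin (cconj z) 1 ((fstf h (cconj z), 0) : G)
    ((0, sndf h (cconj z)) : G) LPsi; rewrite !scale1r => ->.
have e2 : (fun z => symA symbol_of z (fstf h z)) + (fun z => symB symbol_of z (sndf h z)) =
    sndf (J2 (fun z => Psi z (h z))).
  apply: funext => z.
  change ((Psi z ((fstf h z, 0) : G)).2 + (Psi z ((0, sndf h z) : G)).2 = (Psi z (h z)).2).
  rewrite [in RHS](dsumE (h z)).
  by have := Linfty_lin z 1 ((fstf h z, 0) : G) ((0, sndf h z) : G) LPsi; rewrite !scale1r => ->.
by rewrite e1 e2.
Qed.

Lemma ker_W : ker (oplus (@H2 R E) (@H2 R F)) (W symbol_of) =
  [set w | oplus (@H2 R E) (@H2 R F) w /\
     forall h, H2 h -> ip (J2 (fun z => Psi z (h z))) w = 0].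
Proof.
have HG := L2_preHilbert ddG.
apply/seteqP; split=> w [Ow h0]; split=> //; have [HW WP] := W_spec Ow.
  move=> h Hh; rewrite -WP// -(ph0r HG (H2_L2 Hh)).
  apply: (ip_ae ddG) => //; try exact: H2_L2; first exact: (phL0 HG).
  exact: nearW.
apply: (nsq_ae0 ddG (H2_L2 HW)).
by rewrite /nsq WP// h0.
Qed.

End Symbols.

End DirectSumSpaces.

(** * Type I subspaces *)

Section ClosedSubspaces.
Context {R : realType} {G : hilbertType R}.
Local Notation T := (circle R).

Lemma subspaceL2_closed (d : nat -> G) (dd : seq_dense d) (N : set (T -> G)) :
  subspaceL2 N -> closed_sub (@L2 R G) (@ip R G) N.
Proof.
move=> [NL N0 Nl Nc]; split=> //.
move=> u f uN Lf uf; apply: (Nc u) => //.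
have E n : sqnorm (fun z => u n z - f z) = (nsq (@ip R G) (u n - f))%:E.
  apply: (sqnorm_nsq dd (f := u n - f)).
  exact: (phLB (L2_preHilbert dd) (NL _ (uN n)) Lf).
rewrite (_ : (fun n => sqnorm _) = fun n => (nsq (@ip R G) (u n - f))%:E); last first.
  by apply: funext => n; exact: E.
by apply/fine_cvgP; split; [exact: nearW|exact: uf].
Qed.

Lemma closed_subspace_closed_sub (M : set G) : linear_subspace M -> closed M ->
  closed_sub setT (@inner R G) M.
Proof.
move=> lM cM; split=> // u f uM _ uf.
have cv : u n @[n --> \oo] --> f.
  apply/cvgrPdist_lt => e e0; have [eE Re0] := c_ge0 (ltW e0).
  have R0 : 0 < Re e by rewrite lt_neqAle Re0 andbT eq_sym; apply/eqP => h;
    move: e0; rewrite eE h ltxx.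
  move/cvgrPdist_lt : uf => /(_ _ (exprn_gt0 2 R0))[N _ NP].
  exists N => // n /NP /=; rewrite /nsq inner_rn/= sub0r normrN ger0_norm ?sqr_ge0//.
  by rewrite ltr_pXn2r ?nnegrE ?rn_ge0// normE eE ltcR rnB.
by apply: (closed_cvg M cM _ _ cv); exact: nearW.
Qed.

(** The values are chosen pointwise; linearity comes from the uniqueness of the nearest point. *)
Lemma orthogonal_projector (M : set G) : closed_sub setT (@inner R G) M ->
  exists P : G -> G, [/\ forall x, M (P x),
    forall x y, inner (P x) y = inner x (P y),
    forall x, M x -> P x = x,
    forall a x y, P (a *: x + y) = a *: P x + P y & forall x, rn (P x) <= rn x].
Proof.
move=> cM; have H := @hilbert_preHilbert R G; have [_ [_ Ml] _] := cM.
have /choice[P PP] x : exists p, M p /\ forall h, M h -> inner (x - p) h = 0.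
  by have [p Mp pP] := projection H cM (I : setT x); exists p.
have uni x p : M p -> (forall h, M h -> inner (x - p) h = 0) -> p = P x.
  move=> Mp pP; apply/eqP; rewrite -subr_eq0; apply/eqP; apply: rn_eq0.
  have Md := closed_subB cM Mp (PP x).1.
  apply/eqP; rewrite -sqrf_eq0 rn2E.
  rewrite {1}(_ : p - P x = (x - P x) - (x - p)); last by rewrite opprB [x - P x + _]addrC addrA subrK.
  by rewrite iBl (PP x).2// pP// subrr.
have selfh x h : M h -> inner (P x) h = inner x h.
  by move=> Mh; apply/eqP; rewrite eq_sym -subr_eq0 -iBl (PP x).2.
have Pl a x y : P (a *: x + y) = a *: P x + P y.
  apply/esym/uni; first by apply: Ml; [exact: (PP x).1|exact: (PP y).1].
  by move=> h Mh; rewrite iBl !innerDl !selfh// subrr.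
exists P; split=> //.
- by move=> x; exact: (PP x).1.
- move=> x y; rewrite -(selfh x (P y) (PP y).1) innerC [RHS]innerC; congr (_^*).
  by rewrite selfh//; exact: (PP x).1.
- by move=> x Mx; apply/esym/uni => // h _; rewrite subrr i0l.
- move=> x; rewrite -(@ler_pXn2r _ 2)// ?nnegrE ?rn_ge0//.
  have -> : rn x ^+ 2 = rn (P x) ^+ 2 + rn (x - P x) ^+ 2.
    have {1}-> : x = (x - P x) + P x by rewrite subrK.
    by rewrite rn2D (PP x).2 ?mul0rn ?addr0 1?addrC//; exact: (PP x).1.
  by rewrite lerDl sqr_ge0.
Qed.

End ClosedSubspaces.

Section TypeI.
Context {R : realType} {E F : hilbertType R} (dE : nat -> E) (dF : nat -> F).
Hypotheses (ddE : seq_dense dE) (ddF : seq_dense dF).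
Local Notation T := (circle R).
Local Notation C := R[i].
Local Notation mu := (@arc_length R).
Local Notation G := (dsum E F).
Let ddG := dsum_dense ddE ddF.
Let H := L2_preHilbert ddG.

Theorem typeI_partial_isometry (N : set (T -> G)) : invariant_shift N -> typeI N ->
  exists Psi : symbol E F,
     [/\ Lambda Psi, partial_isometry (oplus (@H2 R E) (@H2 R F)) (W Psi) &
         N = ker (oplus (@H2 R E) (@H2 R F)) (W Psi)].
Proof.
move=> [NO _] [N3 [[sN3 _] _ N3O NE [E0 [U [[lE0 cE0] _ [Ul [M UM] Um] Uiso N3E]]]]].
have cN3 := subspaceL2_closed ddG sN3.
have N3L w : N3 w -> L2 w by case: sN3 => h _ _ _; exact: h.
have [P [PE0 Psa Pid Pl Prn]] := orthogonal_projector (closed_subspace_closed_sub lE0 cE0).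
(* [U] is controlled only on [E0]; composing with the projector gives an operator function that is
   linear and bounded on the whole space. *)
pose Psi z x := U z (P x).
have LPsi : Linfty setT Psi.
  split.
  - by move=> z a x y _ _; rewrite /Psi Pl Ul.
  - exists (Num.max M 0) => z x _; rewrite !normE -rmorphM/= lecR.
    have := UM z (P x) (PE0 x); rewrite !normE -rmorphM/= lecR => h.
    apply: (le_trans h); apply: (@le_trans _ _ (Num.max M 0 * rn (P x))).
      by rewrite ler_wpM2r ?rn_ge0// le_max lexx.
    by rewrite ler_wpM2l// le_max lexx orbT.
  - by move=> x _; exact: Um.
have LP : Linfty setT (fun (_ : T) (x : G) => P x).
  split; [by move=> *; exact: Pl| |by move=> x _; exact: wm_cst].
  by exists 1 => z x _; rewrite !normE -rmorphM/= lecR mul1r.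
(* A constant self-adjoint operator acts on each Fourier coefficient separately, so the negative
   ones stay 0. *)
have HP h : H2 h -> H2 (fun z => P (h z)).
  move=> Hh; apply/H2P; split; first exact: (Linfty_mul ddG ddG LP (H2_L2 Hh)).
  move=> n x n0; have [_ /(_ n (P x) n0)] := (H2P h).1 Hh; move=> <-.
  by apply: eq_Cint => z; rewrite /tmul !iZr Psa.
have PsiN3 h : H2 h -> N3 (fun z => Psi z (h z)).
  move=> Hh; rewrite N3E; split; first exact: (L2_symbol ddE ddF LPsi (H2_L2 Hh)).
  exists (fun z => P (h z)); last exact: nearW.
  by split; [exact: HP|apply: nearW => z; exact: PE0].
have HPsi x : H2 (sndf (fun z => Psi z x)).
  have Hx : H2 (fun _ : T => x) by have := H2_monomial ddG 0 x; rewrite tmul00.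
  by have [_] := N3O _ (PsiN3 _ Hx).
have N3Psi f : N3 f -> exists h, [/\ H2 h, \forall z \ae mu, E0 (h z) &
    \forall z \ae mu, f z = Psi z (h z)].
  rewrite N3E => -[_ [h [Hh hE0] fU]]; exists h; split=> //.
  by apply: filterS2 hE0 fU => z hz ->; rewrite /Psi Pid.
have LPsih h : H2 h -> L2 (fun z => Psi z (h z)) by move=> /PsiN3/N3L.
have Nker : N = ker (oplus (@H2 R E) (@H2 R F)) (W (symbol_of Psi)).
  rewrite (ker_W ddE ddF LPsi HPsi); apply/seteqP; split=> w.
    move=> Nw; split; first exact: NO.
    move=> h Hh; move: Nw; rewrite NE => -[Ow /(_ (J2 (fun z => Psi z (h z)))) wJ].
    apply: (phC0 H); [exact: (oplus_L2 ddE ddF Ow)|exact: (L2_J2 ddE ddF (LPsih _ Hh))|].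
    by apply: wJ; exists (fun z => Psi z (h z)) => //; exact: PsiN3.
  move=> [Ow wP]; have Lw : L2 w by apply: H2_L2; apply/(H2_dsum ddE ddF).
  rewrite NE; split; first by case: Ow => Hw1 Hw2; split=> //; exact: H2_L2.
  move=> _ [f N3f <-]; have [h [Hh _ fh]] := N3Psi f N3f.
  have LJ := L2_J2 ddE ddF (LPsih _ Hh).
  rewrite -(phC0 H LJ Lw (wP h Hh)); apply: (ip_ae ddG Lw Lw _ LJ).
  - exact: (L2_J2 ddE ddF (N3L _ N3f)).
  - exact: nearW.
  - exact: J2_ae.
exists (symbol_of Psi); split=> //; first exact: (symbol_of_Lambda LPsi HPsi).
rewrite /partial_isometry -Nker => f [Of fN].
have Hf : H2 f by apply/(H2_dsum ddE ddF).
have Lf := H2_L2 Hf; have LJf := L2_J2 ddE ddF Lf.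
have [p N3p pP] := projection H cN3 LJf; have Lp := N3L _ N3p.
have Lq : L2 (J2 f - p) := phLB H LJf Lp.
(* The part of [J2 f] orthogonal to [N3] is carried into [N] by [J2]. As [f] is orthogonal to [N],
   that part is null, so [J2 f] lies in [N3] up to a null set. *)
have NJq : N (J2 (J2 f - p)).
  rewrite NE; split.
    split; first by apply: (L2_fstf ddE ddF); exact: (L2_J2 ddE ddF).
    exact: (H2_B ddF Of.2 (N3O _ N3p).2).
  by move=> _ [k N3k <-]; rewrite (ip_J2 ddE ddF)//; [exact: pP|exact: N3L].
have q0 : nsq (@ip R G) (J2 f - p) = 0.
  have h1 := fN _ NJq; rewrite -(ip_J2l ddE ddF Lf Lq) in h1.
  by rewrite /nsq (phBl H LJf Lp Lq) h1 (phC0 H Lq Lp (pP _ N3p)) subrr.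
have Jfp := nsq_B0 ddG LJf Lp q0.
have [h [Hh hE0 ph]] := N3Psi p N3p; have Lh := H2_L2 Hh.
have Jfh : \forall z \ae mu, J2 f z = Psi z (h z) by apply: filterS2 Jfp ph => z -> ->.
(* [h] has values in [E0], so P h = h a.e., and <P k, P h> = <k, P h> = <k, h>. *)
have iso k : H2 k -> ip (fun z => Psi z (k z)) (fun z => Psi z (h z)) = ip k h.
  move=> Hk; apply: Cint_ae.
  - exact/cint_meas/(L2_cint ddG (LPsih _ Hk) (LPsih _ Hh)).
  - exact/cint_meas/(L2_cint ddG (H2_L2 Hk) Lh).
  - by apply: filterS2 Uiso hE0 => z Uz hz; rewrite /Psi Uz// Psa !Pid.
have [HW WP] := W_spec ddE ddF LPsi HPsi Of; have LW := H2_L2 HW.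
(* Testing against all of H^2 identifies [W] of [f] with [h], whose norm is that of Psi h = J2 f,
   hence that of [f]. *)
have Wk k : H2 k -> ip k (W (symbol_of Psi) f) = ip k h.
  move=> Hk; rewrite WP// (ip_J2l ddE ddF (LPsih _ Hk) Lf) -iso//.
  apply: (ip_ae ddG (LPsih _ Hk) (LPsih _ Hk) LJf (LPsih _ Hh)) => //.
  exact: nearW.
have W0 : nsq (@ip R G) (W (symbol_of Psi) f - h) = 0.
  have Hd := H2_B ddG HW Hh.
  by rewrite /nsq (phBr H (H2_L2 Hd) LW Lh) Wk// subrr.
have Wh := nsq_B0 ddG LW Lh W0.
rewrite (sqnorm_nsq ddG LW) (sqnorm_nsq ddG Lf); congr EFin; rewrite /nsq.
rewrite (ip_ae ddG LW Lh LW Lh Wh Wh) -iso// -(ip_J2 ddE ddF Lf Lf).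
by rewrite (ip_ae ddG LJf (LPsih _ Hh) LJf (LPsih _ Hh) Jfh Jfh).
Qed.

End TypeI.

(** * Shift-invariant subspaces *)

Section AlmostEverywhere.
Context {R : realType}.
Local Notation T := (circle R).
Local Notation mu := (@arc_length R).

Lemma ae_exists (Q : set T) : (\forall z \ae mu, Q z) -> exists z, Q z.
Proof.
move=> aQ; apply: contrapT => nQ.
have : \forall z \ae mu, False by apply: filterS aQ => z Qz; apply: nQ; exists z.
move=> [A [mA A0 TA]].
have AT : A = setT by apply/seteqP; split=> // z _; exact: TA.
by move: A0; rewrite AT probability_setT => /eqP; rewrite onee_eq0.
Qed.

(** Otherwise conjugation gives Im z = 0 a.e., so z^2 = 1 a.e., whereas z^2 has mean 0. *)
Lemma upper_half_not_null : ~ \forall z \ae mu, ~ 0 < cy z.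
Proof.
move=> h; have hc := ae_cconj h.
have : Cint mu (fun z : T => trig 2 0 z) = Cint mu (fun=> 1).
  apply: Cint_ae; [exact: cmeas_trig|exact: cmeas_cst|].
  apply: filterS2 h hc => z /negP; rewrite -leNgt => y1.
  rewrite /= cy_cconj => /negP; rewrite -leNgt oppr_le0 => y2.
  have y0 : cy z = 0 by apply/eqP; rewrite eq_le y1.
  have x1 := cxy z; rewrite y0 expr0n addr0 in x1.
  have x1' : cx z * cx z = 1 by rewrite -expr2.
  rewrite /trig expr0 mulr1 expr2; apply: cP.
    by rewrite cReM -/(cx z) -/(cy z) y0 mulr0 subr0 x1'.
  by rewrite cImM -/(cx z) -/(cy z) y0 mulr0 mul0r addr0.
by rewrite Cint_trig Cint_cst => /esym/eqP; rewrite oner_eq0.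
Qed.

Lemma lower_half_not_null : ~ \forall z \ae mu, 0 < cy z.
Proof.
move=> h; apply: upper_half_not_null.
by apply: filterS (ae_cconj h) => z /=; rewrite cy_cconj => ?; apply/negP; rewrite -leNgt; lra.
Qed.

End AlmostEverywhere.

Section ShiftInvariant.
Context {R : realType} {G : hilbertType R} (d : nat -> G) (dd : seq_dense d).
Local Notation T := (circle R).
Local Notation C := R[i].
Local Notation mu := (@arc_length R).
Local Notation nsq := (nsq (@ip R G)).
Local Notation orth := (orth (@L2 R G) (@ip R G)).
Implicit Types (e f g q : T -> G).
Let H := L2_preHilbert dd.

(** The pairings of [e'] with the shifts of [e] are the Fourier coefficients of the pointwise inner
    product. One hypothesis kills the nonzero frequencies of each sign. *)
Lemma const_inner e e' : L2 e -> L2 e' ->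
  (forall n, ip (tmul n.+1 0 e) e' = 0) -> (forall n, ip (tmul n.+1 0 e') e = 0) ->
  \forall z \ae mu, inner (e z) (e' z) = ip e e'.
Proof.
move=> Le Le' h h'.
have ci := L2_cint dd Le Le'; have cc := cint_cst mu (ip e e').
have ct k l (f : T -> C) := cint_trig k l (f := f).
have key k l : Cint mu (fun z => trig k l z * (inner (e z) (e' z) - ip e e')) =
    ip (tmul k l e) e' - ip e e' * (k == l)%:R.
  rewrite -Cint_trig -CintZ; last first.
    by have := ct k l _ (cint_cst mu 1); congr cint; apply: funext => z; rewrite mulr1.
  rewrite -CintB.
  - by apply: eq_Cint => z; rewrite /tmul iZl; ring.
  - have := ct k l _ ci; congr cint; apply: funext => z; by rewrite /tmul iZl.
  - by have := ct k l _ cc; congr cint; apply: funext => z; rewrite mulrC.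
have : \forall z \ae mu, inner (e z) (e' z) - ip e e' = 0.
  apply: fourier_unique; first exact: cintB.
    move=> n; have := key n 0%N; rewrite /trig; under eq_Cint do rewrite expr0 mulr1.
    move=> ->; case: n => [|n]; first by rewrite tmul00 mulr1 subrr.
    by rewrite h mulr0 subrr.
  move=> n; have := key 0%N n; rewrite /trig; under eq_Cint do rewrite expr0 mul1r.
  move=> ->; case: n => [|n]; first by rewrite tmul00 mulr1 subrr.
  rewrite ip_tmul (phC0 H _ Le (h' n)) ?mulr0 ?subrr//.
  exact: (L2_tmul dd).
by apply: filterS => z /eqP; rewrite subr_eq0 => /eqP.
Qed.

(* If [q] were not in the closed span of the [z^n q] with [n > 0], its
   component orthogonal to that span would have constant nonzero norm, whereas
   it vanishes wherever [q] does. *)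
Lemma vanishing_reducing q g : L2 q -> L2 g -> ~ (\forall z \ae mu, q z != 0) ->
  (forall n, ip (tmul n.+1 0 q) g = 0) -> ip q g = 0.
Proof.
move=> Lq Lg q0 qg.
pose S : set (T -> G) := [set s | exists n, s = tmul n.+1 0 q].
have LS : S `<=` @L2 R G by move=> _ [n ->]; exact: (L2_tmul dd).
have [p pS eS] := orth_decomp H LS Lq.
set e := q - p in eS; have [Lp pSS] := pS; have [Le eSS] := eS.
(* Multiplying by conj(z) on the left raises the exponent of z on the right, so the complement of
   the z^n q with n > 0 is stable under it. Hence z^n e is orthogonal to p as well as to its own
   backward shifts. *)
have tS u : orth S u -> orth S (tmul 0 1 u).
  move=> [Lu uS]; split=> [|_ [n ->]]; first exact: (L2_tmul dd).
  by rewrite ip_tmul tmulM add1n; apply: uS; exists n.+1.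
have tSn n u : orth S u -> orth S (tmul 0 n u).
  elim: n => [|n IH] Su; first by rewrite tmul00.
  by have := tS _ (IH Su); rewrite tmulM add0n add1n.
have ee n : ip (tmul n.+1 0 e) e = 0.
  rewrite ip_tmul -[e in ip e _]/(q - p) (phBl H Lq Lp); last exact: (L2_tmul dd).
  rewrite pSS ?subr0; last exact: tSn.
  rewrite -ip_tmul; apply: (phC0 H) => //; first exact: (L2_tmul dd).
  by apply: eSS; exists n.
have ce := const_inner Le Le ee ee.
(* Since q = 0 on [B], the cut-off 1_B p is orthogonal to every z^n q, hence to p itself. Thus p = 0
   on [B], and so is e = q - p. *)
pose B := [set z | q z = 0].
have mB : measurable B.
  have := wm_rn2 dd (L2_wm Lq) measurableT (measurable_set1 (0 : R)).
  rewrite setTI; congr measurable; apply/seteqP; split=> z /=.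
    by move=> /eqP; rewrite sqrf_eq0 => /eqP/rn_eq0.
  by rewrite /B/= => ->; rewrite rn0 expr0n.
pose c z : C := ((\1_B z : R)%:C)%C.
have mc : cmeas c by split; [exact: measurable_indic|exact: measurable_cst].
have cB z : B z -> c z = 1 by move=> Bz; rewrite /c indicE mem_set.
have cnB z : ~ B z -> c z = 0 by move=> Bz; rewrite /c indicE memNset.
pose pB z := c z *: p z.
have LpB : L2 pB.
  apply: (L2_scale dd (M := 1) mc _ Lp) => z.
  by have [/cB ->|/cnB ->] := pselect (B z); rewrite /cn2 /= ?expr1n ?expr0n ?addr0.
have pB0 : \forall z \ae mu, B z -> p z = 0.
  have : nsq pB = 0.
    have : ip p pB = 0.
      apply: pSS; split=> // _ [n ->]; rewrite -(Cint_cst mu 0); apply: eq_Cint => z.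
      rewrite /pB /tmul iZr iZl; have [Bz|/cnB ->] := pselect (B z).
        by rewrite [q z]Bz i0r !mulr0.
      by rewrite mul0r mulr0.
    move=> h; suff h2 : ip pB pB = ip p pB by exact: (congr1 (@complex.Re R) (etrans h2 h)).
    apply: eq_Cint => z; rewrite /pB iZl !iZr mulrA.
    by have [/cB ->|/cnB ->] := pselect (B z); rewrite ?rmorph1 ?rmorph0 ?mul1r ?mul0r.
  move=> /(nsq_ae0 dd LpB); apply: filterS => z; rewrite /pB => h Bz.
  by move: h; rewrite cB// scale1r.
have e0 : \forall z \ae mu, e z = 0.
  have [c0|c0] := eqVneq (ip e e) 0.
    apply: filterS ce => z; rewrite c0 => ez; apply: rn_eq0; apply/eqP.
    by rewrite -sqrf_eq0 rn2E ez.
  exfalso; apply: q0; apply: filterS2 ce pB0 => z ez pz; apply/eqP => qz.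
  have : e z = 0 by change (q z - p z = 0); rewrite qz pz// subrr.
  by move=> e0; move: c0; rewrite -ez e0 i0l eqxx.
have -> : ip q g = ip p g.
  apply: (ip_ae dd Lq Lp Lg Lg); last exact: nearW.
  by apply: filterS e0 => z /eqP; rewrite [e z]/(q z - p z) subr_eq0 => /eqP.
by apply: pSS; split=> // _ [n ->]; apply: (phC0 H _ Lg (qg n)); exact: (L2_tmul dd).
Qed.

(** Orthogonality to the z^n q with n > 0 gives orthogonality to q. Then conj(z) q, which vanishes
    on the same set, satisfies the same hypothesis, and induction descends through the negative
    frequencies. *)
Lemma vanishing_reducingZ q g : L2 q -> L2 g -> ~ (\forall z \ae mu, q z != 0) ->
  (forall n, ip (tmul n.+1 0 q) g = 0) -> forall k l, ip (tmul k l q) g = 0.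
Proof.
move=> Lq Lg q0 qg.
have step l : (forall n, ip (tmul n.+1 l q) g = 0) -> ip (tmul 0 l q) g = 0.
  move=> h; apply: vanishing_reducing => //; first exact: (L2_tmul dd).
    move=> h0; apply: q0; apply: filterS h0 => z; apply: contra => /eqP qz.
    by rewrite /tmul qz scaler0.
  by move=> n; rewrite tmulM addn0 add0n.
have all l n : ip (tmul n.+1 l q) g = 0.
  elim: l n => [|l IH] n; first exact: qg.
  by rewrite tmulSS; case: n => [|n]; [exact: step|exact: IH].
by case=> [|k] l; [exact: step|exact: all].
Qed.

(** * Wandering subspace and Wold decomposition *)

Section Wandering.
Variable S : set (T -> G).
Hypothesis LS : S `<=` @L2 R G.
Local Notation M := (orth S).
Hypothesis Mz : forall f, M f -> M (tmul 1 0 f).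

Let LM f : M f -> L2 f. Proof. by case. Qed.

Lemma inv_tmul n f : M f -> M (tmul n 0 f).
Proof.
elim: n => [|n IH] Mf; first by rewrite tmul00.
by have := Mz (IH Mf); rewrite tmulM add1n.
Qed.

(** M - z M as a single orthogonal complement, so that it is closed by construction. *)
Definition wandering : set (T -> G) :=
  orth (S `|` [set tmul 1 0 f | f in M]).

Let LSw : (S `|` [set tmul 1 0 f | f in M]) `<=` @L2 R G.
Proof. by move=> f [/LS//|[g /LM Lg <-]]; exact: (L2_tmul dd). Qed.

Lemma wandering_closed : closed_sub (@L2 R G) (@ip R G) wandering.
Proof. exact: (orth_closed H). Qed.

Lemma wanderingP e : wandering e <-> M e /\ forall f, M f -> ip (tmul 1 0 f) e = 0.
Proof.
split.
  move=> [Le h]; split; first by split=> // s Ss; apply: h; left.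
  move=> f Mf; apply: (phC0 H Le); first by apply: (L2_tmul dd); exact: LM.
  by apply: h; right; exists f.
move=> [[Le h] h']; split=> // s [Ss|[f Mf <-]]; first exact: h.
by apply: (phC0 H _ Le (h' _ Mf)); apply: (L2_tmul dd); exact: LM.
Qed.

Lemma wandering_const e e' : wandering e -> wandering e' ->
  \forall z \ae mu, inner (e z) (e' z) = ip e e'.
Proof.
move=> /wanderingP[Me he] /wanderingP[Me' he'].
apply: const_inner; [exact: LM|exact: LM| |] => n.
  by have := he' _ (inv_tmul n Me); rewrite tmulM add1n.
by have := he _ (inv_tmul n Me'); rewrite tmulM add1n.
Qed.

(** This set is z M, described as the functions that conj(z) brings back into M. *)
Lemma shifted_closed : closed_sub (@L2 R G) (@ip R G) [set f | L2 f /\ M (tmul 0 1 f)].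
Proof.
have [ML [M0 Ml] Mc] := orth_closed H LS.
split; first by move=> f [].
  split.
    split; first exact: (phL0 H).
    by move: M0; congr M; apply: funext => z; rewrite /tmul scaler0.
  move=> a f g [Lf Mf] [Lg Mg]; split; first exact: (phLl H).
  by rewrite tmul_lin; exact: Ml.
move=> u f uM Lf uf; split=> //.
apply: (Mc (fun n => tmul 0 1 (u n))) => [n||]; first by have [] := uM n.
  exact: (L2_tmul dd).
have E n : nsq (tmul 0 1 (u n) - tmul 0 1 f) = nsq (u n - f).
  rewrite -[RHS](nsq_tmul 0 1); congr nsq.
  by apply: funext => z; rewrite /tmul; exact/esym/scalerBr.
by under eq_fun do rewrite E.
Qed.

(** If conj(z)^k p is in M, its component orthogonal to z M is wandering, hence orthogonal to
    conj(z)^k p by hypothesis, hence null. So conj(z)^k p lies in z M, and conj(z)^(k+1) p in M. *)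
Lemma wold p : M p -> (forall n e, wandering e -> ip (tmul n 0 e) p = 0) ->
  forall k, M (tmul 0 k p).
Proof.
move=> Mp h; elim=> [|k IH]; first by rewrite tmul00.
set q := tmul 0 k p in IH; have Lq := LM IH.
have [g [Lg Mg] gP] := projection H shifted_closed Lq.
have Mg' : M g by have := Mz Mg; rewrite tmulM tmulnn.
have We : wandering (q - g).
  apply/wanderingP; split; first exact: (closed_subB (orth_closed H LS) IH Mg').
  move=> f Mf; apply: (phC0 H); first exact: (phLB H).
    by apply: (L2_tmul dd); exact: LM.
  apply: gP; split; first by apply: (L2_tmul dd); exact: LM.
  by rewrite tmulM tmulnn.
have Le := (phLB H Lq Lg).
have e0 : nsq (q - g) = 0.
  suff h0 : ip (q - g) (q - g) = 0 by exact: (congr1 (@complex.Re R) h0).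
  rewrite (phBr H Le Lq Lg) (gP g (conj Lg Mg)) subr0.
  by have := h k _ We; rewrite ip_tmul => ->.
have [_] : [set f | L2 f /\ M (tmul 0 1 f)] q.
  apply: (closed_sub_ae shifted_closed (conj Lg Mg) Lq).
  by rewrite (nsqBC H).
by rewrite tmulM add0n add1n.
Qed.

(** The trigonometric monomials with coefficients in [d] are total in L^2, so their projections are
    total in the wandering subspace. Gram-Schmidt makes them orthogonal, at the price of possible
    null vectors. *)
Lemma wandering_orthogonal_basis : exists e : nat -> T -> G,
  [/\ forall k, wandering (e k), forall j k, j != k -> ip (e j) (e k) = 0 &
   forall f, wandering f -> (forall k, ip f (e k) = 0) -> \forall z \ae mu, f z = 0].
Proof.
pose tau n : T -> G := if unpickle n is Some (k, l, j) then tmul k l (fun=> d j) else 0.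
have Ltau n : L2 (tau n).
  rewrite /tau; case: unpickle => [[[k l] j]|]; last exact: (phL0 H).
  by apply: (L2_tmul dd); exact: (L2_cst dd).
have /choice[t tP] n : exists t, wandering t /\ forall h, wandering h -> ip (tau n - t) h = 0.
  by have [t Wt tP] := projection H wandering_closed (Ltau n); exists t.
have [e [We eo et]] := gram_schmidt H wandering_closed (fun n => (tP n).1).
exists e; split=> // f Wf fe; have Lf : L2 f by have [ML _ _] := wandering_closed; exact: ML.
apply: (fourier_L2 dd Lf) => k l j.
have -> : tmul k l (fun=> d j) = tau (pickle (k, l, j)) by rewrite /tau pickleK.
set n := pickle _; have Lt : L2 (t n) by have [ML _ _] := wandering_closed; apply: ML; have [] := tP n.
apply: (phC0 H (Ltau n) Lf); have [_ /(_ f Wf)] := tP n.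
rewrite (phBl H (Ltau n) Lt Lf) (phC0 H Lf Lt (et _ Lf fe n)) subr0.
by [].
Qed.

End Wandering.

End ShiftInvariant.

(** * The symbol generated by a sequence *)

Section GeneratedSymbol.
Context {R : realType} {G : hilbertType R} (d : nat -> G) (dd : seq_dense d).
Local Notation T := (circle R).
Local Notation C := R[i].
Local Notation mu := (@arc_length R).
Local Notation nsq := (nsq (@ip R G)).
Local Notation orth := (orth (@L2 R G) (@ip R G)).
Let H := L2_preHilbert dd.
Variables (e : nat -> T -> G) (x : nat -> G) (B : nat -> R).
Hypothesis me : forall k, wmeasurable (e k).
Hypothesis eB : forall k z, rn (e k z) <= B k.

(** The weight that makes each term of the series at most 2^-k times |v|; the added 1's keep the
    denominator positive when x_k or the bound vanishes. *)
Definition gcoef k : R := 2^-1 ^+ k / ((1 + rn (x k)) * (1 + B k)).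
Definition gterm k (z : T) (v : G) : G := ((gcoef k)%:C%C * inner v (x k)) *: e k z.
Definition gpart n z v : G := \sum_(k < n) gterm k z v.
Definition gsum z v : G :=
  xget 0 [set l | forall n, rn (gpart n z v - l) <= 2 * rn v * 2^-1 ^+ n].

Let B0 k : 0 <= B k. Proof. exact: le_trans (rn_ge0 _) (eB k point). Qed.

Let den0 k : 0 < (1 + rn (x k)) * (1 + B k).
Proof. by rewrite mulr_gt0// ltr_wpDr ?rn_ge0 ?B0. Qed.

Lemma gcoef_gt0 k : 0 < gcoef k.
Proof. by rewrite divr_gt0 ?den0// exprn_gt0 ?invr_gt0. Qed.

Lemma rn_gterm k z v : rn (gterm k z v) <= rn v * 2^-1 ^+ k.
Proof.
have p0 : 0 <= rn v * 2^-1 ^+ k by rewrite mulr_ge0 ?rn_ge0// exprn_ge0// invr_ge0.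
rewrite -(@ler_pXn2r _ 2)// ?nnegrE ?rn_ge0//.
rewrite rn2Z cn2M cn2R.
have h1 : cn2 (inner v (x k)) * rn (e k z) ^+ 2 <= rn v ^+ 2 * (rn (x k) * B k) ^+ 2.
  rewrite [X in _ <= X](_ : _ = (rn v ^+ 2 * rn (x k) ^+ 2) * B k ^+ 2); last by ring.
  apply: ler_pM; rewrite ?cn2_ge0 ?sqr_ge0 ?inner_CS//.
  by apply: lerXn2r; rewrite ?nnegrE ?rn_ge0 ?B0.
rewrite -mulrA; apply: le_trans (ler_wpM2l (sqr_ge0 _) h1) _.
rewrite mulrCA -exprMn [leRHS]exprMn; apply: ler_wpM2l; first exact: sqr_ge0.
have c0 := mulr_ge0 (ltW (gcoef_gt0 k)) (mulr_ge0 (rn_ge0 (x k)) (B0 k)).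
apply: lerXn2r; rewrite ?nnegrE ?c0 ?exprn_ge0 ?invr_ge0//.
rewrite /gcoef mulrAC ler_pdivrMr//; apply: ler_wpM2l; first by rewrite exprn_ge0 ?invr_ge0.
by apply: ler_pM; rewrite ?rn_ge0 ?B0// lerDr.
Qed.

Lemma gsumP n z v : rn (gpart n z v - gsum z v) <= 2 * rn v * 2^-1 ^+ n.
Proof.
rewrite /gsum; case: xgetP => [l _ /(_ n)//|nl].
have [|l lP] := @dyadic_complete _ _ (fun n => gpart n z v) (rn v).
  by move=> k; rewrite /gpart big_ord_recr/= addrC addrK; exact: rn_gterm.
by exfalso; apply: (nl l); exact: lP.
Qed.

(** The threshold [N] admits identities that hold only for long enough partial sums, as in
    [gsum_basis], where the j-th term enters at n = j + 1. *)
Lemma dyadic_unique (p : nat -> G) l l' K K' N :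
  (forall n, (N <= n)%N -> rn (p n - l) <= K * 2^-1 ^+ n) ->
  (forall n, (N <= n)%N -> rn (p n - l') <= K' * 2^-1 ^+ n) -> l = l'.
Proof.
move=> h h'; apply/eqP; rewrite -subr_eq0; apply/eqP; apply: rn_eq0.
apply/eqP; rewrite eq_le rn_ge0 andbT.
have cv : (K + K') * 2^-1 ^+ n @[n --> \oo] --> (K + K') * (0 : R).
  apply: cvgM; first exact: cvg_cst.
  by apply: cvg_expr; rewrite ger0_norm// invf_lt1// ltr1n.
rewrite mulr0 in cv; rewrite -(cvg_lim _ cv)//.
apply: limr_ge; first by apply/cvg_ex; exists 0.
exists N => // n /= Nn.
have -> : l - l' = (p n - l') - (p n - l) by rewrite [RHS]addrC opprB addrA subrK.
by apply: le_trans (rnD _ _) _; rewrite rnN mulrDl addrC lerD ?h ?h'.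
Unshelve. all: by end_near. Qed.

Lemma gterm_lin k z (a : C) v w : gterm k z (a *: v + w) = a *: gterm k z v + gterm k z w.
Proof. by rewrite /gterm innerDl scalerA -scalerDl; congr (_ *: _); ring. Qed.

Lemma gpart_lin n z (a : C) v w : gpart n z (a *: v + w) = a *: gpart n z v + gpart n z w.
Proof.
rewrite /gpart scaler_sumr -big_split/=.
by apply: eq_bigr => k _; exact: gterm_lin.
Qed.

Lemma gsum_lin z (a : C) v w : gsum z (a *: v + w) = a *: gsum z v + gsum z w.
Proof.
apply: (@dyadic_unique (fun n => gpart n z (a *: v + w)) _ _
  (2 * rn (a *: v + w)) (Re `|a| * (2 * rn v) + 2 * rn w) 0) => n _.
  exact: gsumP.
rewrite gpart_lin opprD addrACA -scalerBr; apply: le_trans (rnD _ _) _.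
rewrite rnZ mulrDl -mulrA; apply: lerD; last exact: gsumP.
by apply: ler_wpM2l; [have /c_ge0[] := normr_ge0 a|exact: gsumP].
Qed.

Lemma wm_gpart n v : wmeasurable (fun z => gpart n z v).
Proof.
elim: n => [|n IH].
  by move: (wm_cst (0 : G)); congr wmeasurable; apply: funext => z; rewrite /gpart big_ord0.
have := wm_lin 1 IH (wm_scale (cmeas_cst _ ((gcoef n)%:C%C * inner v (x n))) (me n)).
by congr wmeasurable; apply: funext => z; rewrite scale1r /gpart big_ord_recr.
Qed.

Lemma gsum_Linfty : Linfty setT gsum.
Proof.
split.
- by move=> *; exact: gsum_lin.
- exists 2 => z v _; rewrite !normE -rmorphM/= lecR.
  by have := gsumP 0 z v; rewrite /gpart big_ord0 sub0r rnN expr0 mulr1.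
- move=> v _; apply: (wm_cvg (wm_gpart ^~ v)) => z ep ep0.
  have cv : 2 * rn v * 2^-1 ^+ n @[n --> \oo] --> 2 * rn v * (0 : R).
    apply: cvgM; first exact: cvg_cst.
    by apply: cvg_expr; rewrite ger0_norm// invf_lt1// ltr1n.
  rewrite mulr0 in cv; move/cvgrPdist_lt : cv => /(_ _ ep0)[N _ NP].
  exists N => n /NP /=; rewrite sub0r normrN => h.
  by apply: le_lt_trans (gsumP n z v) _; apply: le_lt_trans h; exact: ler_norm.
Qed.

Hypothesis xo : forall j k, j != k -> inner (x j) (x k) = 0.

Lemma gsum_basis j z : gsum z (x j) = ((gcoef j)%:C%C * (rn (x j) ^+ 2)%:C%C) *: e j z.
Proof.
apply: (@dyadic_unique (fun n => gpart n z (x j)) _ _ (2 * rn (x j)) 0 j.+1) => n jn.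
  exact: gsumP.
rewrite mul0r /gpart (bigD1 (Ordinal jn))//= big1 ?addr0.
  by rewrite /gterm inner_rn subrr rn0.
move=> k /eqP kj; rewrite /gterm xo ?mulr0 ?scale0r//.
by apply/eqP => jk; apply: kj; apply: val_inj.
Qed.

Variable S : set (T -> G).
Hypothesis LS : S `<=` @L2 R G.
Hypothesis eS : forall k n, orth S (tmul n 0 (e k)).

(** Each term multiplies [e k] by the analytic scalar function <h, x_k>, and all z^n e_k are
    orthogonal to [S]. Closedness carries this from the partial sums to the series. *)
Lemma gsum_orth h : H2 h -> orth S (fun z => gsum z (h z)).
Proof.
move=> Hh; have Lh := H2_L2 Hh; have [ML [M0 Ml] Mc] := orth_closed H LS.
have Le k : L2 (e k) by have [] := eS k 0; rewrite tmul00.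
have mh k : cmeas (fun z => inner (h z) (x k)) by exact: (L2_wm Lh (x k)).
have Lt k : L2 (fun z => gterm k z (h z)).
  apply: (L2_dom dd (wm_scale (cmeasM (cmeas_cst _ (gcoef k)%:C%C) (mh k)) (me k))
    (h := fun z => (2^-1 ^+ k) ^+ 2 * rn (h z) ^+ 2)).
    move=> z; rewrite -exprMn [X in _ <= X ^+ 2]mulrC; apply: lerXn2r; rewrite ?nnegrE ?rn_ge0 ?mulr_ge0 ?rn_ge0 ?exprn_ge0 ?invr_ge0//.
    exact: rn_gterm.
  by apply: rintZ; exact: (L2_rint dd Lh).
have Mt k : orth S (fun z => gterm k z (h z)).
  split=> // s Ss; have Ls := LS Ss.
  have mse : cmeas (fun z => inner (s z) (e k z)) by exact: (wm_inner dd (L2_wm Ls) (me k)).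
  have Lb : L2 (fun z => ((gcoef k)%:C%C * inner (s z) (e k z)) *: x k).
    apply: (L2_dom dd (wm_scale (cmeasM (cmeas_cst _ (gcoef k)%:C%C) mse) (wm_cst (x k)))
      (h := fun z => (gcoef k ^+ 2 * B k ^+ 2 * rn (x k) ^+ 2) * rn (s z) ^+ 2)).
      move=> z; rewrite rn2Z cn2M cn2R.
      rewrite [leRHS](_ : _ = gcoef k ^+ 2 * (rn (s z) ^+ 2 * B k ^+ 2) * rn (x k) ^+ 2); last by ring.
      rewrite ler_wpM2r ?sqr_ge0// ler_wpM2l ?sqr_ge0//.
      apply: le_trans (inner_CS _ _) _; rewrite ler_wpM2l ?sqr_ge0//.
      by apply: lerXn2r; rewrite ?nnegrE ?rn_ge0 ?B0.
    by apply: rintZ; exact: (L2_rint dd Ls).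
  (* The pairing becomes one of [h] with a fixed function, square integrable because [e k] is
     bounded; density then reduces [h] to monomials. *)
  transitivity (ip h (fun z => ((gcoef k)%:C%C * inner (s z) (e k z)) *: x k)).
    apply: eq_Cint => z; rewrite /gterm iZl iZr cJM cJR -innerC.
    by ring.
  apply: (H2_dense dd Hh Lb) => n y.
  transitivity (((gcoef k)%:C%C * inner y (x k)) * ip (tmul n 0 (e k)) s).
    rewrite -CintZ; last first.
      by have := L2_cint dd (L2_tmul dd n 0 (Le k)) Ls.
    by apply: eq_Cint => z; rewrite /tmul !iZl iZr cJM cJR -innerC; ring.
  by have [_ ->//] := eS k n; rewrite mulr0.
have Mp n : orth S (fun z => gpart n z (h z)).
  elim: n => [|n IH].
    by move: M0; congr (orth S); apply: funext => z; rewrite /gpart big_ord0.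
  have := Ml 1 _ _ IH (Mt n); congr (orth S); apply: funext => z.
  change (1 *: gpart n z (h z) + gterm n z (h z) = gpart n.+1 z (h z)).
  by rewrite scale1r /gpart big_ord_recr.
have LG := Linfty_mul dd dd gsum_Linfty Lh.
apply: (Mc _ _ Mp LG).
have b n z : rn (gpart n z (h z) - gsum z (h z)) ^+ 2 <= 4 * 4^-1 ^+ n * rn (h z) ^+ 2.
  have e2 : (2^-1 ^+ n) ^+ 2 = 4^-1 ^+ n :> R.
    by rewrite -exprM mulnC exprM; congr (_ ^+ _); lra.
  rewrite (_ : 4 * _ * _ = (2 * rn (h z) * 2^-1 ^+ n) ^+ 2); last first.
    by rewrite !exprMn e2; ring.
  by apply: lerXn2r; rewrite ?nnegrE ?rn_ge0 ?mulr_ge0 ?rn_ge0 ?exprn_ge0 ?invr_ge0//; exact: gsumP.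
have cv : 4 * 4^-1 ^+ n * \int[mu]_z rn (h z) ^+ 2 @[n --> \oo] --> 4 * 0 * \int[mu]_z rn (h z) ^+ 2.
  apply: cvgM; last exact: cvg_cst.
  apply: cvgM; first exact: cvg_cst.
  by apply: cvg_expr; rewrite ger0_norm// invf_lt1// ltr1n.
rewrite mulr0 mul0r in cv.
apply: squeeze_cvgr (cvg_cst 0) cv; near=> n.
have Ld : L2 ((fun z => gpart n z (h z)) - (fun z => gsum z (h z))).
  by apply: (phLB H) => //; exact: ML.
rewrite nsqE -RintZ; last exact: (L2_rint dd Lh); apply/andP; split.
  by apply: Rintegral_ge0 => z _; exact: sqr_ge0.
apply: le_Rintegral => //; [exact: (L2_rint dd Ld)|by apply: rintZ; exact: (L2_rint dd Lh)|].
by move=> z _; exact: b.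
Unshelve. all: by end_near. Qed.

End GeneratedSymbol.

(** * Realization of invariant subspaces as kernels *)

Lemma dim1_unit (R : realType) (E : hilbertType R) : has_dim E 1 ->
  exists u : E, rn u = 1 /\ forall x, x = inner x u *: u.
Proof.
move=> [[v vl [g gK vK]]].
have vZ a x : v (a *: x) = a *: v x.
  have v0 : v 0 = 0.
    have := vl 1 0 0; rewrite !scale1r addr0 => /eqP.
    by rewrite -subr_eq0 opprD addrA subrr sub0r oppr_eq0 => /eqP.
  by have := vl a x 0; rewrite addr0 v0 addr0.
pose e := g (const_mx 1).
have spn x : x = v x 0 0 *: e.
  apply: (can_inj gK); rewrite vZ vK; apply/matrixP => i j.
  by rewrite !mxE !ord1 mulr1.
have e0 : rn e != 0.
  apply/eqP => /rn_eq0 e0; have := vK (const_mx 1); rewrite -/e e0 -(scale0r (0 : E)) vZ scale0r.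
  by move=> /matrixP/(_ 0 0)/eqP; rewrite !mxE eq_sym oner_eq0.
have r0 : 0 < rn e by rewrite lt_neqAle rn_ge0 eq_sym e0.
pose u := ((rn e)^-1)%:C%C *: e.
have ru : rn u = 1.
  apply/eqP; rewrite -(@eqrXn2 _ 2)// ?rn_ge0// rn2Z cn2R expr1n exprVn mulVf//.
  by rewrite expf_neq0.
exists u; split=> // x.
have -> : x = (v x 0 0 * (rn e)%:C%C) *: u.
  rewrite /u scalerA -mulrA -rmorphM mulfV// mulr1; exact: spn.
by rewrite iZl inner_rn ru expr1n mulr1.
Qed.

Section Realization.
Context {R : realType} {E F : hilbertType R} (dE : nat -> E) (dF : nat -> F).
Hypotheses (ddE : seq_dense dE) (ddF : seq_dense dF).
Variable u : E.
Hypotheses (ru : rn u = 1) (Eu : forall x : E, x = inner x u *: u).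
Local Notation T := (circle R).
Local Notation C := R[i].
Local Notation mu := (@arc_length R).
Local Notation G := (dsum E F).
Local Notation orthE := (orth (@L2 R E) (@ip R E)).
Local Notation orthG := (orth (@L2 R G) (@ip R G)).
Let ddG := dsum_dense ddE ddF.
Let H := L2_preHilbert ddG.
Let HE := L2_preHilbert ddE.

Lemma dim1_orth (x y : E) : inner x y = 0 -> x = 0 \/ y = 0.
Proof.
rewrite (Eu x) (Eu y) iZl iZr inner_rn ru expr1n mulr1 => /eqP.
rewrite mulf_eq0 => /orP[/eqP ->|]; first by left; rewrite scale0r.
by rewrite conjC_eq0 => /eqP ->; right; rewrite scale0r.
Qed.

Definition halfu (z : T) : E := ((0 < cy z)%R%:R : C) *: u.

Let chi (z : T) : C := (0 < cy z)%R%:R.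

Let cmeas_chi : cmeas chi.
Proof.
have m : measurable_fun setT (\1_[set z : T | 0 < cy z] : T -> R).
  apply: measurable_indic; rewrite (_ : mkset _ = setT `&` cy @^-1` `]0, +oo[).
    by apply: measurable_cy => //; exact: measurable_itv.
  by apply/seteqP; split=> z /=; rewrite in_itv/= andbT// => -[].
have E1 z : chi z = ((\1_[set z : T | 0 < cy z] z : R)%:C)%C.
  rewrite /chi indicE; case: (ltP 0 (cy z)) => h; first by rewrite mem_set.
  by rewrite memNset//= => ?; move: h; rewrite leNgt => /negP.
split; first by under eq_fun do rewrite E1.
by under eq_fun do rewrite E1; exact: measurable_cst.
Qed.

Let cn2_chi z : cn2 (chi z) <= 1.
Proof. by rewrite /chi; case: (0 < _); rewrite /cn2/= ?expr1n expr0n addr0. Qed.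

Lemma L2_halfu : L2 halfu.
Proof. exact: (L2_scale ddE cmeas_chi cn2_chi (L2_cst ddE u)). Qed.

(** [halfu] vanishes on the lower arc, so its analytic shifts already force all its frequencies to
    be orthogonal to [g]. With the positive frequencies of [u], the same then holds for u - halfu,
    which vanishes on the upper arc, and the two add up to [u]. *)
Lemma halfu_cyclic (g : T -> E) : L2 g -> (forall n, ip (tmul n 0 halfu) g = 0) ->
  (forall n x, ip (tmul n.+1 0 (fun=> x)) g = 0) -> \forall z \ae mu, g z = 0.
Proof.
move=> Lg h1 h2.
have Lu := L2_cst ddE u; have Lh := L2_halfu.
have a1 := vanishing_reducingZ ddE Lh Lg.
have {}a1 : forall k l, ip (tmul k l halfu) g = 0.
  apply: a1 => // h; apply: lower_half_not_null; apply: filterS h => z.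
  by rewrite /halfu; case: (0 < cy z) => //; rewrite scale0r eqxx.
pose h' : T -> E := (fun=> u) - halfu.
have Lh' : L2 h' := phLB HE Lu Lh.
have tB k l : tmul k l h' = tmul k l (fun=> u) - tmul k l halfu.
  by apply: funext => z; exact: scalerBr.
have ipB k l : ip (tmul k l h') g = ip (tmul k l (fun=> u)) g - ip (tmul k l halfu) g.
  by rewrite tB (phBl HE)//; exact: (L2_tmul ddE).
have a2 : forall k l, ip (tmul k l h') g = 0.
  apply: (vanishing_reducingZ ddE Lh' Lg).
    move=> h; apply: upper_half_not_null; apply: filterS h => z.
    change (u - halfu z != 0 -> ~ 0 < cy z).
    by rewrite /halfu; case: (0 < cy z) => //; rewrite scale1r subrr eqxx.
  by move=> n; rewrite ipB h2 a1 subrr.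
apply: (fourier_L2 ddE Lg) => k l j; apply: (phC0 HE) => //.
  by apply: (L2_tmul ddE); exact: (L2_cst ddE).
rewrite (_ : tmul k l (fun=> dE j) = inner (dE j) u *: tmul k l (fun=> u)); last first.
  apply: funext => z; change (trig k l z *: dE j = inner (dE j) u *: (trig k l z *: u)).
  by rewrite {1}(Eu (dE j)) !scalerA mulrC.
rewrite (phZl HE)//; last exact: (L2_tmul ddE).
by have := ipB k l; rewrite a1 a2 subr0 => <-; rewrite mulr0.
Qed.

Definition inlf (f : T -> E) : T -> G := pairf f (fun=> 0).

Lemma L2_inl f : L2 f -> L2 (inlf f).
Proof. by move=> Lf; apply: (L2_pairf ddE ddF Lf); exact: (L2_cst ddF). Qed.

Lemma ip_inl f (w : T -> G) : ip (inlf f) w = ip f (fstf w).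
Proof. by apply: eq_Cint => z; rewrite inner_dsum/= i0l addr0. Qed.

Lemma tmul_inl k l f : tmul k l (inlf f) = inlf (tmul k l f).
Proof.
apply: funext => z; change ((trig k l z *: f z, trig k l z *: (0 : F)) = (trig k l z *: f z, 0) :> G).
by rewrite scaler0.
Qed.

Lemma tmul_sndf k l (w : T -> G) : sndf (tmul k l w) = tmul k l (sndf w).
Proof. by []. Qed.

Variable N : set (T -> G).
Hypothesis invN : invariant_shift N.

Let NH v : N v -> oplus (@H2 R E) (@H2 R F) v. Proof. by move: invN => [h _]; exact: h. Qed.

Let NL v : N v -> L2 v.
Proof. by move=> /NH/(H2_dsum ddE ddF)/H2_L2. Qed.

(** Generators of the complement of N3: the image of [N] under [J2], and the negative frequencies
    that the second component must avoid. *)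
Let S : set (T -> G) := [set s | (exists2 v, N v & s = J2 v) \/
  exists n y, (0 < n)%N /\ s = pairf (fun=> 0) (tmul 0 n (fun=> y))].

Let LS : S `<=` @L2 R G.
Proof.
move=> _ [[v Nv ->]|[n [y [n0 ->]]]]; first exact: (L2_J2 ddE ddF (NL Nv)).
by apply: (L2_pairf ddE ddF); [exact: (L2_cst ddE)|apply: (L2_tmul ddF); exact: (L2_cst ddF)].
Qed.

(* The subspace called [N_3] in the paper. *)
Local Notation N3 := (orthG S).

Let N3P f : N3 f <-> [/\ L2 f, H2 (sndf f) & forall v, N v -> ip (J2 f) v = 0].
Proof.
have ipr (g : T -> F) : ip f (pairf (fun=> 0) g) = ip (sndf f) g.
  by apply: eq_Cint => z; rewrite inner_dsum/= i0r add0r.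
split=> [[Lf fS]|[Lf Hf fN]].
  split=> //; last first.
    by move=> v Nv; rewrite (ip_J2l ddE ddF Lf (NL Nv)); apply: fS; left; exists v.
  apply/H2P; split=> [|n y n0]; first exact: (L2_sndf ddE ddF).
  by rewrite -ipr; apply: fS; right; exists n, y.
split=> // _ [[v Nv ->]|[n [y [n0 ->]]]]; first by rewrite -(ip_J2l ddE ddF Lf (NL Nv)) fN.
by rewrite ipr; have [_ h] := (H2P _).1 Hf; exact: h.
Qed.

(** Across the inner product, [J2] turns the multiplication by z of the first component into the
    forward shift of [v], while the second component gives the backward shift: together the operator
    that leaves [N] invariant. *)
Let N3z f : N3 f -> N3 (tmul 1 0 f).
Proof.
move=> /N3P[Lf Hf fN]; apply/N3P; split; first exact: (L2_tmul ddG).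
  by rewrite tmul_sndf; exact: (H2_tmul ddF).
move=> v Nv; have [_ [_ inv]] := invN; have Nv' := inv v Nv.
rewrite -(fN _ Nv') (ip_dsum ddE ddF) ?(ip_dsum ddE ddF (L2_J2 ddE ddF Lf) (NL Nv')); last exact: NL.
  have [Hv1 Hv2] := NH Nv; congr (_ + _).
    rewrite (_ : fstf (J2 (tmul 1 0 f)) = tmul 0 1 (fstf (J2 f))).
      by rewrite ip_tmul -mulzE.
    by apply: funext => z; rewrite /tmul -trig_cconj.
  have [_ sP] := shift_adjoint ddF Hv2.
  by rewrite /= -mulzE; exact/esym/sP.
by apply: (L2_J2 ddE ddF); exact: (L2_tmul ddG).
Qed.

Let N3L f : N3 f -> L2 f. Proof. by case. Qed.
Let cN3 := orth_closed H LS.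

Let N3inl n x : N3 (inlf (tmul n.+1 0 (fun=> x))).
Proof.
have Lt : L2 (tmul n.+1 0 (fun _ : T => x)) by apply: (L2_tmul ddE); exact: (L2_cst ddE).
apply/N3P; split; first exact: L2_inl; first by have := H2_0 ddF.
move=> v Nv; have [Hv1 _] := NH Nv.
have -> : J2 (inlf (tmul n.+1 0 (fun=> x))) = inlf (tmul 0 n.+1 (fun=> x)).
  by apply: funext => z; rewrite /J2 /inlf /pairf /fstf /sndf /tmul/= trig_cconj.
rewrite ip_inl; apply: (phC0 HE); [exact: H2_L2|by apply: (L2_tmul ddE); exact: (L2_cst ddE)|].
by have [_ h] := (H2P _).1 Hv1; exact: h.
Qed.

Let N_of_N3 w : oplus (@H2 R E) (@H2 R F) w -> (forall f, N3 f -> ip (J2 f) w = 0) -> N w.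
Proof.
move=> Ow h; have Lw : L2 w by apply: H2_L2; apply/(H2_dsum ddE ddF).
have cN : closed_sub (@L2 R G) (@ip R G) N.
  by apply: (subspaceL2_closed ddG); move: invN => [_ []].
have [v Nv vP] := projection H cN Lw; have Lv := NL Nv.
have Lwv := phLB H Lw Lv.
apply: (closed_sub_ae cN Nv Lw); rewrite (nsqBC H)//.
suff h0 : ip (w - v) (w - v) = 0 by exact: (congr1 (@complex.Re R) h0).
rewrite (phBr H Lwv Lw Lv) (vP v Nv) subr0 -[w - v]J2K; apply: h.
apply/N3P; split; first exact: (L2_J2 ddE ddF).
  exact: (H2_B ddF Ow.2 (NH Nv).2).
by move=> x Nx; rewrite J2K; exact: vP.
Qed.

Let Wn := wandering S.

(** The second components of all conj(z)^k r lie in H^2, so that of r has no frequency at all.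
    Raising both exponents in [tmul] gives the positive power of conj(z) that H^2 tests. *)
Let bilateral r : (forall k, N3 (tmul 0 k r)) -> \forall z \ae mu, sndf r z = 0.
Proof.
move=> Rr; have Lr : L2 r by have /N3L := Rr 0%N; rewrite tmul00.
apply: (fourier_L2 ddF (L2_sndf ddE ddF Lr)) => k l j.
rewrite -tmulSS -(add0n l.+1) -(addn0 k.+1) -tmulM -ip_tmul -tmul_sndf.
by have /N3P[_ /H2P[_ h] _] := Rr k.+1; exact: h.
Qed.

(* The part [q] of [z x] orthogonal to the reducing part of [N3] is pointwise
   orthogonal to [r]; since [dim E = 1], it vanishes wherever [r] does not, so
   that it lies in the reducing part as well and is null. *)
Let dichotomy : (forall r, (forall k, N3 (tmul 0 k r)) -> \forall z \ae mu, r z = 0) \/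
  (forall f, L2 f -> N3 (inlf f)).
Proof.
have [h|] := pselect (forall r, (forall k, N3 (tmul 0 k r)) -> \forall z \ae mu, r z = 0).
  by left.
move=> /existsNP[r /not_implyP[Rr nr]]; right.
have Lr : L2 r by have /N3L := Rr 0%N; rewrite tmul00.
(* Its complement is the largest reducing subspace inside N3, the intersection of all z^k N3. *)
pose SR : set (T -> G) := [set s | exists k s', S s' /\ s = tmul k 0 s'].
have LSR : SR `<=` @L2 R G by move=> _ [k [s [Ss ->]]]; apply: (L2_tmul ddG); exact: LS.
have RP f : orthG SR f <-> forall k, N3 (tmul 0 k f).
  split=> [[Lf h] k|h].
    by split=> [|s Ss]; [exact: (L2_tmul ddG)|rewrite ip_tmul; apply: h; exists k, s].
  split=> [|_ [k [s [Ss ->]]]]; first by have /N3L := h 0%N; rewrite tmul00.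
  by have [_ /(_ s Ss)] := h k; rewrite ip_tmul.
have cR := orth_closed H LSR.
have Rkl f k l : orthG SR f -> orthG SR (tmul k l f).
  move=> /RP Rf; apply/RP => m; rewrite tmulM add0n.
  have [km|mk] := leqP k (m + l).
    have -> : tmul k (m + l) f = tmul 0 (m + l - k) f; last exact: Rf.
    by rewrite -[in RHS](tmulnn k f) tmulM add0n subnK.
  have -> : tmul k (m + l) f = tmul (k - (m + l)) 0 f.
    by rewrite -[in RHS](tmulnn (m + l) f) tmulM add0n subnK// ltnW.
  by apply: (inv_tmul N3z); have := Rf 0%N; rewrite tmul00.
have xin x : orthG SR (inlf (tmul 1 0 (fun=> x))).
  set zeta := inlf _; have N3zeta : N3 zeta := N3inl 0 x; have Lz := N3L N3zeta.
  have [p Rp pP] := projection H cR Lz; have Lp : L2 p by case: Rp.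
  set q := zeta - p in pP; have Lq : L2 q := phLB H Lz Lp.
  have N3p : N3 p by have /RP/(_ 0%N) := Rp; rewrite tmul00.
  have N3q : N3 q := closed_subB cN3 N3zeta N3p.
  have qr : \forall z \ae mu, inner (q z) (r z) = 0.
    apply: fourier_unique; first exact: (L2_cint ddG Lq Lr).
      move=> n; transitivity (ip q (tmul 0 n r)); last by apply: pP; apply: Rkl; apply/RP.
      by apply: eq_Cint => z; rewrite /tmul iZr trigJ /trig expr0 mulr1.
    move=> n; transitivity (ip q (tmul n 0 r)); last by apply: pP; apply: Rkl; apply/RP.
    by apply: eq_Cint => z; rewrite /tmul iZr trigJ /trig expr0 mul1r.
  have r2 := bilateral Rr.
  have p2 := bilateral ((RP p).1 Rp).
  have q2 : \forall z \ae mu, sndf q z = 0.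
    apply: filterS p2 => z; rewrite /sndf => pz; change (0 - (p z).2 = 0).
    by rewrite pz subrr.
  have q0 : ~ \forall z \ae mu, q z != 0.
    move=> qn; apply: nr; apply: filterS2 (filterI qr qn) (filterI r2 q2) => z [qrz qz] [rz2 qz2].
    move: qrz; rewrite inner_dsum -/(sndf r z) rz2 i0r addr0 => /dim1_orth[q1|r1].
      by exfalso; move/eqP: qz; apply; rewrite (dsumE (q z)) q1 -/(sndf q z) qz2 addr0.
    by rewrite (dsumE (r z)) r1 -/(sndf r z) rz2 addr0.
  have Rq : orthG SR q.
    apply/RP => k; split=> [|s Ss]; first exact: (L2_tmul ddG).
    apply: (vanishing_reducingZ ddG Lq (LS Ss) q0) => n.
    by have [_ h] := inv_tmul N3z n.+1 N3q; exact: h.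
  apply: (closed_sub_ae cR Rp Lz); rewrite (nsqBC H)//.
  by have := pP q Rq => h; exact: (congr1 (@complex.Re R) h).
have all k l x : N3 (inlf (tmul k l (fun=> x))).
  have := Rkl _ k l.+1 (xin x); rewrite tmul_inl tmulM addn0 addn1 tmulSS.
  by move=> /RP/(_ 0%N); rewrite tmul00.
move=> f Lf; split; first exact: L2_inl.
move=> s Ss; have Ls := LS Ss; have Ls1 := L2_fstf ddE ddF Ls; rewrite ip_inl.
have s0 : \forall z \ae mu, fstf s z = 0.
  apply: (fourier_L2 ddE Ls1) => k l j; apply: (phC0 HE) => //.
    by apply: (L2_tmul ddE); exact: (L2_cst ddE).
  by rewrite -ip_inl; have [_ h] := all k l (dE j); exact: h.
rewrite -(ph0r HE Lf); apply: (ip_ae ddE Lf Lf Ls1 (phL0 HE) _ s0).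
exact: nearW.
Qed.

(* [e k.+1] is an orthogonal basis of the wandering subspace; its pointwise
   inner products are constant, so the values at a suitable point serve as [x]. *)
Let generators : exists (e : nat -> T -> G) (x : nat -> G) (B : nat -> R),
  [/\ forall k, N3 (e k), forall k z, rn (e k z) <= B k,
      forall j k, j != k -> inner (x j) (x k) = 0,
      forall k, x k = 0 -> \forall z \ae mu, e k z = 0 &
      forall p, N3 p -> (forall n k, ip (tmul n 0 (e k)) p = 0) ->
        (forall n y, ip (inlf (tmul n.+1 0 (fun=> y))) p = 0) -> \forall z \ae mu, p z = 0].
Proof.
have [b [Wb bo bt]] := wandering_orthogonal_basis ddG LS.
have N3b k : N3 (b k) by have /(wanderingP ddG S _)[] := Wb k.
have Lb k := N3L (N3b k).
have cW := wandering_closed ddG LS.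
have bc j k : \forall z \ae mu, inner (b j z) (b k z) = ip (b j) (b k).
  exact: (wandering_const ddG N3z (Wb j) (Wb k)).
pose nb k := Num.sqrt (nsq (@ip R G) (b k)).
(* |b_k| is a.e. equal to its norm [nb k], so this truncation changes [b k] only on a null set and
   yields the everywhere bound that the series construction needs. *)
pose b' k z : G := if rn (b k z) <= nb k then b k z else 0.
have nb0 k : 0 <= nb k by exact: sqrtr_ge0.
have bb' k : \forall z \ae mu, b k z = b' k z.
  apply: filterS (bc k k) => z bz; rewrite /b' ifT// -(@ler_pXn2r _ 2)// ?nnegrE ?rn_ge0//.
  by rewrite sqr_sqrtr ?(nsq_ge0 H)// rn2E bz.
have b'B k z : rn (b' k z) <= nb k by rewrite /b'; case: ifP => //; rewrite rn0.
have mb' k : wmeasurable (b' k).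
  pose A := [set z | rn (b k z) ^+ 2 <= nb k ^+ 2].
  have mA : measurable A.
    rewrite (_ : A = setT `&` (fun z => rn (b k z) ^+ 2) @^-1` `]-oo, nb k ^+ 2]).
      by apply: (wm_rn2 ddG (L2_wm (Lb k))) => //; exact: measurable_itv.
    by apply/seteqP; split=> z /=; rewrite in_itv/= // => -[].
  have mc : cmeas (fun z => ((\1_A z : R)%:C)%C).
    by split; [exact: measurable_indic|exact: measurable_cst].
  have := wm_scale mc (L2_wm (Lb k)); congr wmeasurable; apply: funext => z.
  rewrite /b' indicE; case: ifPn => h.
    by rewrite mem_set ?scale1r// /A/=; apply: lerXn2r; rewrite ?nnegrE ?rn_ge0.
  rewrite memNset ?scale0r// /A/= => h'; move/negP: h; apply.
  by rewrite -(@ler_pXn2r _ 2)// ?nnegrE ?rn_ge0.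
have Lb' k : L2 (b' k) := L2_ae ddG (mb' k) (Lb k) (bb' k).
have N3b' k : N3 (b' k).
  apply: (closed_sub_ae cN3 (N3b k) (Lb' k)); apply: (nsq_ae ddG).
    exact: (phLB H (Lb k) (Lb' k)).
  by apply: filterS (bb' k) => z bz; change (b k z - b' k z = 0); rewrite bz subrr.
have wold0 p : N3 p -> (forall n k, ip (tmul n 0 (b' k)) p = 0) -> forall k, N3 (tmul 0 k p).
  move=> N3p pb; have Lp := N3L N3p.
  apply: (wold ddG LS N3z N3p) => n e We.
  have Le : L2 e by have /(wanderingP ddG S _)[/N3L] := We.
  have Lq : L2 (tmul 0 n p) := L2_tmul ddG 0 n Lp.
  (* The projection of conj(z)^n p on the wandering subspace is orthogonal to every [b k], hence
     null; thus p is orthogonal to z^n e for every wandering e, as [wold] asks. *)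
  have [t Wt tP] := projection H cW Lq.
  have Lt : L2 t by have /(wanderingP ddG S _)[/N3L] := Wt.
  have t0 : \forall z \ae mu, t z = 0.
    apply: bt => // k.
    have := tP _ (Wb k); rewrite (phBl H Lq Lt (Lb k)) => /eqP; rewrite subr_eq0 => /eqP <-.
    have Lbk := L2_tmul ddG n 0 (Lb k).
    rewrite ip_tmul; apply: (phC0 H Lbk Lp); rewrite -(pb n k).
    apply: (ip_ae ddG Lbk (L2_tmul ddG n 0 (Lb' k)) Lp Lp); last exact: nearW.
    by apply: filterS (bb' k) => z bz; rewrite /tmul bz.
  rewrite ip_tmul; apply: (phC0 H Lq Le).
  have := tP _ We; rewrite (phBl H Lq Lt Le) => /eqP; rewrite subr_eq0 => /eqP ->.
  rewrite -(ph0l H Le); apply: (ip_ae ddG Lt (phL0 H) Le Le t0).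
  exact: nearW.
(* All pairs are handled off one null set, so a single point can give orthogonal values. *)
have good : \forall z \ae mu, forall jk : nat, if unpickle jk is Some (j, k)
    then inner (b j z) (b k z) = ip (b j) (b k) else True.
  apply: ae_foralln => jk; case: unpickle => [[j k]|]; first exact: bc.
  exact: nearW.
have [R0|Rf] := dichotomy.
  have [z0 gz] := ae_exists good.
  have gjk j k : inner (b j z0) (b k z0) = ip (b j) (b k).
    by have := gz (pickle (j, k)); rewrite pickleK.
  exists b', (b ^~ z0), nb; split=> //.
  - by move=> j k jk; rewrite gjk bo.
  - move=> k bk; have := gjk k k; rewrite bk i0l => /esym h.
    have h0 : nsq (@ip R G) (b k) = 0 by exact: (congr1 (@complex.Re R) h).
    apply: filterS2 (nsq_ae0 ddG (Lb k) h0) (bb' k) => z bz <-; exact: bz.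
  - by move=> p N3p pb _; apply: R0; exact: wold0.
(* Here N3 contains all of L^2(E), and so does z N3; wandering vectors are orthogonal to z N3, so
   their first components vanish. *)
have b1 k : \forall z \ae mu, fstf (b k) z = 0.
  have Lb1 := L2_fstf ddE ddF (Lb k).
  apply: (fourier_L2 ddE Lb1) => m l j; apply: (phC0 HE) => //.
    by apply: (L2_tmul ddE); exact: (L2_cst ddE).
  rewrite -tmulSS -ip_inl.
  have /(wanderingP ddG S _)[_ h] := Wb k.
  have -> : inlf (tmul m.+1 l.+1 (fun=> dE j)) = tmul 1 0 (inlf (tmul m l.+1 (fun=> dE j))).
    by rewrite tmul_inl tmulM add1n.
  by apply: h; apply: Rf; apply: (L2_tmul ddE); exact: (L2_cst ddE).
have b1all : \forall z \ae mu, forall k, fstf (b k) z = 0 by exact: ae_foralln.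
have [z0 [gz bz]] := ae_exists (filterI good b1all).
have gjk j k : inner (b j z0) (b k z0) = ip (b j) (b k).
  by have := gz (pickle (j, k)); rewrite pickleK.
(* The arc function is put at index 0 with the vector (u, 0), which is orthogonal to the values
   b_k(z0) because these have zero first component. *)
pose e k := if k is k'.+1 then b' k' else inlf halfu.
pose x k : G := if k is k'.+1 then b k' z0 else (u, 0).
pose B k := if k is k'.+1 then nb k' else 1.
exists e, x, B; split.
- by case=> [|k]; [apply: Rf; exact: L2_halfu|exact: N3b'].
- case=> [|k] z; last exact: b'B.
  rewrite /e /inlf /pairf rn_inl /halfu; case: (0 < cy z); last by rewrite scale0r rn0.
  by rewrite scale1r ru.
- have ub k : inner ((u, 0) : G) (b k z0) = 0.
    by rewrite inner_dsum/= -/(fstf (b k) z0) bz i0r i0l addr0.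
  case=> [|j] [|k] jk; [by []|exact: ub| |].
    by rewrite innerC /x ub rmorph0.
  by rewrite /x gjk bo.
- case=> [|k] /=.
    by move=> /(congr1 fst)/= u0; move: ru; rewrite u0 rn0 => /eqP; rewrite eq_sym oner_eq0.
  move=> bk; have := gjk k k; rewrite bk i0l => /esym h.
  have h0 : nsq (@ip R G) (b k) = 0 by exact: (congr1 (@complex.Re R) h).
  by apply: filterS2 (nsq_ae0 ddG (Lb k) h0) (bb' k) => z bz' <-; exact: bz'.
- move=> p N3p pe pz; have Lp := N3L N3p.
  have Rp := wold0 p N3p (fun n k => pe n k.+1).
  have p2 := bilateral Rp.
  have p1 : \forall z \ae mu, fstf p z = 0.
    apply: halfu_cyclic; first exact: (L2_fstf ddE ddF).
      by move=> n; rewrite -ip_inl -tmul_inl; exact: (pe n 0%N).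
    by move=> n y; rewrite -ip_inl.
  apply: filterS2 p1 p2 => z; rewrite /fstf /sndf => h1 h2.
  by rewrite (dsumE (p z)) h1 h2 addr0.
Qed.

Theorem invariant_is_kernel : exists Psi : symbol E F,
  Lambda Psi /\ N = ker (oplus (@H2 R E) (@H2 R F)) (W Psi).
Proof.
have [e [x [B [N3e eB xo xe gen]]]] := generators.
have me k : wmeasurable (e k) := L2_wm (N3L (N3e k)).
pose Psi := gsum e x B.
have LPsi : Linfty setT Psi := gsum_Linfty x me eB.
have PsiN3 h : H2 h -> N3 (fun z => Psi z (h z)).
  by apply: (gsum_orth ddG x me eB LS) => k n; exact: (inv_tmul N3z).
have HPsi v : H2 (sndf (fun z => Psi z v)).
  have Hv : H2 (fun _ : T => v) by have := H2_monomial ddG 0 v; rewrite tmul00.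
  by have /N3P[] := PsiN3 _ Hv.
exists (symbol_of Psi); split; first exact: (symbol_of_Lambda LPsi HPsi).
rewrite (ker_W ddE ddF LPsi HPsi); apply/seteqP; split=> w.
  move=> Nw; split; first exact: NH.
  by move=> h Hh; have /N3P[_ _ fN] := PsiN3 _ Hh; exact: fN.
move=> [Ow wP]; have Lw : L2 w by apply: H2_L2; apply/(H2_dsum ddE ddF).
have Lg := L2_J2 ddE ddF Lw.
(* It remains to see that the component [p] of [J2 w] in N3 is null, since then [J2 w] is orthogonal
   to N3 and w lies in [N]. *)
have [p N3p pP] := projection H cN3 Lg; have Lp := N3L N3p.
have ipp f : N3 f -> ip f p = ip f (J2 w).
  move=> N3f; have Lf := N3L N3f; apply/eqP; rewrite eq_sym -subr_eq0 -(phBr H)//; apply/eqP.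
  by apply: (phC0 H); [exact: (phLB H Lg Lp)|by []|exact: pP].
have p0 : \forall z \ae mu, p z = 0.
  apply: gen => // [n k|n y]; last first.
    rewrite ipp; last exact: N3inl.
    have /N3P[Lf _ _] := N3inl n y; rewrite -(ip_J2l ddE ddF Lf Lw).
    have -> : J2 (inlf (tmul n.+1 0 (fun=> y))) = inlf (tmul 0 n.+1 (fun=> y)).
      by apply: funext => z; rewrite /J2 /inlf /pairf /fstf /sndf /tmul/= trig_cconj.
    rewrite ip_inl; apply: (phC0 HE); [exact: H2_L2 Ow.1|by apply: (L2_tmul ddE); exact: (L2_cst ddE)|].
    by have [_ h] := (H2P _).1 Ow.1; exact: h.
  have N3t := inv_tmul N3z n (N3e k).
  (* If x_k = 0 the symbol cannot produce [e k], but then [e k] is null. Otherwise Psi sends z^n x_k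
     to c z^n e_k with c nonzero. *)
  have [xk|xk] := eqVneq (x k) 0.
    rewrite -(ph0l H Lp); apply: (ip_ae ddG (N3L N3t) (phL0 H) Lp Lp); last exact: nearW.
    by apply: filterS (xe k xk) => z ez; rewrite /tmul ez scaler0.
  rewrite ipp//.
  have Hm := H2_monomial ddG n (x k).
  have /(_ Hm) := wP (tmul n 0 (fun=> x k)).
  have LPm := N3L (PsiN3 _ Hm).
  rewrite (ip_J2l ddE ddF LPm Lw).
  pose c : C := (gcoef x B k)%:C%C * (rn (x k) ^+ 2)%:C%C.
  have -> : (fun z => Psi z (tmul n 0 (fun=> x k) z)) = c *: tmul n 0 (e k).
    apply: funext => z; rewrite /tmul -[trig n 0 z *: x k]addr0 (Linfty_lin _ _ _ _ LPsi).
    rewrite (Linfty_0 _ LPsi) addr0 /Psi (gsum_basis eB xo).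
    change (trig n 0 z *: (c *: e k z) = c *: (trig n 0 z *: e k z)).
    by rewrite !scalerA mulrC.
  rewrite (phZl H c (N3L N3t) Lg) => /eqP; rewrite mulf_eq0 => /orP[/eqP c0|/eqP//].
  exfalso; move/eqP: xk; apply; apply: rn_eq0; apply/eqP; rewrite -sqrf_eq0.
  move: c0; rewrite /c -rmorphM => /(congr1 (@complex.Re R))/= /eqP.
  by rewrite mulf_eq0 (gt_eqF (gcoef_gt0 x eB k)).
apply: N_of_N3 => // f N3f; have Lf := N3L N3f.
rewrite (ip_J2l ddE ddF Lf Lw) -ipp// -(ph0r H Lf).
by apply: (ip_ae ddG Lf Lf Lp (phL0 H) _ p0); exact: nearW.
Qed.

End Realization.

Theorem theorem5p1 (R : realType) (E F : hilbertType R)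
  (sepE : separable E) (sepF : separable F) (dimE : has_dim E 1)
  (N : set (circle R -> dsum E F)) (invN : invariant_shift N) :
  (exists Psi : symbol E F,
     Lambda Psi /\ N = ker (oplus (@H2 R E) (@H2 R F)) (W Psi)) /\
  ((exists n, has_dim F n) -> typeI N ->
   exists Psi : symbol E F,
     [/\ Lambda Psi,
         partial_isometry (oplus (@H2 R E) (@H2 R F)) (W Psi) &
         N = ker (oplus (@H2 R E) (@H2 R F)) (W Psi)]).
Proof.
have [dE ddE] := separable_seq_dense sepE; have [dF ddF] := separable_seq_dense sepF.
split; last by move=> _; exact: (typeI_partial_isometry ddE ddF invN).
by have [u [ru Eu]] := dim1_unit dimE; exact: (invariant_is_kernel ddE ddF ru Eu invN).
Qed.
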